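(* Let $\mathcal{G}$ be a (discrete) groupoid. Every groupoid dynamical system $\mathcal{A}=(\mathcal{G},\{A_u\}_{u\in\mathcal{G}^{(0)}},\alpha)$ has a $\mathcal{G}$-injective envelope $(I_{\mathcal{G}}(\mathcal{A}),\Upsilon)$, and it is unique up to $\mathcal{G}$-isomorphism (if $(\mathcal{W},\Theta)$ and $(\mathcal{W}',\Theta')$ are $\mathcal{G}$-injective envelopes of $\mathcal{A}$, then $\mathcal{W}$ and $\mathcal{W}'$ are $\mathcal{G}$-isomorphic).
   Context: A groupoid $\mathcal{G}$ is regarded as discrete (no topology); $\mathcal{G}^{(0)}$ is its unit space, $r(g)=gg^{-1}$, $d(g)=g^{-1}g$, and $gh$ is defined iff $d(g)=r(h)$. An operator system is a closed self-adjoint subspace of a unital $C^*$-algebra containing its unit. All completely positive (c.p.) maps are assumed unital. A groupoid dynamical system is a triple $\mathcal{A}=(\mathcal{G},\{A_u\}_{u\in\mathcal{G}^{(0)}},\alpha)$ where each $A_u$ is an operator system, each $\alpha_g:A_{d(g)}\to A_{r(g)}$ ($g\in\mathcal{G}$) is a (unital) complete order isomorphism, and $\alpha_g\alpha_h=\alpha_{gh}$ whenever $gh$ is defined. A $\mathcal{G}$-morphism $\Phi=\{\varphi_u\}_{u\in\mathcal{G}^{(0)}}:(\mathcal{G},\{A_u\},\alpha)\to(\mathcal{G},\{B_u\},\beta)$ is a family of c.p. maps $\varphi_u:A_u\to B_u$ with $\beta_g\circ\varphi_{d(g)}=\varphi_{r(g)}\circ\alpha_g$ for all $g\in\mathcal{G}$;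 composition is defined fibrewise. $\Phi$ is a $\mathcal{G}$-injection (equivalently $\mathcal{G}$-embedding, or $\mathcal{G}$-injective morphism) if every $\varphi_u$ is a complete order injection (a complete order isomorphism onto its image), and a $\mathcal{G}$-isomorphism if every $\varphi_u$ is a complete order isomorphism. A system $\mathcal{W}$ is $\mathcal{G}$-injective if for all systems $\mathcal{B},\mathcal{C}$, every $\mathcal{G}$-injection $\Phi:\mathcal{B}\to\mathcal{C}$ and every $\mathcal{G}$-morphism $\Psi:\mathcal{B}\to\mathcal{W}$, there is a $\mathcal{G}$-morphism $\Theta:\mathcal{C}\to\mathcal{W}$ with $\Theta\circ\Phi=\Psi$. A $\mathcal{G}$-extension of $\mathcal{A}$ is a pair $(\mathcal{W},\Theta)$ with $\Theta:\mathcal{A}\to\mathcal{W}$ a $\mathcal{G}$-embedding. It is $\mathcal{G}$-rigid if every $\mathcal{G}$-morphism $\Phi:\mathcal{W}\to\mathcal{W}$ with $\Phi\circ\Theta=\Theta$ satisfies $\varphi_u=\mathrm{id}_{W_u}$ for all $u$. A $\mathcal{G}$-injective envelope of $\mathcal{A}$ is a $\mathcal{G}$-extension $(\mathcal{W},\Theta)$ of $\mathcal{A}$ such that $\mathcal{W}$ is $\mathcal{G}$-injective and $(\mathcal{W},\Theta)$ is $\mathcal{G}$-rigid. *)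

(* Defs.v *)
From HB Require Import structures.
From mathcomp Require Import all_boot all_order all_algebra.
From mathcomp Require Import complex.
From mathcomp Require Import all_classical all_reals all_analysis.

Set Implicit Arguments.
Unset Strict Implicit.
Unset Printing Implicit Defensive.

Import Order.TTheory GRing.Theory Num.Theory numFieldNormedType.Exports.

Local Open Scope classical_set_scope.
Local Open Scope ring_scope.

(* Unital complex C*-algebras: a Banach space over R[i] with a product, a unit
   and an involution. The product is a field of the mixin, and the ring
   structure is derived below, because Hierarchy Builder admits no structure
   inheriting from both rings and normed modules (no join of the two precedes
   numDomainType). One does not require 1 != 0: the zero algebra is allowed. *)
HB.mixin Record isCStarAlgebra (R : realType) A
    of CompleteNormedModule R[i] A := {
  cmul : A -> A -> A;
  cone : A;
  star : A -> A;
  cmulA : associative cmul;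
  cmul1l : left_id cone cmul;
  cmul1r : right_id cone cmul;
  cmulDl : left_distributive cmul +%R;
  cmulDr : right_distributive cmul +%R;
  cmulZl : forall (c : R[i]) (x y : A), cmul (c *: x) y = c *: cmul x y;
  cmulZr : forall (c : R[i]) (x y : A), cmul x (c *: y) = c *: cmul x y;
  starK : involutive star;
  starD : {morph star : x y / x + y};
  starZ : forall (c : R[i]) (x : A), star (c *: x) = (c^*)%C *: star x;
  starM : forall x y : A, star (cmul x y) = cmul (star y) (star x);
  cnormM : forall x y : A, `|cmul x y| <= `|x| * `|y|;
  cnorm_star : forall x : A, `|cmul (star x) x| = `|x| ^+ 2
}.

#[short(type="cstarAlgType")]
HB.structure Definition CStarAlgebra (R : realType) :=
  {A of CompleteNormedModule R[i] A & isCStarAlgebra R A}.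

HB.instance Definition _ (R : realType) (A : cstarAlgType R) :=
  GRing.Zmodule_isPzRing.Build (CStarAlgebra.sort A)
    (@cmulA R A) (@cmul1l R A) (@cmul1r R A) (@cmulDl R A) (@cmulDr R A).

Record opSystem (R : realType) := OpSystem {
  ambient : cstarAlgType R;
  os_pred : {pred ambient};
  os_submod : submod_closed os_pred;
  os_star : {in os_pred, forall x, star x \in os_pred};
  os_unit : 1 \in os_pred;
  os_closed : closed [set x | x \in os_pred]
}.

HB.instance Definition _ (R : realType) (S : opSystem R) :=
  GRing.isSubmodClosed.Build R[i] (ambient S) (@os_pred R S) (@os_submod R S).

Definition os_sort (R : realType) (S : opSystem R) : Type :=
  {x : ambient S | x \in @os_pred R S}.
Coercion os_sort : opSystem >-> Sortclass.

HB.instance Definition _ (R : realType) (S : opSystem R) :=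
  SubChoice.on (os_sort S).
HB.instance Definition _ (R : realType) (S : opSystem R) :=
  [SubChoice_isSubLmodule of os_sort S by <:].

Definition os_one (R : realType) (S : opSystem R) : S :=
  exist _ 1 (os_unit S).

Section CompletelyPositive.
Variable R : realType.
Implicit Types S T : opSystem R.

(* The cone M_n(S)^+ = M_n(S) \cap M_n(ambient S)^+, an element of the
   C*-algebra M_n(ambient S) being positive iff it has the form Y^* Y. *)
Definition mx_pos S n (X : 'M[S]_n) : Prop :=
  exists Y : 'M[ambient S]_n, map_mx val X = (map_mx (@star R _) Y)^T *m Y.

Definition ucp S T (f : {linear S -> T}) : Prop :=
  f (os_one S) = os_one T /\
  forall n (X : 'M[S]_n), mx_pos X -> mx_pos (map_mx f X).

Definition complete_order_iso S T (f : {linear S -> T}) : Prop :=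
  ucp f /\
  exists g : {linear T -> S}, [/\ ucp g, cancel f g & cancel g f].

(* The last clause says that the inverse of f on its image, ordered as a
   subspace of T, is completely positive. *)
Definition complete_order_injection S T (f : {linear S -> T}) : Prop :=
  [/\ ucp f, injective f &
      forall n (X : 'M[S]_n), mx_pos (map_mx f X) -> mx_pos X].

End CompletelyPositive.

(* Discrete groupoids with the partial product encoded as a total function
   whose values are meaningful only on composable pairs, i.e. pairs (g, h)
   such that g^-1 g = h h^-1; the product is unconstrained elsewhere. *)
Record groupoid := Groupoid {
  arrow :> Type;
  gmul : arrow -> arrow -> arrow;
  ginv : arrow -> arrow;
  gr (g : arrow) : arrow := gmul g (ginv g);
  gd (g : arrow) : arrow := gmul (ginv g) g;
  gr_mul : forall g h, gd g = gr h -> gr (gmul g h) = gr g;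
  gd_mul : forall g h, gd g = gr h -> gd (gmul g h) = gd h;
  gmulA : forall g h k, gd g = gr h -> gd h = gr k ->
    gmul (gmul g h) k = gmul g (gmul h k);
  ginvK : involutive ginv;
  gmulKV : forall g h, gd g = gr h -> gmul (ginv g) (gmul g h) = h;
  gmulVK : forall g h, gd g = gr h -> gmul (gmul g h) (ginv h) = g
}.

Section Units.
Variable G : groupoid.

Definition unit_space : Type := {u : G | exists g : G, u = gr g}.

Definition rng (g : G) : unit_space := exist _ (gr g) (ex_intro _ g erefl).

Fact gd_unit (g : G) : exists h : G, gd g = gr h.
Proof. by exists (ginv g); rewrite /gr ginvK. Qed.

Definition dom (g : G) : unit_space := exist _ (gd g) (gd_unit g).

Fact unit_space_inj (u v : unit_space) : sval u = sval v -> u = v.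
Proof.
case: u v => [u pu] [v pv] /= e; rewrite e in pu *.
by congr exist; exact: Prop_irrelevance.
Qed.

Fact rng_mul (g h : G) : dom g = rng h -> rng (gmul g h) = rng g.
Proof. by move=> /(congr1 sval) e; apply: unit_space_inj; exact: gr_mul. Qed.

Fact dom_mul (g h : G) : dom g = rng h -> dom (gmul g h) = dom h.
Proof. by move=> /(congr1 sval) e; apply: unit_space_inj; exact: gd_mul. Qed.

End Units.

Section Systems.
Variables (R : realType) (G : groupoid).

Definition fib_cast (A : unit_space G -> opSystem R) u v (e : u = v) :
  A u -> A v := eq_rect u (fun w => A u -> A w) id v e.

(* In [act_mul] both sides are compared in the fibre over r(g) = r(gh), after
   identifying the fibres over d(gh) and d(h) and those over r(h) and d(g). *)
Record gsystem := GSystem {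
  fib :> unit_space G -> opSystem R;
  act : forall g : G, {linear fib (dom g) -> fib (rng g)};
  act_iso : forall g : G, complete_order_iso (act g);
  act_mul : forall (g h : G) (e : dom g = rng h) (x : fib (dom (gmul g h))),
    fib_cast (rng_mul e) (act (gmul g h) x) =
    act g (fib_cast (esym e) (act h (fib_cast (dom_mul e) x)))
}.

Record gmorphism (A B : gsystem) := GMorphism {
  gmor :> forall u : unit_space G, {linear A u -> B u};
  gmor_ucp : forall u, ucp (gmor u);
  gmor_equiv : forall (g : G) (x : A (dom g)),
    act B g (gmor (dom g) x) = gmor (rng g) (act A g x)
}.

Definition g_injection (A B : gsystem) (Phi : gmorphism A B) : Prop :=
  forall u, complete_order_injection (Phi u).

Definition g_isomorphism (A B : gsystem) (Phi : gmorphism A B) : Prop :=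
  forall u, complete_order_iso (Phi u).

Definition g_isomorphic (A B : gsystem) : Prop :=
  exists Phi : gmorphism A B, g_isomorphism Phi.

Definition g_injective (W : gsystem) : Prop :=
  forall (B C : gsystem) (Phi : gmorphism B C) (Psi : gmorphism B W),
    g_injection Phi ->
    exists Theta : gmorphism C W, forall u x, Theta u (Phi u x) = Psi u x.

Definition g_rigid (A W : gsystem) (Theta : gmorphism A W) : Prop :=
  forall Phi : gmorphism W W,
    (forall u x, Phi u (Theta u x) = Theta u x) -> forall u x, Phi u x = x.

Definition g_injective_envelope (A W : gsystem) (Theta : gmorphism A W) : Prop :=
  [/\ g_injection Theta, g_injective W & g_rigid Theta].

End Systems.

(* Main.v *)
(* Every system embeds into an injective one that is cofree: its fibre over u is
   the product of the algebras M_n over all arrows k with r(k) = u and all unital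
   completely positive maps A_(d(k)) -> M_n, and G acts by translating k. A
   morphism into it amounts to a family of such maps on the fibres, which extend
   along complete order injections because they correspond to positive
   functionals on M_n(A_v) (Hahn-Banach).

   Among the endomorphisms of this system W fixing A, order by
   P <= Q iff |P w| <= |Q w| for all self-adjoint w. Limits along ultrafilters
   give lower bounds of chains, so Zorn's lemma yields a minimal P. Comparing P
   with the averages of P, P^2, ..., P^(2^m), which send w - P w to 0 in the
   limit, shows that P is idempotent; its image is an injective system, and it is
   rigid because an endomorphism of the image fixing A induces an endomorphism
   below P, hence again minimal, idempotent, and with the same kernel as P. *)
Require Import Defs.
From HB Require Import structures.
From mathcomp Require Import all_boot all_order all_algebra.
From mathcomp Require Import complex.
From mathcomp Require Import all_classical all_reals all_analysis.
From mathcomp Require Import ring lra.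

Set Implicit Arguments.
Unset Strict Implicit.
Unset Printing Implicit Defensive.

Import Order.TTheory GRing.Theory Num.Theory numFieldNormedType.Exports.

Local Open Scope classical_set_scope.
Local Open Scope ring_scope.
Local Open Scope complex_scope.

Local Notation Re := complex.Re.
Local Notation Im := complex.Im.

(** Positivity in M_n(S) is defined by a factorization [star Y * Y], so even its additivity rests on
    M_n(A) being a C*-algebra in which such elements are positive. Both facts are obtained without
    representing A on a Hilbert space: positivity is first expressed by the distance to a scalar,
    square roots come from an iteration, and M_n(A) gets its norm by acting on the Hilbert module
    A^n. The usual injective object B(H) is replaced by a product of finite matrix algebras:
    finite-dimensional targets make extension a question about functionals, and the states of all
    orders together recover the full matrix order. Norms of endomorphisms are compared on
    self-adjoint elements because there the order alone makes a unital positive map contractive; on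
    other elements a factor 2 is lost, which is harmless for boundedness and closedness. The image
    of an idempotent stays an operator system inside the same C*-algebra, with the order it
    inherits. *)

Section LinearIdentity.
Variables (K : comPzRingType) (V : lmodType K).

Inductive lexp :=
  | LAtom of nat | LZero | LAdd of lexp & lexp | LOpp of lexp
  | LScale of K & lexp.

Fixpoint lval (s : seq V) (e : lexp) : V :=
  match e with
  | LAtom n => nth 0 s n
  | LZero => 0
  | LAdd e1 e2 => lval s e1 + lval s e2
  | LOpp e1 => - lval s e1
  | LScale c e1 => c *: lval s e1
  end.

(** [eqn] on numerals reduces under simplification, so that comparing coefficients leaves identities
    between scalars only. *)
Fixpoint lcoef (k : nat) (e : lexp) : K :=
  match e with
  | LAtom n => if eqn n k then 1 else 0
  | LZero => 0
  | LAdd e1 e2 => lcoef k e1 + lcoef k e2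
  | LOpp e1 => - lcoef k e1
  | LScale c e1 => c * lcoef k e1
  end.

Fixpoint lcoefs_eq (n : nat) (e1 e2 : lexp) : Prop :=
  if n is m.+1 then lcoef m e1 = lcoef m e2 /\ lcoefs_eq m e1 e2 else True.

Lemma lvalE s e : lval s e = \sum_(k < size s) lcoef k e *: nth 0 s k.
Proof.
elim: e => [n||e1 ih1 e2 ih2|e1 ih1|c e1 ih1] /=.
- case: (ltnP n (size s)) => [ns|ns].
    rewrite (bigD1 (Ordinal ns)) //= ?eqnE eqxx scale1r big1 ?addr0 // => i.
    by rewrite -val_eqE /= ?eqnE eq_sym => /negbTE ->; rewrite scale0r.
  rewrite nth_default // big1 // => i _; rewrite ?eqnE gtn_eqF ?scale0r //.
  exact: leq_trans (ltn_ord i) ns.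
- by rewrite big1 // => i _; rewrite scale0r.
- by rewrite ih1 ih2 -big_split; apply: eq_bigr => i _; rewrite scalerDl.
- by rewrite ih1 -sumrN; apply: eq_bigr => i _; rewrite scaleNr.
- by rewrite ih1 scaler_sumr; apply: eq_bigr => i _; rewrite scalerA.
Qed.

Lemma lcoefs_eqP s e1 e2 : lcoefs_eq (size s) e1 e2 -> lval s e1 = lval s e2.
Proof.
move=> h; rewrite !lvalE; apply: eq_bigr => i _; congr (_ *: _).
case: i => i /=; elim: (size s) h => //= n ih [h hn].
by rewrite ltnS leq_eqVlt => /orP[/eqP -> //|]; exact: ih.
Qed.

End LinearIdentity.

(* [lmod R] proves linear identities in an R[i]-module by comparing the
   coefficients of the atoms. *)
Ltac lmod_mem x l :=
  match l with
  | nil => constr:(false)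
  | cons ?y _ => let _ := match goal with _ => unify x y end in constr:(true)
  | cons _ ?l' => lmod_mem x l'
  end.

Ltac lmod_index x l :=
  match l with
  | cons ?y _ => let _ := match goal with _ => unify x y end in constr:(0%N)
  | cons _ ?l' => let n := lmod_index x l' in constr:(S n)
  end.

Ltac lmod_atoms t l :=
  lazymatch t with
  | (?a + ?b)%R => let l1 := lmod_atoms a l in lmod_atoms b l1
  | (- ?a)%R => lmod_atoms a l
  | GRing.scale _ ?a => lmod_atoms a l
  | GRing.zero => l
  | _ => lazymatch lmod_mem t l with
         | true => l
         | false => constr:(cons t l)
         end
  end.

Ltac lmod_reify K t l :=
  lazymatch t with
  | (?a + ?b)%R =>
      let ea := lmod_reify K a l in let eb := lmod_reify K b l in
      constr:(@LAdd K ea eb)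
  | (- ?a)%R => let ea := lmod_reify K a l in constr:(@LOpp K ea)
  | GRing.scale ?c ?a => let ea := lmod_reify K a l in constr:(@LScale K c ea)
  | GRing.zero => constr:(@LZero K)
  | _ => let n := lmod_index t l in constr:(@LAtom K n)
  end.

Ltac lmod_core K :=
  lazymatch goal with
  | |- @eq ?V ?a ?b =>
      let l0 := lmod_atoms a (@nil V) in
      let l := lmod_atoms b l0 in
      let ea := lmod_reify K a l in
      let eb := lmod_reify K b l in
      apply: (@lcoefs_eqP K _ l ea eb); rewrite /=; repeat split
  end.

Ltac lmod R :=
  lmod_core constr:((R[i])%C : comPzRingType); try ring; try by field.

Definition lin_of (K : pzRingType) (U V : lmodType K) (f : U -> V)
    (h : linear f) : {linear U -> V} :=
  HB.pack_for {linear U -> V} f (GRing.isLinear.Build K U V *:%R f h).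

(** * Square roots and positive elements of a C*-algebra *)

Lemma ler_eps (R : realType) (a b : R) :
  (forall e : R, 0 < e -> a <= b + e) -> a <= b.
Proof. by move=> h; apply/ler_addgt0Pr => e; exact: h. Qed.

Section Norm.
Variables (R : realType) (A : cstarAlgType R).
Implicit Types (x y z : A) (c : R[i]) (t : R).

(** The norm of a module over [R[i]] takes its values in [R[i]]; its real part makes real arithmetic
    available. *)
Definition nrm x : R := Re `|x|.

Lemma nrmE x : `|x| = (nrm x)%:C.
Proof. by rewrite /nrm RRe_real // normr_real. Qed.

Lemma nrm_ge0 x : 0 <= nrm x.
Proof. by rewrite -lecR -nrmE normr_ge0. Qed.

Lemma nrm0 : nrm 0 = 0.
Proof. by rewrite /nrm normr0. Qed.

Lemma nrm_eq0 x : nrm x = 0 -> x = 0.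
Proof. by move=> h; apply/eqP; rewrite -normr_eq0 nrmE h. Qed.

Lemma nrm_le0 x : nrm x <= 0 -> x = 0.
Proof. by move=> h; apply/nrm_eq0/le_anti; rewrite h nrm_ge0. Qed.

Lemma nrmD x y : nrm (x + y) <= nrm x + nrm y.
Proof. by rewrite -lecR rmorphD /= -!nrmE ler_normD. Qed.

Lemma nrmN x : nrm (- x) = nrm x.
Proof. by rewrite /nrm normrN. Qed.

Lemma nrmBC x y : nrm (x - y) = nrm (y - x).
Proof. by rewrite -nrmN opprB. Qed.

Lemma nrmB x y : nrm (x - y) <= nrm x + nrm y.
Proof. by rewrite -(nrmN y) nrmD. Qed.

Lemma nrm_tri y x z : nrm (x - z) <= nrm (x - y) + nrm (y - z).
Proof. by rewrite -{1}(subrK y x) -addrA nrmD. Qed.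

Lemma nrmZ c x : nrm (c *: x) = Normc.normc c * nrm x.
Proof.
apply: (@complexI R); rewrite rmorphM /= -!nrmE normrZ; congr (_ * _).
Qed.

Lemma nrmZr t x : nrm (t%:C *: x) = `|t| * nrm x.
Proof. by rewrite nrmZ /= expr0n addr0 sqrtr_sqr. Qed.

Lemma nrmZi x : nrm ('i *: x) = nrm x.
Proof. by rewrite nrmZ /= expr0n add0r expr1n sqrtr1 mul1r. Qed.

Lemma nrmM x y : nrm (x * y) <= nrm x * nrm y.
Proof. by rewrite -lecR rmorphM /= -!nrmE cnormM. Qed.

Lemma nrm_starM x : nrm (star x * x) = nrm x ^+ 2.
Proof. by apply: (@complexI R); rewrite rmorphXn /= -!nrmE cnorm_star. Qed.

Lemma mulZl c x y : (c *: x) * y = c *: (x * y).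
Proof. exact: cmulZl. Qed.

Lemma mulZr c x y : x * (c *: y) = c *: (x * y).
Proof. exact: cmulZr. Qed.

Lemma star0 : star (0 : A) = 0.
Proof. by apply: (addIr (star 0)); rewrite -starD !add0r. Qed.

Lemma starN x : star (- x) = - star x.
Proof. by apply/eqP; rewrite -addr_eq0 -starD addNr star0. Qed.

Lemma starB x y : star (x - y) = star x - star y.
Proof. by rewrite starD starN. Qed.

Lemma starMr x y : star (x * y) = star y * star x.
Proof. exact: starM. Qed.

Lemma star1 : star (1 : A) = 1.
Proof. by rewrite -[LHS]mulr1 -{2}(starK (1 : A)) -starMr mulr1 starK. Qed.

Lemma starZr t x : star (t%:C *: x) = t%:C *: star x.
Proof. by rewrite starZ conjc_real. Qed.

Lemma starZi x : star ('i *: x) = - ('i *: star x).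
Proof. by rewrite starZ -scaleNr; congr (_ *: _); simpc. Qed.

Lemma star_sum (I : Type) (r : seq I) (P : pred I) (F : I -> A) :
  star (\sum_(i <- r | P i) F i) = \sum_(i <- r | P i) star (F i).
Proof. exact: (big_morph _ (@starD R A) star0). Qed.

(** The C*-identity gives |y|^2 = |star y * y| <= |star y| |y|. *)
Lemma nrm_star x : nrm (star x) = nrm x.
Proof.
suff h y : nrm y <= nrm (star y) by apply/le_anti; rewrite h -{2}(starK x) h.
have := nrm_starM y; have := nrmM (star y) y; have := nrm_ge0 y.
have := nrm_ge0 (star y); nra.
Qed.

(** |1|^2 = |1|; equality with 1 fails in the zero algebra. *)
Lemma nrm1_le : nrm (1 : A) <= 1.
Proof.
have := nrm_starM 1; rewrite star1 mul1r.
have := nrm_ge0 (1 : A); nra.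
Qed.

Lemma nrm_scalar t : nrm (t%:C *: (1 : A)) <= `|t|.
Proof. by rewrite nrmZr ler_piMr // nrm1_le. Qed.

Lemma nrm_sa x : star x = x -> nrm (x * x) = nrm x ^+ 2.
Proof. by move=> sx; rewrite -nrm_starM sx. Qed.

Lemma nrm_sum (I : Type) (r : seq I) (P : pred I) (F : I -> A) :
  nrm (\sum_(i <- r | P i) F i) <= \sum_(i <- r | P i) nrm (F i).
Proof.
elim/big_rec2: _ => [|i s y _ h]; first by rewrite nrm0.
by apply: le_trans (nrmD _ _) _; rewrite lerD2l.
Qed.

Definition nlim (u : nat -> A) (l : A) :=
  forall e : R, 0 < e -> exists n0, forall n, (n0 <= n)%N -> nrm (u n - l) <= e.

Lemma cstar_complete (u : nat -> A) :
  (forall e : R, 0 < e -> exists n0, forall m n, (n0 <= m)%N -> (n0 <= n)%N ->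
     nrm (u m - u n) <= e) -> exists l, nlim u l.
Proof.
move=> cu.
have cvu : cvg (u @ \oo).
  apply: cauchy_cvg; apply/cauchy_ballP => _/posnumP[e].
  have e0 : 0 < Re e%:num / 2.
    by have := [gt0 of e%:num : R[i]]; rewrite ltcE /= => /andP[_ ?]; lra.
  have [n0 h] := cu _ e0.
  exists ([set` [set x | exists2 n, (n0 <= n)%N & x = u n]],
     [set` [set x | exists2 n, (n0 <= n)%N & x = u n]]) => /=.
    by split; exists n0 => // n /= nn; rewrite inE; exists n.
  move=> [a b] /= []; rewrite !inE => -[m m0 ->] [n nn0 ->].
  rewrite -ball_normE /ball_ /= nrmE.
  have : nrm (u m - u n) < Re e%:num by have := h _ _ m0 nn0; lra.
  rewrite -ltcR; move/lt_le_trans; apply.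
  by rewrite RRe_real // realE ltW.
exists (lim (u @ \oo)) => e e0.
have ec0 : 0 < e%:C by rewrite ltcR.
have /cvgrPdist_le /(_ _ ec0) [n0 _ h] := cvu.
exists n0 => n nn0; have := h n nn0.
by rewrite nrmE lecR nrmBC.
Qed.

End Norm.

Section Sqrt.
Variables (R : realType) (A : cstarAlgType R).
Implicit Types (x y z b T : A) (t e : R).

Lemma nrm_small x (K : R) : (forall e, 0 < e -> nrm x <= K * e) -> x = 0.
Proof.
move=> h; apply: nrm_le0; rewrite leNgt; apply/negP => x0.
have K0 : 0 < K.
  by have := h 1 ltr01; rewrite mulr1; apply: lt_le_trans.
have /h : 0 < nrm x / (2 * K) by rewrite divr_gt0 // mulr_gt0.
have -> : K * (nrm x / (2 * K)) = nrm x / 2 by field; rewrite gt_eqF.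
by lra.
Qed.

Lemma nrm_half x : nrm ((2^-1)%:C *: x) = nrm x / 2.
Proof. by rewrite nrmZr ger0_norm ?invr_ge0 // mulrC. Qed.

Lemma scale_halfD x : (2^-1)%:C *: (x + x) = x.
Proof.
rewrite -{1 2}[x]scale1r -scalerDl scalerA -[X in X *: _]/((2^-1)%:C * (1 + 1)).
rewrite -(rmorph1 (real_complex R)) -rmorphD -rmorphM /= -mulr2n mulVf //.
by rewrite rmorph1 scale1r.
Qed.

(** The case T = 1 of the iteration [sqY] below. It is bounded by 1 and dominates the terms and the
    increments of [sqY], so a bounded scalar sequence gives the convergence, even in the boundary
    case |T| = 1. *)
Fixpoint sqy (n : nat) : R :=
  if n is m.+1 then (1 + sqy m * sqy m) / 2 else 0.

Lemma sqy_bnd n : 0 <= sqy n <= 1.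
Proof. by elim: n => [|n /= /andP[h0 h1]]; [rewrite lexx ler01 | apply/andP; split; nra]. Qed.

Lemma sqy_cauchy e : 0 < e -> exists n0, forall n, (n0 <= n)%N ->
  sqy n - sqy n0 <= e.
Proof.
move=> e0.
have hs : has_sup (range sqy).
  split; first by exists (sqy 0); exists 0%N.
  by exists 1 => _ [n _ <-]; case/andP: (sqy_bnd n).
have [_ [n0 _ <-] h] := sup_adherent e0 hs.
exists n0 => n _.
have : sqy n <= sup (range sqy) by apply: sup_upper_bound => //; exists n.
lra.
Qed.

Section SqrtSeq.
Variable T : A.
Hypotheses (saT : star T = T) (T1 : nrm T <= 1).

Fixpoint sqY (n : nat) : A :=
  if n is m.+1 then (2^-1)%:C *: (T + sqY m * sqY m) else 0.

Lemma sqY_sa n : star (sqY n) = sqY n.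
Proof.
elim: n => [|n ih] /=; first exact: star0.
by rewrite starZr starD starMr ih saT.
Qed.

Lemma sqY_comm b : b * T = T * b -> forall n, b * sqY n = sqY n * b.
Proof.
move=> bT; elim=> [|n ih] /=; first by rewrite mulr0 mul0r.
by rewrite mulZr mulZl mulrDr mulrDl bT mulrA ih -mulrA ih mulrA.
Qed.

Lemma sqY_le n : nrm (sqY n) <= sqy n.
Proof.
elim: n => [|n ih] /=; first by rewrite nrm0.
rewrite nrm_half ler_pM2r ?invr_gt0 //.
apply: le_trans (nrmD _ _) _; apply: lerD => //.
by apply: le_trans (nrmM _ _) _; apply: ler_pM; rewrite ?nrm_ge0.
Qed.

(* Y_(n+1)^2 - Y_n^2 = Y_(n+1) (Y_(n+1) - Y_n) + (Y_(n+1) - Y_n) Y_n *)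
Lemma sqY_diff n : nrm (sqY n.+1 - sqY n) <= sqy n.+1 - sqy n.
Proof.
elim: n => [|n ih].
  rewrite /= !mulr0 !addr0 !subr0 nrm_half.
  by rewrite ler_pM2r ?invr_gt0.
rewrite -[sqY n.+2]/((2^-1)%:C *: (T + sqY n.+1 * sqY n.+1)).
rewrite -[X in nrm (_ - X)]/((2^-1)%:C *: (T + sqY n * sqY n)) -scalerBr nrm_half.
rewrite opprD addrACA subrr add0r.
have -> : sqY n.+1 * sqY n.+1 - sqY n * sqY n =
    sqY n.+1 * (sqY n.+1 - sqY n) + (sqY n.+1 - sqY n) * sqY n.
  by rewrite mulrBr mulrBl addrA subrK.
set y1 := sqy n.+1; set y0 := sqy n; set D := sqY n.+1 - sqY n.
have h1 : nrm (sqY n.+1 * D) <= y1 * (y1 - y0).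
  by apply: le_trans (nrmM _ _) _; apply: ler_pM; rewrite ?nrm_ge0 ?sqY_le.
have h2 : nrm (D * sqY n) <= (y1 - y0) * y0.
  by apply: le_trans (nrmM _ _) _; apply: ler_pM; rewrite ?nrm_ge0 ?sqY_le.
have h3 := nrmD (sqY n.+1 * D) (D * sqY n).
have -> : sqy n.+2 - y1 = ((1 + y1 * y1) - (1 + y0 * y0)) / 2 by rewrite mulrBl.
by rewrite ler_pM2r ?invr_gt0 //; nra.
Qed.

Lemma sqY_cauchy m n : (m <= n)%N -> nrm (sqY n - sqY m) <= sqy n - sqy m.
Proof.
move=> /subnK <-; elim: (n - m)%N => [|k ih]; first by rewrite !subrr nrm0.
by rewrite addSn; have := nrm_tri (sqY (k + m)) (sqY (k + m).+1) (sqY m);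
  have := sqY_diff (k + m); lra.
Qed.

(* The limit Y satisfies Y = (T + Y^2)/2, that is (1 - Y)^2 = 1 - T. *)
Lemma sqrt_exists : exists Z, [/\ star Z = Z, Z * Z = 1 - T, nrm (1 - Z) <= 1 &
  forall b, b * T = T * b -> b * Z = Z * b].
Proof.
have [Y hY] : exists Y, nlim sqY Y.
  apply: cstar_complete => e e0.
  have [n0 h] := sqy_cauchy (divr_gt0 e0 (ltr0Sn R 1)).
  exists n0 => m n mm nn.
  have := nrm_tri (sqY n0) (sqY m) (sqY n).
  rewrite [nrm (sqY n0 - _)]nrmBC.
  have := sqY_cauchy mm; have := sqY_cauchy nn.
  have := h _ mm; have := h _ nn; lra.
have Yle n : nrm (sqY n) <= 1.
  by apply: le_trans (sqY_le n) _; case/andP: (sqy_bnd n).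
have Y1 : nrm Y <= 1.
  rewrite leNgt; apply/negP => Y1.
  have e0 : 0 < (nrm Y - 1) / 2 by lra.
  have [n0 /(_ _ (leqnn n0)) h] := hY _ e0.
  have := nrmD (sqY n0) (Y - sqY n0); rewrite addrC subrK [nrm (Y - _)]nrmBC.
  by have := Yle n0; lra.
have YS : star Y = Y.
  apply/eqP; rewrite -subr_eq0; apply/eqP/(@nrm_small _ 2) => e e0.
  have [n0 /(_ _ (leqnn n0)) h] := hY _ e0.
  have := nrm_tri (sqY n0) (star Y) Y.
  by rewrite -{1}(sqY_sa n0) -starB nrm_star [nrm (Y - _)]nrmBC; lra.
have YY : Y * Y = Y + Y - T.
  apply/eqP; rewrite -subr_eq0; apply/eqP/(@nrm_small _ 4) => e e0.
  have [n0 h] := hY _ e0.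
  have h0 := h _ (leqnn n0); have h1 := h _ (leqnSn n0).
  (* The recursion gives T = 2 Y_(n0+1) - Y_n0^2. *)
  have -> : Y * Y - (Y + Y - T) =
     - ((sqY n0 - Y) * Y + sqY n0 * (sqY n0 - Y)) +
     ((sqY n0.+1 - Y) + (sqY n0.+1 - Y)).
    rewrite /= mulrBl mulrBr; lmod R.
  have := nrmD (- ((sqY n0 - Y) * Y + sqY n0 * (sqY n0 - Y)))
     ((sqY n0.+1 - Y) + (sqY n0.+1 - Y)).
  rewrite nrmN.
  have := nrmD ((sqY n0 - Y) * Y) (sqY n0 * (sqY n0 - Y)).
  have := nrmD (sqY n0.+1 - Y) (sqY n0.+1 - Y).
  have := nrmM (sqY n0 - Y) Y; have := nrmM (sqY n0) (sqY n0 - Y).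
  have : nrm (sqY n0 - Y) * nrm Y <= e * 1 by apply: ler_pM; rewrite ?nrm_ge0.
  have : nrm (sqY n0) * nrm (sqY n0 - Y) <= 1 * e by apply: ler_pM; rewrite ?nrm_ge0.
  by lra.
exists (1 - Y); split.
- by rewrite starB star1 YS.
- by rewrite mulrBl mul1r mulrBr mulr1 YY; lmod R.
- by rewrite opprB addrC subrK.
- move=> b bT; rewrite mulrBl mulrBr mul1r mulr1; congr (_ - _).
  apply/eqP; rewrite -subr_eq0; apply/eqP/(@nrm_small _ (2 * nrm b)) => e e0.
  have [n0 /(_ _ (leqnn n0)) h] := hY _ e0.
  have -> : b * Y - Y * b = (sqY n0 - Y) * b - b * (sqY n0 - Y).
    by rewrite mulrBl mulrBr sqY_comm //; lmod R.
  have := nrmB ((sqY n0 - Y) * b) (b * (sqY n0 - Y)).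
  have := nrmM (sqY n0 - Y) b; have := nrmM b (sqY n0 - Y).
  have : nrm b * nrm (sqY n0 - Y) <= nrm b * e by rewrite ler_wpM2l ?nrm_ge0.
  by lra.
Qed.

End SqrtSeq.
End Sqrt.

Section Positive.
Variables (R : realType) (A : cstarAlgType R).
Implicit Types (x y z a b h p : A) (t c e : R).
Local Notation sc t := (t%:C *: (1 : A)).

(* For self-adjoint [x], being within distance [t] of the scalar [t] says that
   the spectrum lies in [0, 2t]; in this form positivity is visibly additive. *)
Definition cpos x := star x = x /\ exists2 t, 0 <= t & nrm (sc t - x) <= t.

Lemma star_sc t : star (sc t) = sc t.
Proof. by rewrite starZr star1. Qed.

Lemma mul_sc t x : sc t * x = t%:C *: x.
Proof. by rewrite mulZl mul1r. Qed.

Lemma mulr_sc t x : x * sc t = t%:C *: x.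
Proof. by rewrite mulZr mulr1. Qed.

Lemma scD t c : sc (t + c) = sc t + sc c.
Proof. by rewrite rmorphD scalerDl. Qed.

Lemma cpos_sa x : cpos x -> star x = x. Proof. by case. Qed.

Lemma cpos0 : cpos 0.
Proof. by split; [exact: star0 | exists 0 => //; rewrite scale0r subrr nrm0]. Qed.

Lemma cposD x y : cpos x -> cpos y -> cpos (x + y).
Proof.
move=> [sx [t t0 ht]] [sy [c c0 hc]]; split; first by rewrite starD sx sy.
exists (t + c); first exact: addr_ge0.
have -> : sc (t + c) - (x + y) = (sc t - x) + (sc c - y) by rewrite scD; lmod R.
by apply: le_trans (nrmD _ _) _; apply: lerD.
Qed.

Lemma cposZ t x : 0 <= t -> cpos x -> cpos (t%:C *: x).
Proof.
move=> t0 [sx [c c0 hc]]; split; first by rewrite starZr sx.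
exists (t * c); first exact: mulr_ge0.
by rewrite rmorphM -scalerA -scalerBr nrmZr ger0_norm // ler_wpM2l.
Qed.

Lemma cpos_sum (I : Type) (r : seq I) (P : pred I) (F : I -> A) :
  (forall i, P i -> cpos (F i)) -> cpos (\sum_(i <- r | P i) F i).
Proof. by move=> h; elim/big_ind: _; [exact: cpos0 | exact: cposD | ]. Qed.

Lemma cpos_subl x t : star x = x -> nrm x <= t -> cpos (sc t - x).
Proof.
move=> sx xt; split; first by rewrite starB star_sc sx.
exists t; first exact: le_trans (nrm_ge0 _) xt.
by have -> : sc t - (sc t - x) = x by lmod R.
Qed.

(** With t from the definition, T = 1 - x / t has norm at most 1, and the root of 1 - T = x / t is
    rescaled by sqrt t. It is positive because [sqrt_exists] keeps it within distance 1 of the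
    unit. *)
Lemma cpos_sqrt x : cpos x -> exists z, [/\ star z = z, z * z = x, cpos z &
  forall b, b * x = x * b -> b * z = z * b].
Proof.
move=> [sx [t t0 ht]]; case: (eqVneq t 0) => [tz|tn0].
  have -> : x = 0.
    by apply: nrm_le0; move: ht; rewrite tz scale0r sub0r nrmN.
  by exists 0; split; rewrite ?star0 ?mulr0 //; exact: cpos0.
have tp : 0 < t by rewrite lt_def tn0.
pose T := 1 - (t^-1)%:C *: x.
have eT : T = (t^-1)%:C *: (sc t - x).
  rewrite scalerBr scalerA -rmorphM mulVf //.
  by rewrite rmorph1 scale1r.
have sT : star T = T by rewrite starB star1 starZr sx.
have T1 : nrm T <= 1.
  by rewrite eT nrmZr ger0_norm ?invr_ge0 // mulrC ler_pdivrMr // mul1r.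
have [z [sz zz z1 zc]] := sqrt_exists sT T1.
pose s := Num.sqrt t.
have ss : s * s = t by rewrite -expr2 sqr_sqrtr.
exists (s%:C *: z); split.
- by rewrite starZr sz.
- rewrite mulZl mulZr scalerA -rmorphM ss zz /T opprB addrC subrK.
  by rewrite scalerA -rmorphM mulfV // rmorph1 scale1r.
- apply: cposZ; rewrite ?sqrtr_ge0 //; split => //.
  by exists 1 => //; rewrite rmorph1 scale1r.
- move=> b bx; rewrite mulZr mulZl zc //.
  by rewrite /T mulrBr mulrBl mulr1 mul1r mulZl mulZr bx.
Qed.

(* Writing 1 - h^2 = z^2, the element h + i z is unitary, so z is a
   contraction. *)
Lemma nrm_1Bsqr h : star h = h -> nrm h <= 1 -> nrm (1 - h * h) <= 1.
Proof.
move=> sh h1.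
have sT : star (h * h) = h * h by rewrite starMr sh.
have T1 : nrm (h * h) <= 1.
  by rewrite nrm_sa // exprn_ile1 // nrm_ge0.
have [z [sz zz z1 zc]] := sqrt_exists sT T1.
have hz : h * z = z * h by apply: zc; rewrite mulrA.
pose u := h + 'i *: z.
have su : star u = h - 'i *: z by rewrite starD sh starZi sz.
have uu : star u * u = 1.
  rewrite su /u mulrBl !mulrDr !mulZl !mulZr scalerA hz zz.
  have -> : 'i * 'i = -1 :> R[i] by rewrite -expr2 sqr_i.
  by lmod R.
have u1 : nrm u <= 1.
  have := nrm_starM u; rewrite uu => e; have := nrm1_le A.
  by have := nrm_ge0 u; nra.
have z2 : nrm z <= 1.
  have e : ('i *: z) + ('i *: z) = u - star u by rewrite su /u; lmod R.
  have := nrmB u (star u); rewrite -e nrm_star.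
  have -> : 'i *: z + 'i *: z = (2%:R : R)%:C *: ('i *: z).
    by rewrite rmorph_nat scaler_nat mulr2n.
  by rewrite nrmZr nrmZi ger0_norm //; lra.
rewrite -zz; apply: le_trans (nrmM _ _) _.
by have := nrm_ge0 z; nra.
Qed.

(** For h of norm 1 this is [nrm_1Bsqr]; rescaling gives the scalar |h|^2. *)
Lemma cpos_sqr h : star h = h -> cpos (h * h).
Proof.
move=> sh; split; first by rewrite starMr sh.
case: (eqVneq (nrm h) 0) => [h0|hn0].
  by exists 0 => //; rewrite (nrm_eq0 h0) mulr0 subr0 scale0r nrm0.
have hp : 0 < nrm h by rewrite lt_def hn0 nrm_ge0.
pose k := ((nrm h)^-1)%:C *: h.
have /nrm_1Bsqr : star k = k by rewrite starZr sh.
rewrite nrmZr ger0_norm ?invr_ge0 ?nrm_ge0 // mulVf // lexx => /(_ isT) k1.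
exists (nrm h * nrm h); first by rewrite mulr_ge0 // nrm_ge0.
have -> : sc (nrm h * nrm h) - h * h = (nrm h * nrm h)%:C *: (1 - k * k).
  rewrite scalerBr mulZl mulZr !scalerA -!rmorphM mulrA mulrK ?mulfV ?unitfE //.
  by rewrite rmorph1 scale1r.
by rewrite nrmZr ger0_norm ?mulr_ge0 ?nrm_ge0 // ler_piMr // mulr_ge0 ?nrm_ge0.
Qed.

Lemma cpos_scalar t : 0 <= t -> cpos (sc t).
Proof.
move=> t0; apply: cposZ => //; rewrite -[1](mulr1 1).
by apply: cpos_sqr; exact: star1.
Qed.

(* Writing p = z^2 and t - p = w^2 with z, w commuting, the norm of z is at most
   that of z + i w, whose square is t. *)
Lemma nrm_le_scalar p t : 0 <= t -> cpos p -> cpos (sc t - p) -> nrm p <= t.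
Proof.
move=> t0 pp pt.
have [z [sz zz _ zc]] := cpos_sqrt pp.
have [w [sw ww _ wc]] := cpos_sqrt pt.
have zw : z * w = w * z.
  by apply: wc; rewrite mulrBr mulrBl mulr_sc mul_sc -zz mulrA.
pose u := z + 'i *: w.
have su : star u = z - 'i *: w by rewrite starD sz starZi sw.
have uu : star u * u = sc t.
  rewrite su /u mulrBl !mulrDr !mulZl !mulZr scalerA zw ww zz.
  have -> : 'i * 'i = -1 :> R[i] by rewrite -expr2 sqr_i.
  by lmod R.
have u1 : nrm u ^+ 2 <= t.
  by rewrite -nrm_starM uu; apply: le_trans (nrm_scalar _ _) _; rewrite ger0_norm.
have z2 : nrm z <= nrm u.
  have e : z + z = u + star u by rewrite su /u; lmod R.
  have := nrmD u (star u); rewrite -e nrm_star.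
  have -> : z + z = (2%:R : R)%:C *: z by rewrite rmorph_nat scaler_nat mulr2n.
  by rewrite nrmZr ger0_norm //; lra.
rewrite -zz nrm_sa //; apply: le_trans u1.
by rewrite ler_pXn2r // nnegrE nrm_ge0.
Qed.

Lemma cpos_anti x : cpos x -> cpos (- x) -> x = 0.
Proof.
move=> px nx; apply: nrm_le0; apply: nrm_le_scalar => //.
by rewrite scale0r sub0r.
Qed.

(** In [cpos] the scalar merely exists; [nrm_le_scalar] applied to t - x shows that every bound on
    the norm serves. *)
Lemma cpos_scB x t : cpos x -> nrm x <= t -> nrm (sc t - x) <= t.
Proof.
move=> px xt; have t0 := le_trans (nrm_ge0 _) xt.
apply: nrm_le_scalar => //; first exact: cpos_subl (cpos_sa px) xt.
by have -> : sc t - (sc t - x) = x by lmod R.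
Qed.

Lemma nrm_mono p x : cpos p -> cpos (x - p) -> nrm p <= nrm x.
Proof.
move=> pp px; apply: (nrm_le_scalar (nrm_ge0 _) pp).
have sx : star x = x.
  by have := cposD pp px; rewrite addrC subrK; exact: cpos_sa.
have -> : sc (nrm x) - p = (sc (nrm x) - x) + (x - p) by lmod R.
exact: cposD (cpos_subl sx (lexx _)) px.
Qed.

(** The scalar |x| + 1 serves all x + d with 0 < d <= 1 at once, so the inequality in [cpos]
    survives the limit d -> 0. *)
Lemma cpos_arch x : star x = x -> (forall e, 0 < e -> cpos (x + sc e)) -> cpos x.
Proof.
move=> sx h; split => //.
have n0 := nrm_ge0 x.
exists (nrm x + 1); first by lra.
apply: ler_eps => e e0.
pose d := Num.min e 1.
have d0 : 0 < d by rewrite lt_min e0 ltr01.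
have de : d <= e by rewrite ge_min lexx.
have d1 : d <= 1 by rewrite ge_min lexx orbT.
have hd : nrm (x + sc d) <= nrm x + 1.
  apply: le_trans (nrmD _ _) _; rewrite lerD2l; apply: le_trans (nrm_scalar _ _) _.
  by rewrite (ger0_norm (ltW d0)).
have := cpos_scB (h _ d0) hd.
have -> : sc (nrm x + 1) - x = (sc (nrm x + 1) - (x + sc d)) + sc d by lmod R.
have := nrmD (sc (nrm x + 1) - (x + sc d)) (sc d).
by have := nrm_scalar A d; rewrite (ger0_norm (ltW d0)); lra.
Qed.

(* With m the square root of a^2 and b = m - a one has b a b = - m b^2 <= 0 and
   b^3 = 2 m b^2. *)
Lemma cpos_of_flank a : star a = a ->
  (forall b, star b = b -> cpos (- (b * a * b)) -> b * a * b = 0) -> cpos a.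
Proof.
move=> sa h.
have [m [sm mm pm mc]] := cpos_sqrt (cpos_sqr sa).
have am : a * m = m * a by apply: mc; rewrite mulrA.
pose b := m - a.
have sb : star b = b by rewrite starB sm sa.
have bm : b * m = m * b by rewrite /b mulrBl mulrBr am.
have ba : b * a = - (m * b).
  by rewrite /b mulrBl mulrBr mm opprB.
have [z [sz zz _ zc]] := cpos_sqrt pm.
have zb : b * z = z * b by apply: zc.
have bab : b * a * b = - ((z * b) * (z * b)).
  by rewrite ba mulNr -zz; congr (- _); rewrite -[RHS]mulrA [b * (z * b)]mulrA zb !mulrA.
have szb : star (z * b) = z * b by rewrite starMr sb sz.
have bab0 : b * a * b = 0 by apply: h => //; rewrite bab opprK; exact: cpos_sqr.
have mbb : m * b * b = 0.
  by have := bab0; rewrite ba mulNr => /eqP; rewrite oppr_eq0 => /eqP.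
have bb : b * b = m * b + m * b.
  by rewrite /b !mulrBl !mulrBr am mm; lmod R.
have b3 : b * b * b = 0 by rewrite bb mulrDl mbb addr0.
have b4 : (b * b) * (b * b) = 0 by rewrite mulrA b3 mul0r.
have bb0 : b * b = 0.
  apply: nrm_eq0; apply/eqP; rewrite -sqrf_eq0 -nrm_sa ?b4 ?nrm0 //.
  by rewrite starMr sb.
have b0 : b = 0.
  by apply: nrm_eq0; apply/eqP; rewrite -sqrf_eq0 -nrm_sa // bb0 nrm0.
by have /eqP := b0; rewrite subr_eq0 => /eqP <-.
Qed.

(** With x = h + i k and h, k self-adjoint, the sum is 2 h^2 + 2 k^2. *)
Lemma cpos_star_sum x : cpos (star x * x + x * star x).
Proof.
pose h := (2^-1)%:C *: (x + star x).
pose k := (2^-1)%:C *: ('i *: (star x - x)).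
have sh : star h = h by rewrite starZr starD starK addrC.
have sk : star k = k by rewrite starZr starZi starB starK -scalerN opprB.
have -> : star x * x + x * star x = (h * h + k * k) + (h * h + k * k).
  have ii : 'i * 'i = -1 :> R[i] by rewrite -expr2 sqr_i.
  have hh : h * h = ((2^-1)%:C * (2^-1)%:C) *: ((x + star x) * (x + star x)).
    by rewrite mulZl mulZr scalerA.
  have kk : k * k =
      - ((2^-1)%:C * (2^-1)%:C) *: ((star x - x) * (star x - x)).
    rewrite /k !mulZl !mulZr !scalerA; congr (_ *: _).
    by rewrite -mulrN1 -ii; ring.
  by rewrite hh kk !mulrDl !mulrDr !mulrN !mulNr; lmod R.
by apply: cposD; apply: cposD; exact: cpos_sqr.
Qed.

(* With c = star x * x = - z^2 and d = x * star x, the element w = z * star x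
   satisfies star w * w = - d^2 and w * star w = - c^2. *)
Lemma neg_star_mul x : cpos (- (star x * x)) -> x = 0.
Proof.
move=> px.
have [z [sz zz _ _]] := cpos_sqrt px.
pose d := x * star x; pose c := star x * x.
have sd : star d = d by rewrite starMr starK.
have scc : star c = c by rewrite starMr starK.
have := cpos_star_sum (z * star x).
have -> : star (z * star x) * (z * star x) = - (d * d).
  rewrite starMr starK sz -mulrA (mulrA z) zz mulNr mulrN /d.
  by rewrite !mulrA.
have -> : (z * star x) * star (z * star x) = - (c * c).
  rewrite starMr starK sz -[X in - (X * _)]opprK -[X in - (_ * X)]opprK mulrNN -zz.
  rewrite -mulrA (mulrA (star x)) -[star x * x]opprK -zz mulNr mulrN !mulrA.
  by [].
move=> h.
have : c * c = 0.
  apply: cpos_anti; first exact: cpos_sqr.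
  have -> : - (c * c) = (- (d * d) + - (c * c)) + d * d by lmod R.
  by apply: cposD => //; exact: cpos_sqr.
move=> cc; have c0 : c = 0.
  by apply: nrm_eq0; apply/eqP; rewrite -sqrf_eq0 -nrm_sa // cc nrm0.
by apply: nrm_eq0; apply/eqP; rewrite -sqrf_eq0 -nrm_starM -/c c0 nrm0.
Qed.

(** A flank of [star x * x] by b has the same shape, with [x * b] for x, so [neg_star_mul] makes it
    vanish whenever its opposite is positive. *)
Lemma cpos_starM x : cpos (star x * x).
Proof.
apply: cpos_of_flank; first by rewrite starMr starK.
move=> b sb; have -> : b * (star x * x) * b = star (x * b) * (x * b).
  by rewrite starMr sb !mulrA.
by move/neg_star_mul => ->; rewrite mulr0.
Qed.

Lemma cposP x : cpos x <-> exists y, x = star y * y.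
Proof.
split=> [/cpos_sqrt[y [sy <- _ _]]|[y ->]]; last exact: cpos_starM.
by exists y; rewrite sy.
Qed.

Lemma cpos_conj x y : cpos x -> cpos (star y * x * y).
Proof.
move=> /cposP[z ->]; apply/cposP; exists (z * y).
by rewrite starMr !mulrA.
Qed.

End Positive.

(** * Matrices over a C*-algebra *)

Section HilbertModule.
Variables (R : realType) (A : cstarAlgType R).
Local Notation sc t := (t%:C *: (1 : A)).

Section Vectors.
Variable J : finType.
Implicit Types (v w : J -> A) (x y : J -> J -> A).

(** The A-valued inner product that makes A^J a Hilbert module; bounds of matrices as operators on
    it give the C*-norm of M_J(A). *)
Definition dotp v w : A := \sum_j star (v j) * w j.

Definition hnrm v : R := Num.sqrt (nrm (dotp v v)).

Lemma star_dotp v w : star (dotp v w) = dotp w v.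
Proof.
by rewrite star_sum; apply: eq_bigr => j _; rewrite starMr starK.
Qed.

Lemma dotpDl v1 v2 w : dotp (fun j => v1 j + v2 j) w = dotp v1 w + dotp v2 w.
Proof. by rewrite -big_split; apply: eq_bigr => j _; rewrite starD mulrDl. Qed.

Lemma dotpDr v w1 w2 : dotp v (fun j => w1 j + w2 j) = dotp v w1 + dotp v w2.
Proof. by rewrite -big_split; apply: eq_bigr => j _; rewrite mulrDr. Qed.

Lemma dotpNr v w : dotp v (fun j => - w j) = - dotp v w.
Proof. by rewrite -sumrN; apply: eq_bigr => j _; rewrite mulrN. Qed.

Lemma dotpMr v w (a : A) : dotp v (fun j => w j * a) = dotp v w * a.
Proof. by rewrite mulr_suml; apply: eq_bigr => j _; rewrite mulrA. Qed.

Lemma dotpMl v w (a : A) : dotp (fun j => v j * a) w = star a * dotp v w.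
Proof. by rewrite mulr_sumr; apply: eq_bigr => j _; rewrite starMr mulrA. Qed.

Lemma dotpZr (c : R[i]) v w : dotp v (fun j => c *: w j) = c *: dotp v w.
Proof. by rewrite scaler_sumr; apply: eq_bigr => j _; rewrite mulZr. Qed.

Lemma dotpZl (c : R[i]) v w : dotp (fun j => c *: v j) w = (c^*)%C *: dotp v w.
Proof. by rewrite scaler_sumr; apply: eq_bigr => j _; rewrite starZ mulZl. Qed.

Lemma cpos_dotp v : cpos (dotp v v).
Proof. by apply: cpos_sum => j _; exact: cpos_starM. Qed.

Lemma hnrm_ge0 v : 0 <= hnrm v.
Proof. exact: sqrtr_ge0. Qed.

Lemma sqr_hnrm v : hnrm v ^+ 2 = nrm (dotp v v).
Proof. by rewrite sqr_sqrtr ?nrm_ge0. Qed.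

Lemma hnrm_le v (c : R) : 0 <= c -> nrm (dotp v v) <= c ^+ 2 -> hnrm v <= c.
Proof. by move=> c0; rewrite -sqr_hnrm ler_pXn2r // nnegrE hnrm_ge0. Qed.

(* Expand <u, u> >= 0 for u = v a - s w, where a = <v, w> and s > |<v, v>|. *)
Lemma dotp_CS v w : nrm (dotp v w) <= hnrm v * hnrm w.
Proof.
rewrite -(@ler_pXn2r _ 2) ?nnegrE ?mulr_ge0 ?nrm_ge0 ?hnrm_ge0 //.
rewrite exprMn !sqr_hnrm -nrm_starM.
set p := dotp v v; set q := dotp w w; set a := dotp v w.
have step (s : R) : 0 < s -> nrm p <= s -> nrm (star a * a) <= s * nrm q.
  move=> s0 ps.
  have h1 := cpos_dotp (fun j => v j * a + (- s%:C) *: w j).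
  have h2 := cpos_conj a (cpos_subl (cpos_sa (cpos_dotp v)) ps).
  have e : s%:C *: q - star a * a =
      (s^-1)%:C *: (dotp (fun j => v j * a + (- s%:C) *: w j)
                      (fun j => v j * a + (- s%:C) *: w j)
                    + star a * (sc s - p) * a).
    rewrite dotpDl !dotpDr !dotpMl !dotpMr !dotpZl !dotpZr -(star_dotp v w).
    rewrite -/p -/q -/a !mulrBr mulr_sc mulrBl mulZr.
    rewrite -rmorphN conjc_real rmorphN /= !mulrA ?mulZl ?mulZr.
    have sN : real_complex R s != 0 by rewrite fmorph_eq0 gt_eqF.
    by lmod R.
  have -> : s * nrm q = nrm (s%:C *: q) by rewrite nrmZr ger0_norm // ltW.
  apply: nrm_mono; first exact: cpos_starM.
  by rewrite e; apply: cposZ; [rewrite invr_ge0 ltW | exact: cposD].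
apply: ler_eps => e e0.
have q0 := nrm_ge0 q; have p0 := nrm_ge0 p.
have d0 : 0 < e / (nrm q + 1) by rewrite divr_gt0 //; lra.
have := step (nrm p + e / (nrm q + 1)); rewrite mulrDl => h.
apply: le_trans (h _ _) _; [lra|lra|].
rewrite lerD2l mulrAC ler_pdivrMr; last lra.
by rewrite ler_pM2l //; lra.
Qed.

Lemma hnrmD v w : hnrm (fun j => v j + w j) <= hnrm v + hnrm w.
Proof.
apply: hnrm_le; first by rewrite addr_ge0 ?hnrm_ge0.
rewrite dotpDl !dotpDr.
have := nrmD (dotp v v + dotp v w) (dotp w v + dotp w w).
have := nrmD (dotp v v) (dotp v w); have := nrmD (dotp w v) (dotp w w).
have := dotp_CS v w; have := dotp_CS w v.
rewrite -!sqr_hnrm; nra.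
Qed.

Lemma hnrmZ (c : R[i]) v : hnrm (fun j => c *: v j) = Normc.normc c * hnrm v.
Proof.
apply/eqP; rewrite -(@eqrXn2 _ 2) ?mulr_ge0 ?hnrm_ge0 //; last first.
  by case: c => a b; rewrite /= sqrtr_ge0.
rewrite exprMn !sqr_hnrm dotpZl dotpZr !nrmZ mulrA; apply/eqP; congr (_ * _).
by case: c => a b /=; rewrite sqrrN -expr2.
Qed.

Lemma hnrm0 : hnrm (fun=> 0) = 0.
Proof. by rewrite /hnrm /dotp big1 ?nrm0 ?sqrtr0 // => j _; rewrite mulr0. Qed.

Lemma nrm_coord v j : nrm (v j) <= hnrm v.
Proof.
rewrite -(@ler_pXn2r _ 2) ?nnegrE ?nrm_ge0 ?hnrm_ge0 // sqr_hnrm -nrm_starM.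
apply: nrm_mono; first exact: cpos_starM.
rewrite /dotp (bigD1 j) //= addrC addrK.
by apply: cpos_sum => k _; exact: cpos_starM.
Qed.

Lemma hnrm_sum v : hnrm v <= \sum_j nrm (v j).
Proof.
have s0 : 0 <= \sum_j nrm (v j) by rewrite sumr_ge0 // => j _; exact: nrm_ge0.
apply: hnrm_le => //; apply: le_trans (nrm_sum _ _ _) _.
rewrite expr2 mulr_suml; apply: ler_sum => j _; rewrite nrm_starM expr2.
rewrite ler_wpM2l ?nrm_ge0 // (bigD1 j) //= lerDl.
by rewrite sumr_ge0 // => k _; exact: nrm_ge0.
Qed.

Definition opapp x v : J -> A := fun a => \sum_b x a b * v b.
Definition opadj x : J -> J -> A := fun a b => star (x b a).
Definition opmul x y : J -> J -> A := fun a b => \sum_c x a c * y c b.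
Definition opone : J -> J -> A := fun a b => if a == b then 1 else 0.

Lemma dotp_adj x v w : dotp (opapp x v) w = dotp v (opapp (opadj x) w).
Proof.
rewrite /dotp /opapp /opadj.
under eq_bigr => j _ do rewrite star_sum mulr_suml.
rewrite exchange_big; apply: eq_bigr => k _; rewrite mulr_sumr.
by apply: eq_bigr => j _; rewrite starMr mulrA.
Qed.

Lemma opadjK x : opadj (opadj x) = x.
Proof. by apply/funext => a; apply/funext => b; rewrite /opadj starK. Qed.

Lemma opapp_mul x y v : opapp (opmul x y) v = opapp x (opapp y v).
Proof.
apply/funext => a; rewrite /opapp /opmul.
under eq_bigr => b _ do rewrite mulr_suml.
rewrite exchange_big; apply: eq_bigr => c _; rewrite mulr_sumr.
by apply: eq_bigr => b _; rewrite mulrA.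
Qed.

Lemma opapp_one v : opapp opone v = v.
Proof.
apply/funext => a; rewrite /opapp /opone (bigD1 a) //= eqxx mul1r big1 ?addr0 //.
by move=> b; rewrite eq_sym => /negbTE ->; rewrite mul0r.
Qed.

Definition unitv (b : J) : J -> A := fun a => if a == b then 1 else 0.

Lemma opapp_unitv x a b : opapp x (unitv b) a = x a b.
Proof.
rewrite /opapp /unitv (bigD1 b) //= eqxx mulr1 big1 ?addr0 //.
by move=> c /negbTE ->; rewrite mulr0.
Qed.

Lemma hnrm_unitv b : hnrm (unitv b) <= 1.
Proof.
apply: le_trans (hnrm_sum _) _.
rewrite (bigD1 b) //= /unitv eqxx big1 ?addr0 ?nrm1_le //.
by move=> c /negbTE ->; rewrite nrm0.
Qed.

Definition opbnd x (C : R) := forall v, hnrm (opapp x v) <= C * hnrm v.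

Lemma opbnd_sum x : opbnd x (\sum_a \sum_b nrm (x a b)).
Proof.
move=> v; apply: le_trans (hnrm_sum _) _; rewrite mulr_suml.
apply: ler_sum => a _; apply: le_trans (nrm_sum _ _ _) _.
rewrite mulr_suml; apply: ler_sum => b _; apply: le_trans (nrmM _ _) _.
by rewrite ler_wpM2l ?nrm_ge0 ?nrm_coord.
Qed.

Lemma opbnd_entry x C a b : 0 <= C -> opbnd x C -> nrm (x a b) <= C.
Proof.
move=> C0 h; rewrite -opapp_unitv; apply: le_trans (nrm_coord _ _) _.
by apply: le_trans (h _) _; rewrite ler_piMr // hnrm_unitv.
Qed.

(** <x v, x v> = <v, x^* x v>, then Cauchy-Schwarz. This is the nontrivial half of the C*-identity
    for the operator norm. *)
Lemma opbnd_starM x C : 0 <= C -> opbnd (opmul (opadj x) x) (C ^+ 2) -> opbnd x C.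
Proof.
move=> C0 h v; apply: hnrm_le; first by rewrite mulr_ge0 ?hnrm_ge0.
rewrite dotp_adj -opapp_mul; apply: le_trans (dotp_CS _ _) _.
have := h v; have := hnrm_ge0 v; rewrite exprMn; nra.
Qed.

(** For w = x^* v, the square of |w| is bounded through <w, w> = <x w, v> by C |w| |v|, and one
    factor |w| cancels unless it is 0. *)
Lemma opbnd_adj x C : 0 <= C -> opbnd x C -> opbnd (opadj x) C.
Proof.
move=> C0 h v; set w := opapp _ v.
have : hnrm w ^+ 2 <= (C * hnrm w) * hnrm v.
  rewrite sqr_hnrm {2}/w -dotp_adj; apply: le_trans (dotp_CS _ _) _.
  by rewrite ler_wpM2r ?hnrm_ge0.
have := hnrm_ge0 w; rewrite le_eqVlt => /orP[/eqP <- _|w0].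
  by rewrite mulr_ge0 ?hnrm_ge0.
by rewrite expr2 mulrAC ler_pM2r.
Qed.

Lemma opbnd_mul x y C D : 0 <= C -> opbnd x C -> opbnd y D ->
  opbnd (opmul x y) (C * D).
Proof.
move=> C0 hx hy v; rewrite opapp_mul; apply: le_trans (hx _) _.
by rewrite -mulrA ler_wpM2l.
Qed.

Lemma opbnd_one : opbnd opone 1.
Proof. by move=> v; rewrite opapp_one mul1r. Qed.

Lemma opbndD x y C D : opbnd x C -> opbnd y D ->
  opbnd (fun a b => x a b + y a b) (C + D).
Proof.
move=> hx hy v; rewrite mulrDl; apply: le_trans (lerD (hx v) (hy v)).
apply: le_trans (hnrmD _ _); rewrite le_eqVlt; apply/orP; left; apply/eqP.
congr hnrm; apply/funext => a; rewrite /opapp -big_split.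
by apply: eq_bigr => b _; rewrite mulrDl.
Qed.

Lemma opbndZ (c : R[i]) x C : opbnd x C ->
  opbnd (fun a b => c *: x a b) (Normc.normc c * C).
Proof.
move=> hx v; rewrite -mulrA.
have -> : opapp (fun a b => c *: x a b) v = fun a => c *: opapp x v a.
  apply/funext => a; rewrite /opapp scaler_sumr.
  by apply: eq_bigr => b _; rewrite mulZl.
rewrite hnrmZ ler_wpM2l //.
by case: c => a b; rewrite /= sqrtr_ge0.
Qed.

End Vectors.
End HilbertModule.

(** * C*-algebras from a real-valued norm *)

Record cstarData (R : realType) (V : lmodType R[i]) := CstarData {
  cd_mul : V -> V -> V;
  cd_one : V;
  cd_star : V -> V;
  cd_norm : V -> R;
  cd_mulA : associative cd_mul;
  cd_mul1l : left_id cd_one cd_mul;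
  cd_mul1r : right_id cd_one cd_mul;
  cd_mulDl : left_distributive cd_mul +%R;
  cd_mulDr : right_distributive cd_mul +%R;
  cd_mulZl : forall (c : R[i]) x y, cd_mul (c *: x) y = c *: cd_mul x y;
  cd_mulZr : forall (c : R[i]) x y, cd_mul x (c *: y) = c *: cd_mul x y;
  cd_starK : involutive cd_star;
  cd_starD : {morph cd_star : x y / x + y};
  cd_starZ : forall (c : R[i]) x, cd_star (c *: x) = (c^*)%C *: cd_star x;
  cd_starM : forall x y, cd_star (cd_mul x y) = cd_mul (cd_star y) (cd_star x);
  cd_normD : forall x y, cd_norm (x + y) <= cd_norm x + cd_norm y;
  cd_normZ : forall (c : R[i]) x, cd_norm (c *: x) = Normc.normc c * cd_norm x;
  cd_norm0 : forall x, cd_norm x = 0 -> x = 0;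
  cd_normM : forall x y, cd_norm (cd_mul x y) <= cd_norm x * cd_norm y;
  cd_norm_star : forall x, cd_norm (cd_mul (cd_star x) x) = cd_norm x ^+ 2;
  cd_complete : forall u : nat -> V,
    (forall e : R, 0 < e -> exists n0, forall m n,
      (n0 <= m)%N -> (n0 <= n)%N -> cd_norm (u m - u n) <= e) ->
    exists l, forall e : R, 0 < e -> exists n0, forall n,
      (n0 <= n)%N -> cd_norm (u n - l) <= e
}.

(** An alias of V that mentions [d], so that the instances below can depend on the data. *)
Definition cstar_of (R : realType) (V : lmodType R[i]) (d : cstarData V) : Type := V.

Section CstarOf.
Variables (R : realType) (V : lmodType R[i]) (d : cstarData V).

HB.instance Definition _ := GRing.Lmodule.on (cstar_of d).

Let T := cstar_of d.
Let N (x : T) : R[i] := (cd_norm d x)%:C.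

Let ND (x y : T) : N (x + y) <= N x + N y.
Proof. by rewrite /N -rmorphD lecR; exact: (cd_normD d). Qed.

Let NZ (c : R[i]) (x : T) : N (c *: x) = `|c| * N x.
Proof. by rewrite /N (cd_normZ d) rmorphM. Qed.

Let N0 (x : T) : N x = 0 -> x = 0.
Proof. by move=> /complexI; exact: (@cd_norm0 _ _ d). Qed.

HB.instance Definition _ := Lmodule_isNormed.Build R[i] (cstar_of d) ND NZ N0.

(** [cd_complete] speaks of sequences: centres are chosen of balls of radius 1/(n+1) that belong to
    F. Any two members of F meet, so the centres form a Cauchy sequence, and F converges to its
    limit. *)
Let T_complete (F : set_system T) : ProperFilter F -> cauchy F -> cvg F.
Proof.
move=> FF cF.
have hn (n : nat) : 0 < (n.+1%:R^-1 : R)%:C by rewrite ltcR invr_gt0 ltr0Sn.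
have /cauchyP cF' := cF.
have /choice[u hu] : forall n : nat, exists x : T, F (ball x (n.+1%:R^-1 : R)%:C).
  by move=> n; have [x Fx] := cF' _ (hn n); exists x.
have small (e : R) : 0 < e -> exists n0, forall n, (n0 <= n)%N -> n.+1%:R^-1 <= e.
  move=> e0; exists (Num.truncn e^-1) => n nn.
  rewrite invf_ple ?posrE ?ltr0Sn //; apply: le_trans (ltW (truncnS_gt _)) _.
  by rewrite ler_nat ltnS.
have hd m n : cd_norm d (u m - u n) <= m.+1%:R^-1 + n.+1%:R^-1.
  have [z [/= zm zn]] := filter_ex (filterI (hu m) (hu n)).
  move: zm zn; rewrite -!ball_normE /ball_ /= => zm zn.
  rewrite -lecR rmorphD /=; apply: le_trans (lerD (ltW zm) (ltW zn)).
  by rewrite [`|u n - z|]distrC; exact: (ler_distD z (u m) (u n)).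
have [|l hl] := @cd_complete _ _ d u.
  move=> e e0; have [n0 h] := small _ (divr_gt0 e0 (ltr0Sn R 1)).
  exists n0 => m n mm nn; apply: le_trans (hd m n) _.
  by rewrite [leRHS]splitr; exact: lerD (h _ mm) (h _ nn).
apply/cvg_ex; exists (l : T); apply/cvgrPdist_le => e e0.
have er : e = (Re e)%:C by rewrite RRe_real // realE ltW.
have e1 : 0 < Re e by rewrite -ltcR -er.
have [n0 h0] := small _ (divr_gt0 e1 (ltr0Sn R 1)).
have [n1 h1] := hl _ (divr_gt0 e1 (ltr0Sn R 1)).
pose n := maxn n0 n1.
have := hu n; apply: filterS => x; rewrite -ball_normE /ball_ /= => xn.
apply: le_trans (ler_distD (u n) (l : T) x) _.
rewrite [`|_ - u n|]distrC er.
apply: (@le_trans _ _ ((Re e / 2)%:C + (Re e / 2)%:C)); last first.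
  by rewrite -rmorphD lecR; lra.
apply: lerD; first by rewrite lecR h1 // leq_maxr.
by apply: le_trans (ltW xn) _; rewrite lecR h0 // leq_maxl.
Qed.

HB.instance Definition _ := Uniform_isComplete.Build (cstar_of d) T_complete.

Let NM (x y : T) : `|cd_mul d x y : T| <= `|x| * `|y|.
Proof. by rewrite -[_ * _](rmorphM (real_complex R)) lecR; exact: cd_normM. Qed.

Let NS (x : T) : `|cd_mul d (cd_star d x) x : T| = `|x| ^+ 2.
Proof.
rewrite -[RHS](rmorphXn (real_complex R)); congr _%:C; exact: cd_norm_star.
Qed.

HB.instance Definition _ := isCStarAlgebra.Build R (cstar_of d)
  (cd_mulA d) (cd_mul1l d) (cd_mul1r d) (cd_mulDl d) (cd_mulDr d)
  (cd_mulZl d) (cd_mulZr d) (cd_starK d) (cd_starD d) (cd_starZ d) (cd_starM d)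
  NM NS.

Definition calg : cstarAlgType R := cstar_of d.

End CstarOf.

Section ComplexAlgebra.
Variable R : realType.

Lemma normc_ge0 (c : R[i]) : 0 <= Normc.normc c.
Proof. by case: c => a b; rewrite /= sqrtr_ge0. Qed.

Lemma normc_Re (c : R[i]) : `|Re c| <= Normc.normc c.
Proof.
by case: c => a b /=; rewrite -sqrtr_sqr ler_wsqrtr // lerDl sqr_ge0.
Qed.

Lemma normc_Im (c : R[i]) : `|Im c| <= Normc.normc c.
Proof.
by case: c => a b /=; rewrite -[`|b|]sqrtr_sqr ler_wsqrtr // lerDr sqr_ge0.
Qed.

Lemma normc_le (c : R[i]) : Normc.normc c <= `|Re c| + `|Im c|.
Proof.
case: c => a b /=; rewrite -[leRHS]ger0_norm ?addr_ge0 // -sqrtr_sqr.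
rewrite ler_wsqrtr // sqrrD !real_normK ?num_real //.
by rewrite addrAC lerDl mulrn_wge0 // mulr_ge0.
Qed.

Lemma real_cauchy (u : nat -> R) :
  (forall e : R, 0 < e -> exists n0, forall m n,
     (n0 <= m)%N -> (n0 <= n)%N -> `|u m - u n| <= e) ->
  exists l, forall e : R, 0 < e -> exists n0, forall n,
     (n0 <= n)%N -> `|u n - l| <= e.
Proof.
move=> cu.
have cvu : cvg (u @ \oo).
  apply: cauchy_cvg; apply/cauchy_ballP => e e0.
  have [n0 h] := cu _ (divr_gt0 e0 (ltr0Sn R 1)).
  exists ([set x | exists2 n, (n0 <= n)%N & x = u n],
     [set x | exists2 n, (n0 <= n)%N & x = u n]) => /=.
    by split; exists n0 => // n /= nn; exists n.
  move=> [a b] /= [] [m m0 ->] [n nn0 ->].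
  rewrite -ball_normE /ball_ /=; apply: le_lt_trans (h _ _ m0 nn0) _.
  by rewrite ltr_pdivrMr // ltr_pMr // ltr1n.
exists (lim (u @ \oo)) => e e0.
have /cvgrPdist_le /(_ _ e0) [n0 _ h] := cvu.
by exists n0 => n nn0; rewrite distrC; exact: h.
Qed.

Lemma complex_cauchy (u : nat -> R[i]^o) :
  (forall e : R, 0 < e -> exists n0, forall m n,
     (n0 <= m)%N -> (n0 <= n)%N -> Normc.normc (u m - u n) <= e) ->
  exists l : R[i]^o, forall e : R, 0 < e -> exists n0, forall n,
     (n0 <= n)%N -> Normc.normc (u n - l) <= e.
Proof.
move=> cu.
have eR (x y : R[i]) : Re (x - y) = Re x - Re y by case: x y => [? ?] [? ?].
have eI (x y : R[i]) : Im (x - y) = Im x - Im y by case: x y => [? ?] [? ?].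
have [|a ha] := @real_cauchy (fun n => Re (u n)).
  move=> e /cu[n0 h]; exists n0 => m n mm nn; apply: le_trans (h m n mm nn).
  by rewrite -eR normc_Re.
have [|b hb] := @real_cauchy (fun n => Im (u n)).
  move=> e /cu[n0 h]; exists n0 => m n mm nn; apply: le_trans (h m n mm nn).
  by rewrite -eI normc_Im.
exists (a +i* b)%C => e e0.
have [n0 h0] := ha _ (divr_gt0 e0 (ltr0Sn R 1)).
have [n1 h1] := hb _ (divr_gt0 e0 (ltr0Sn R 1)).
exists (maxn n0 n1) => n; rewrite geq_max => /andP[nn0 nn1].
apply: le_trans (normc_le _) _; rewrite eR eI /= [leRHS]splitr.
by apply: lerD; [exact: h0 | exact: h1].
Qed.

Lemma normc_conjM (x : R[i]) : Normc.normc ((x^*)%C * x) = Normc.normc x ^+ 2.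
Proof.
by rewrite Normc.normcM expr2; congr (_ * _); case: x => a b /=; rewrite sqrrN.
Qed.

Definition complexData : cstarData (R[i]^o : lmodType R[i]).
Proof.
refine (@CstarData R (R[i]^o : lmodType R[i]) *%R 1 (@conjc R) (@Normc.normc R)
  (@mulrA _) (@mul1r _) (@mulr1 _) (@mulrDl _) (@mulrDr _) _ _ (@conjcK R) _ _ _
  (@le_normcD R) _ (@Normc.eq0_normc R) _ normc_conjM complex_cauchy).
- by move=> c x y; rewrite /GRing.scale /= mulrA.
- by move=> c x y; rewrite /GRing.scale /= mulrCA.
- by move=> x y; rewrite rmorphD.
- by move=> c x; rewrite /GRing.scale /= rmorphM.
- by move=> x y; rewrite rmorphM mulrC.
- by move=> c x; rewrite /GRing.scale /= Normc.normcM.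
- by move=> x y; rewrite Normc.normcM.
Defined.

Definition Calg : cstarAlgType R := calg complexData.

End ComplexAlgebra.

(** * Bounded families of matrices over a C*-algebra *)

Section FamilyAlgebra.
Variables (R : realType) (A : cstarAlgType R) (I : Type) (J : I -> finType).

(** The construction serves twice: the index type [unit] gives M_n(A), and [A := Calg R] gives the
    products of matrix algebras that are the fibres of the cofree system. *)
Definition opfam := forall i, J i -> J i -> A.

Definition bounded_opfam (f : opfam) :=
  exists2 C : R, 0 <= C & forall i, opbnd (f i) C.

(** All entries are flattened into one function, so that the module structure is inherited from a
    function space. *)
Definition fam_idx := {i : I & (J i * J i)%type}.

Definition ent_of (X : fam_idx -> A) : opfam :=
  fun i a b => X (existT _ i (a, b)).

Arguments ent_of X i a b : clear implicits.

Definition bfam_pred : {pred fam_idx -> A} :=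
  fun X => `[< bounded_opfam (ent_of X) >].

Lemma bfam_submod : submod_closed bfam_pred.
Proof.
split.
  apply/asboolP; exists 0 => // i v; rewrite mul0r le_eqVlt; apply/orP; left.
  rewrite -(hnrm0 A (J i)); apply/eqP; congr hnrm; apply/funext => a.
  by rewrite /opapp big1 // => b _; rewrite mul0r.
move=> c X Y /asboolP[C C0 hX] /asboolP[D D0 hY].
apply/asboolP; exists (Normc.normc c * C + D).
  by rewrite addr_ge0 // mulr_ge0 // normc_ge0.
by move=> i; apply: opbndD => //; apply: opbndZ.
Qed.

HB.instance Definition _ :=
  GRing.isSubmodClosed.Build R[i] (fam_idx -> A) bfam_pred bfam_submod.

Definition bfam : Type := {X : fam_idx -> A | X \in bfam_pred}.

HB.instance Definition _ := SubChoice.on bfam.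
HB.instance Definition _ := [SubChoice_isSubLmodule of bfam by <:].

Definition ent (X : bfam) : opfam := ent_of (val X).

Arguments ent X i a b : clear implicits.

Lemma ent_bounded (X : bfam) : bounded_opfam (ent X).
Proof. by have /asboolP := valP X. Qed.

Lemma bfam_eq (X Y : bfam) : (forall i a b, ent X i a b = ent Y i a b) -> X = Y.
Proof.
by move=> h; apply: val_inj; apply/funext => -[i [a b]]; exact: h.
Qed.

Definition bfam_of (f : opfam) (h : bounded_opfam f) : bfam :=
  exist (fun X => X \in bfam_pred)
    (fun t : fam_idx => f (tag t) (tagged t).1 (tagged t).2) (asboolT h).

(** The supremum over i of the operator norms, expressed as the least common bound. *)
Definition fnrm (X : bfam) : R :=
  inf [set C | 0 <= C /\ forall i, opbnd (ent X i) C].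

Lemma fnrm_has_inf X : has_inf [set C | 0 <= C /\ forall i, opbnd (ent X i) C].
Proof.
split; last by exists 0 => C [].
by have [C C0 h] := ent_bounded X; exists C.
Qed.

Lemma fnrm_ge0 X : 0 <= fnrm X.
Proof. by apply: lb_le_inf; [case: (fnrm_has_inf X) | move=> C []]. Qed.

Lemma fnrm_le X C : 0 <= C -> (forall i, opbnd (ent X i) C) -> fnrm X <= C.
Proof. by move=> C0 h; apply: ge_inf => //; case: (fnrm_has_inf X). Qed.

Lemma fnrm_bnd X i : opbnd (ent X i) (fnrm X).
Proof.
move=> v; apply: ler_eps => e e0.
have v1 : 0 < hnrm v + 1 by have := hnrm_ge0 v; lra.
have [C [C0 h] hC] := inf_adherent (divr_gt0 e0 v1) (fnrm_has_inf X).
apply: le_trans (h i v) _; apply: le_trans (ler_wpM2r (hnrm_ge0 v) (ltW hC)) _.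
rewrite mulrDl lerD2l mulrAC ler_pdivrMr // ler_pM2l //.
by have := hnrm_ge0 v; lra.
Qed.

Arguments fnrm_bnd X i : clear implicits.

Lemma fnrm_entry X i a b : nrm (ent X i a b) <= fnrm X.
Proof. by apply: opbnd_entry; [exact: fnrm_ge0 | exact: fnrm_bnd]. Qed.

Lemma bentD X Y i a b : ent (X + Y) i a b = ent X i a b + ent Y i a b.
Proof. by []. Qed.

Lemma bentZ (c : R[i]) X i a b : ent (c *: X) i a b = c *: ent X i a b.
Proof. by []. Qed.

Definition fmul (X Y : bfam) : bfam.
Proof.
refine (bfam_of (f := fun i => opmul (ent X i) (ent Y i)) _).
exists (fnrm X * fnrm Y); first by rewrite mulr_ge0 ?fnrm_ge0.
by move=> i; apply: opbnd_mul; [exact: fnrm_ge0 | exact: fnrm_bnd..].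
Defined.

Lemma ent_fmul X Y i : ent (fmul X Y) i = opmul (ent X i) (ent Y i).
Proof. by []. Qed.

Definition fone : bfam.
Proof.
by refine (bfam_of (f := fun i => @opone R A (J i)) _); exists 1 => // i; exact: opbnd_one.
Defined.

Definition fstar (X : bfam) : bfam.
Proof.
refine (bfam_of (f := fun i => opadj (ent X i)) _).
exists (fnrm X); first exact: fnrm_ge0.
by move=> i; apply: opbnd_adj; [exact: fnrm_ge0 | exact: fnrm_bnd].
Defined.

Lemma ent_fstar X i : ent (fstar X) i = opadj (ent X i).
Proof. by []. Qed.

Lemma fnrmD X Y : fnrm (X + Y) <= fnrm X + fnrm Y.
Proof.
apply: fnrm_le; first by rewrite addr_ge0 ?fnrm_ge0.
by move=> i; apply: opbndD; exact: fnrm_bnd.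
Qed.

Lemma fnrmZ_le (c : R[i]) X : fnrm (c *: X) <= Normc.normc c * fnrm X.
Proof.
apply: fnrm_le; first by rewrite mulr_ge0 ?fnrm_ge0 ?normc_ge0.
by move=> i; apply: opbndZ; exact: fnrm_bnd.
Qed.

Lemma fnrmZ (c : R[i]) X : fnrm (c *: X) = Normc.normc c * fnrm X.
Proof.
apply/le_anti; rewrite fnrmZ_le /=.
case: (eqVneq c 0) => [->|c0].
  by rewrite Normc.normc0 mul0r fnrm_ge0.
have := fnrmZ_le c^-1 (c *: X); rewrite scalerA mulVf // scale1r.
have n0 : 0 < Normc.normc c.
  by rewrite lt_def normc_ge0 andbT; apply: contraNneq c0 => /Normc.eq0_normc ->.
by rewrite Normc.normcV mulrC ler_pdivlMr // mulrC.
Qed.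

Lemma fnrm_eq0 X : fnrm X = 0 -> X = 0.
Proof.
move=> h; apply: bfam_eq => i a b; apply: nrm_le0; rewrite -h.
exact: fnrm_entry.
Qed.

Lemma fnrmM X Y : fnrm (fmul X Y) <= fnrm X * fnrm Y.
Proof.
apply: fnrm_le; first by rewrite mulr_ge0 ?fnrm_ge0.
by move=> i; rewrite ent_fmul; apply: opbnd_mul; [exact: fnrm_ge0 | exact: fnrm_bnd..].
Qed.

Lemma fnrm_fstar X : fnrm (fstar X) <= fnrm X.
Proof.
apply: fnrm_le; first exact: fnrm_ge0.
by move=> i; rewrite ent_fstar; apply: opbnd_adj; [exact: fnrm_ge0 | exact: fnrm_bnd].
Qed.

Lemma fnrm_starM X : fnrm (fmul (fstar X) X) = fnrm X ^+ 2.
Proof.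
apply/le_anti/andP; split.
  apply: le_trans (fnrmM _ _) _.
  by rewrite expr2 ler_wpM2r ?fnrm_ge0 // fnrm_fstar.
set Y := fmul _ _; rewrite -[leRHS]sqr_sqrtr ?fnrm_ge0 //.
rewrite ler_pXn2r ?nnegrE ?fnrm_ge0 ?sqrtr_ge0 //.
apply: fnrm_le => [|i]; first exact: sqrtr_ge0.
apply: opbnd_starM; first exact: sqrtr_ge0.
rewrite sqr_sqrtr ?fnrm_ge0 // -ent_fstar -ent_fmul.
exact: fnrm_bnd.
Qed.

(** The limit is taken entrywise, which is not uniform in i. The uniform bound is recovered by
    comparing u n with u m through the Cauchy property, where m, depending on i and v, is so large
    that u m is close to the limit at the finitely many entries over i. *)
Lemma fam_complete (u : nat -> bfam) :
  (forall e : R, 0 < e -> exists n0, forall m n,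
     (n0 <= m)%N -> (n0 <= n)%N -> fnrm (u m - u n) <= e) ->
  exists l : bfam, forall e : R, 0 < e -> exists n0, forall n,
     (n0 <= n)%N -> fnrm (u n - l) <= e.
Proof.
move=> cu.
have /choice[l hl] : forall t : fam_idx, exists l, nlim (fun n => val (u n) t) l.
  move=> [i [a b]]; apply: cstar_complete => e /cu[n0 h].
  exists n0 => m n mm nn; apply: le_trans (h m n mm nn).
  exact: (fnrm_entry (u m - u n) a b).
have key e n0 : 0 < e -> (forall m n, (n0 <= m)%N -> (n0 <= n)%N ->
    fnrm (u m - u n) <= e) ->
    forall n, (n0 <= n)%N -> forall i,
    opbnd (fun a b => ent (u n) i a b - ent_of l i a b) e.
  move=> e0 h n nn i v; apply: ler_eps => d d0.
  set x := fun a b => _.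
  (* K depends on v and on the size of [J i], through the crude bound by the sum of the entries; the
     summand 1 keeps it positive. *)
  have [K K0 hK] : exists2 K, 0 < K & forall c : R, 0 < c -> exists m, (n0 <= m)%N /\
      hnrm (opapp (fun a b => ent (u m) i a b - ent_of l i a b) v) <= K * c.
    exists ((\sum_(a : J i) \sum_(b : J i) 1) * hnrm v + 1).
      rewrite ltr_wpDl // mulr_ge0 ?hnrm_ge0 //.
      by apply: sumr_ge0 => a _; apply: sumr_ge0.
    move=> c c0.
    have /choice[k hk] : forall t : fam_idx, exists k, forall n, (k <= n)%N ->
        nrm (val (u n) t - l t) <= c by move=> t; exact: hl.
    pose F (t : J i * J i) := k (existT _ i t).
    pose m := maxn n0 (\max_t F t).
    exists m; split; first exact: leq_maxl.
    apply: le_trans (opbnd_sum _ _) _.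
    rewrite mulrDl mul1r -[leLHS]addr0; apply: lerD; last exact: ltW.
    rewrite mulrAC ler_wpM2r ?hnrm_ge0 //.
    rewrite mulr_suml; apply: ler_sum => a _; rewrite mulr_suml.
    apply: ler_sum => b _; rewrite mul1r; apply: hk.
    exact: leq_trans (leq_bigmax (F := F) (a, b)) (leq_maxr _ _).
  have dK : 0 < d / K by rewrite divr_gt0.
  have [m [mm hm]] := hK _ dK.
  have -> : opapp x v = fun a => opapp (ent (u n - u m) i) v a +
      opapp (fun a b => ent (u m) i a b - ent_of l i a b) v a.
    apply/funext => a; rewrite /opapp -big_split; apply: eq_bigr => b _ /=.
    rewrite -mulrDl; congr (_ * _); rewrite /x addrA; congr (_ - _).
    by rewrite /ent /ent_of /= subrK.
  apply: le_trans (hnrmD _ _) _; apply: lerD.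
    apply: le_trans (fnrm_bnd _ _ _) _; rewrite ler_wpM2r ?hnrm_ge0 //.
    exact: h.
  by apply: le_trans hm _; rewrite mulrC divfK // gt_eqF.
have bl : bounded_opfam (ent_of l).
  have [n0 h] := cu _ ltr01; exists (fnrm (u n0) + 1).
    by rewrite addr_ge0 // fnrm_ge0.
  move=> i; have := key _ _ ltr01 h _ (leqnn n0) i => k1.
  have := opbndZ (- 1) k1; rewrite normcN Normc.normc1 mul1r => k2.
  have := opbndD (fnrm_bnd (u n0) i) k2.
  congr (opbnd _ _); apply/funext => a; apply/funext => b.
  by rewrite scaleN1r opprB addrC subrK.
exists (bfam_of bl) => e e0; have [n0 h] := cu _ e0; exists n0 => n nn.
apply: fnrm_le => [|i]; first exact: ltW.
exact: (key e n0 e0 h n nn i).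
Qed.

Definition famData : cstarData (bfam : lmodType R[i]).
Proof.
refine (@CstarData R (bfam : lmodType R[i]) fmul fone fstar fnrm
  _ _ _ _ _ _ _ _ _ _ _ fnrmD fnrmZ fnrm_eq0 fnrmM fnrm_starM fam_complete).
- move=> X Y Z; apply: bfam_eq => i a b.
  rewrite /ent /ent_of /= /opmul /ent /ent_of /= /opmul.
  under eq_bigr => c _ do rewrite mulr_sumr.
  rewrite exchange_big; apply: eq_bigr => c _; rewrite mulr_suml.
  by apply: eq_bigr => d _; rewrite mulrA.
- move=> X; apply: bfam_eq => i a b.
  rewrite /ent /ent_of /= /opmul /ent /ent_of /= /opone (bigD1 a) //= eqxx mul1r.
  by rewrite big1 ?addr0 // => c; rewrite eq_sym => /negbTE ->; rewrite mul0r.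
- move=> X; apply: bfam_eq => i a b.
  rewrite /ent /ent_of /= /opmul /ent /ent_of /= /opone (bigD1 b) //= eqxx mulr1.
  by rewrite big1 ?addr0 // => c /negbTE ->; rewrite mulr0.
- move=> X Y Z; apply: bfam_eq => i a b.
  rewrite bentD !ent_fmul /opmul -big_split.
  by apply: eq_bigr => c _; rewrite mulrDl.
- move=> X Y Z; apply: bfam_eq => i a b.
  rewrite bentD !ent_fmul /opmul -big_split.
  by apply: eq_bigr => c _; rewrite mulrDr.
- move=> c X Y; apply: bfam_eq => i a b.
  rewrite bentZ !ent_fmul /opmul scaler_sumr.
  by apply: eq_bigr => d _; rewrite -mulZl.
- move=> c X Y; apply: bfam_eq => i a b.
  rewrite bentZ !ent_fmul /opmul scaler_sumr.
  by apply: eq_bigr => d _; rewrite -mulZr.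
- by move=> X; apply: bfam_eq => i a b; rewrite /ent /ent_of /= /opadj starK.
- by move=> X Y; apply: bfam_eq => i a b; rewrite bentD !ent_fstar /opadj -starD.
- by move=> c X; apply: bfam_eq => i a b; rewrite bentZ !ent_fstar /opadj -starZ.
- move=> X Y; apply: bfam_eq => i a b.
  rewrite ent_fstar !ent_fmul /opadj /opmul star_sum; apply: eq_bigr => c _.
  by rewrite starMr.
Defined.

Definition falg : cstarAlgType R := calg famData.

Implicit Types X Y : falg.

Lemma falg_eq X Y : (forall i a b, ent X i a b = ent Y i a b) -> X = Y.
Proof. exact: bfam_eq. Qed.

Lemma falg_bnd X i : opbnd (ent X i) (nrm X).
Proof. exact: (@fnrm_bnd X). Qed.

Lemma entD X Y i a b : ent (X + Y) i a b = ent X i a b + ent Y i a b.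
Proof. by []. Qed.

Lemma entN X i a b : ent (- X) i a b = - ent X i a b.
Proof. by rewrite -scaleN1r -[RHS]scaleN1r. Qed.

Lemma entP (c : R[i]) X Y i a b :
  ent (c *: X + Y) i a b = c *: ent X i a b + ent Y i a b.
Proof. by []. Qed.

Lemma entZ (c : R[i]) X i a b : ent (c *: X) i a b = c *: ent X i a b.
Proof. by []. Qed.

Lemma entM X Y i : ent (X * Y) i = opmul (ent X i) (ent Y i).
Proof. by []. Qed.

Lemma ent1 i : ent (1 : falg) i = @opone R A (J i).
Proof. by []. Qed.

Lemma ent_star X i : ent (star X) i = opadj (ent X i).
Proof. by []. Qed.

Lemma ent_sum (K : Type) (r : seq K) (P : pred K) (F : K -> falg) i a b :
  ent (\sum_(k <- r | P k) F k) i a b = \sum_(k <- r | P k) ent (F k) i a b.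
Proof. by elim/big_rec2: _ => // k x y _ <-; exact: entD. Qed.

End FamilyAlgebra.

Arguments ent_of {R A I J} X i a b.
Arguments ent {R A I J} X i a b.
Arguments bfam_of {R A I J} f h.

(** * Positive functionals *)

Section HahnBanach.
Variables (R : realType) (V : lmodType R[i]) (p : V -> R).
Hypothesis pD : forall x y, p (x + y) <= p x + p y.
Hypothesis pZ : forall (t : R) x, 0 < t -> p (t%:C *: x) = t * p x.

(** A partial real-linear functional below p, given by its graph so that chains have unions.
    Single-valuedness follows from the domination: the difference of two values at x is a value at
    0, hence at most [p 0], which is 0. *)
Definition dominated_graph (G : set (V * R)) :=
  [/\ G (0, 0), (forall x r y s, G (x, r) -> G (y, s) -> G (x + y, r + s)),
    (forall (t : R) x r, G (x, r) -> G (t%:C *: x, t * r)) &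
    forall x r, G (x, r) -> r <= p x].

Lemma graph_fun G x r s : dominated_graph G -> G (x, r) -> G (x, s) -> r = s.
Proof.
move=> [G0 GD GZ Gp].
suff h a b : G (x, a) -> G (x, b) -> a <= b.
  by move=> hr hs; apply/le_anti; rewrite !h.
move=> ha hb.
have p0 : p 0 <= 0.
  have := pZ 0 (ltr0Sn R 1); rewrite scaler0; lra.
have := GD _ _ _ _ ha (GZ (-1) _ _ hb).
rewrite rmorphN1 scaleN1r subrr => /Gp; lra.
Qed.

(** Subadditivity gives r - p (v - x) <= p (v' + x) - r' on the graph; the value c at x is the
    supremum of the left-hand sides. *)
Lemma graph_step G x : dominated_graph G -> exists c, dominated_graph
  [set a | exists v r (s : R), [/\ G (v, r), a.1 = v + s%:C *: x & a.2 = r + s * c]].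
Proof.
move=> [G0 GD GZ Gp].
pose L := [set t | exists v r, G (v, r) /\ t = r - p (v - x)].
have Lub v' r' : G (v', r') -> ubound L (p (v' + x) - r').
  move=> h' _ [v [r [h ->]]].
  have := Gp _ _ (GD _ _ _ _ h h'); have := pD (v - x) (v' + x).
  by rewrite addrACA [- x + x]addrC subrr addr0; lra.
have Ls : has_sup L.
  split; first by exists (0 - p (0 - x)), 0, 0.
  by exists (p (0 + x) - 0); exact: Lub.
exists (sup L); split => /=.
- by exists 0, 0, 0; rewrite scale0r mul0r !addr0.
- move=> a r b s [v [r1 [t [h1 -> ->]]]] [w [s1 [q [h2 -> ->]]]].
  exists (v + w), (r1 + s1), (t + q); split; first exact: GD.
    by rewrite rmorphD scalerDl addrACA.
  by rewrite mulrDl addrACA.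
- move=> t a r [v [r1 [q [h1 -> ->]]]].
  exists (t%:C *: v), (t * r1), (t * q); split; first exact: GZ.
    by rewrite scalerDr scalerA rmorphM.
  by rewrite mulrDr mulrA.
- move=> a r [v [r1 [s [h1 -> ->]]]].
  case: (ltgtP s 0) => [s0|s0|->]; last first.
  + by rewrite scale0r mul0r !addr0; exact: Gp.
  + have h2 := GZ s^-1 _ _ h1.
    have : sup L <= p ((s^-1)%:C *: v + x) - s^-1 * r1.
      by apply: ge_sup; [case: Ls | exact: Lub].
    have -> : v + s%:C *: x = s%:C *: ((s^-1)%:C *: v + x).
      by rewrite scalerDr scalerA -rmorphM mulfV ?gt_eqF // rmorph1 scale1r.
    rewrite pZ // -(ler_pM2l s0) mulrBr mulrA mulfV ?gt_eqF // mul1r; lra.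
  + have s1 : 0 < - s by lra.
    have h2 := GZ (- s)^-1 _ _ h1.
    have : (- s)^-1 * r1 - p ((- s)^-1%:C *: v - x) <= sup L.
      by apply: ub_le_sup; [case: Ls | exists ((- s)^-1%:C *: v), ((- s)^-1 * r1)].
    have -> : v + s%:C *: x = (- s)%:C *: ((- s)^-1%:C *: v - x).
      rewrite scalerBr scalerA -rmorphM mulfV ?gt_eqF // rmorph1 scale1r.
      by rewrite rmorphN scaleNr opprK.
    rewrite pZ // -(ler_pM2l s1) mulrBr mulrA mulfV ?gt_eqF // mul1r; lra.
Qed.

Lemma hahn_banach G0 : dominated_graph G0 -> exists g : V -> R,
  [/\ forall x y, g (x + y) = g x + g y, forall (t : R) x, g (t%:C *: x) = t * g x,
      forall x, g x <= p x & forall x r, G0 (x, r) -> g x = r].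
Proof.
move=> dG0.
pose P (G : set (V * R)) := G = set0 \/ (dominated_graph G /\ G0 `<=` G).
have [F FP Ftot|G [PG Gmax]] := @Zorn_bigcup _ P.
  have [[H [FH H0]]|none] := pselect (exists H, F H /\ H !=set0); last first.
    left; rewrite -subset0 => a [H FH Ha]; apply: none; exists H.
    by split => //; exists a.
  have ok K : F K -> K !=set0 -> dominated_graph K /\ G0 `<=` K.
    by move=> FK [a Ka]; case: (FP _ FK) => // K0; rewrite K0 in Ka.
  have [dH GH] := ok _ FH H0.
  right; split; last by move=> a /GH Ha; exists H.
  split.
  - by exists H => //; case: dH.
  - move=> x r y s [K FK Ka] [L FL La].
    have [KL|LK] := Ftot _ _ FK FL.
      exists L => //; have [[_ LD _ _] _] := ok _ FL (ex_intro _ _ La).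
      by apply: LD => //; exact: KL.
    exists K => //; have [[_ KD _ _] _] := ok _ FK (ex_intro _ _ Ka).
    by apply: KD => //; exact: LK.
  - move=> t x r [K FK Ka]; exists K => //.
    by have [[_ _ KZ _] _] := ok _ FK (ex_intro _ _ Ka); exact: KZ.
  - move=> x r [K FK Ka].
    by have [[_ _ _ Kp] _] := ok _ FK (ex_intro _ _ Ka); exact: Kp.
have [dG G0G] : dominated_graph G /\ G0 `<=` G.
  case: PG => // Ge; exfalso; apply: (Gmax G0); last by right; split.
  rewrite Ge properEneq; split; last exact: sub0set.
  by apply/eqP => e; have [] := dG0; rewrite -e.
have tot x : exists r, G (x, r).
  apply: contrapT => nx; have [c dB] := graph_step x dG.
  set B := (X in dominated_graph X) in dB.
  have GB : G `<=` B.
    by move=> [v r] h; exists v, r, 0; rewrite scale0r mul0r !addr0.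
  apply: (Gmax B); last by right; split => //; exact: subset_trans GB.
  rewrite properEneq; split => //; apply/eqP => e; apply: nx; exists c.
  rewrite e; exists 0, 0, 1; case: dG => G00 _ _ _.
  by rewrite rmorph1 scale1r mul1r !add0r.
have [g hg] := choice tot.
have gE x r : G (x, r) -> g x = r by move=> h; exact: graph_fun dG (hg x) h.
have [_ GD GZ Gp] := dG.
exists g; split.
- by move=> x y; apply: gE; exact: GD.
- by move=> t x; apply: gE; exact: GZ.
- by move=> x; exact: Gp.
- by move=> x r /G0G; exact: gE.
Qed.

End HahnBanach.

Section PositiveFunctionals.
Variables (R : realType) (E : cstarAlgType R).
Local Notation sc t := (t%:C *: (1 : E)).
Implicit Types x y : E.

Definition rpart x : E := (2^-1)%:C *: (x + star x).

Lemma rpart_sa x : star (rpart x) = rpart x.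
Proof. by rewrite starZr starD starK addrC. Qed.

Lemma rpart_id x : star x = x -> rpart x = x.
Proof. by move=> sx; rewrite /rpart sx scale_halfD. Qed.

Lemma rpartD x y : rpart (x + y) = rpart x + rpart y.
Proof. by rewrite /rpart starD addrACA scalerDr. Qed.

Lemma rpartZ (t : R) x : rpart (t%:C *: x) = t%:C *: rpart x.
Proof. by rewrite /rpart starZr -scalerDr !scalerA mulrC. Qed.

Lemma rpart_i x : star x = x -> rpart ('i *: x) = 0.
Proof. by move=> sx; rewrite /rpart starZi sx subrr scaler0. Qed.

(** The largest spectral value of the real part of x, a sublinear functional such that domination by
    it encodes positivity. In the zero algebra every t would qualify, hence [E10]. *)
Definition ospec x : R := inf [set t | cpos (sc t - rpart x)].

Hypothesis E10 : (1 : E) <> 0.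

Lemma sc_ge0 (t : R) : cpos (sc t) -> 0 <= t.
Proof.
move=> h; rewrite leNgt; apply/negP => t0; apply: E10.
apply: cpos_anti; first by have := cpos_scalar E ler01; rewrite rmorph1 scale1r.
have -> : - (1 : E) = ((- t)^-1)%:C *: sc t.
  by rewrite scalerA -rmorphM invrN mulNr mulVf ?lt_eqF // rmorphN1 scaleN1r.
by apply: cposZ => //; rewrite invr_ge0; lra.
Qed.

Lemma ospec_has_inf x : has_inf [set t | cpos (sc t - rpart x)].
Proof.
split; first by exists (nrm (rpart x)); exact: cpos_subl (rpart_sa x) (lexx _).
exists (- nrm (rpart x)) => t /= h.
have : cpos (sc (nrm (rpart x)) + rpart x).
  have -> : sc (nrm (rpart x)) + rpart x = sc (nrm (rpart x)) - (- rpart x).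
    by rewrite opprK.
  by apply: cpos_subl; rewrite ?nrmN // starN rpart_sa.
move=> /(cposD h).
have -> : sc t - rpart x + (sc (nrm (rpart x)) + rpart x) =
  sc (t + nrm (rpart x)) by rewrite scD; lmod R.
by move/sc_ge0; lra.
Qed.

Lemma ospecP x (t : R) : ospec x <= t <-> cpos (sc t - rpart x).
Proof.
split=> [h|h]; last by apply: ge_inf => //; case: (ospec_has_inf x).
apply: cpos_arch; first by rewrite starB star_sc rpart_sa.
move=> e e0; have [s hs se] := inf_adherent e0 (ospec_has_inf x).
have -> : sc t - rpart x + sc e = (sc s - rpart x) + sc (t + e - s).
  by rewrite rmorphB rmorphD scalerBl scalerDl; lmod R.
by apply: cposD => //; apply: cpos_scalar; move: se h; rewrite -/(ospec x); lra.
Qed.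

Lemma ospecD x y : ospec (x + y) <= ospec x + ospec y.
Proof.
apply/ospecP; rewrite rpartD scD.
have -> : sc (ospec x) + sc (ospec y) - (rpart x + rpart y) =
  (sc (ospec x) - rpart x) + (sc (ospec y) - rpart y) by lmod R.
by apply: cposD; apply/ospecP.
Qed.

Lemma ospecZ (t : R) x : 0 < t -> ospec (t%:C *: x) = t * ospec x.
Proof.
suff h s y : 0 < s -> ospec (s%:C *: y) <= s * ospec y.
  move=> t0; apply/le_anti; rewrite h //= -ler_pdivlMl //.
  apply: le_trans (h _ _ _); last by rewrite invr_gt0.
  by rewrite scalerA -rmorphM mulVf ?gt_eqF // rmorph1 scale1r.
move=> s0; apply/ospecP; rewrite rpartZ rmorphM -scalerA -scalerBr.
by apply: cposZ; [exact: ltW | apply/ospecP].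
Qed.

Lemma ospec_le0 x : cpos (- rpart x) -> ospec x <= 0.
Proof. by move=> h; apply/ospecP; rewrite scale0r sub0r. Qed.

(** G x = g x - i g (i x). For positive x the domination gives g (- x) <= 0, and since i x and - i x
    have real part 0 it also gives g (i x) = 0; so G x is real and nonnegative. *)
Lemma complexify (g : E -> R) (tau : R) : 0 <= tau ->
  (forall x y, g (x + y) = g x + g y) -> (forall (t : R) x, g (t%:C *: x) = t * g x) ->
  (forall x, g x <= tau * ospec x) ->
  exists G : {linear E -> R[i]^o},
    (forall x, cpos x -> 0 <= G x) /\ forall x, G x = (g x +i* - g ('i *: x))%C.
Proof.
move=> tau0 gD gZ gle.
pose G x : R[i]^o := (g x +i* - g ('i *: x))%C.
have gi x : g ('i *: ('i *: x)) = - g x.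
  rewrite scalerA -expr2 sqr_i -(rmorphN1 (real_complex R)) gZ; lra.
have Glin : linear G.
  move=> [a b] x y.
  have e : (a +i* b)%C *: x = a%:C *: x + b%:C *: ('i *: x).
    by rewrite scalerA -scalerDl; congr (_ *: _); simpc.
  rewrite e /G !scalerDr -[RHS]/(Complex (a * g x - b * - g ('i *: x) + g y)
    (a * - g ('i *: x) + b * g x - g ('i *: y))).
  have c (t : R) z : 'i *: (t%:C *: z) = t%:C *: ('i *: z) by rewrite !scalerA mulrC.
  by rewrite !c !gD !gZ gi; congr Complex; ring.
exists (lin_of Glin); split => // x px.
have sx := cpos_sa px.
have le0 y : cpos (- rpart y) -> g y <= 0.
  move=> /ospec_le0 h; apply: le_trans (gle y) _.
  by rewrite mulr_ge0_le0.
have gN y : g (- y) = - g y.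
  by rewrite -scaleN1r -(rmorphN1 (real_complex R)) gZ; lra.
rewrite /G /= lecE /=.
have h1 : g ('i *: x) <= 0.
  by apply: le0; rewrite rpart_i // oppr0; exact: cpos0.
have h2 : g (- ('i *: x)) <= 0.
  by apply: le0; rewrite -[- ('i *: x)]scalerN rpart_i ?oppr0; [exact: cpos0 | rewrite starN sx].
have h3 : g (- x) <= 0.
  by apply: le0; rewrite rpart_id ?opprK // starN sx.
move: h2 h3; rewrite !gN => h2 h3.
by apply/andP; split; [apply/eqP|]; lra.
Qed.

End PositiveFunctionals.

Section Extension.
Variables (R : realType) (E : cstarAlgType R).
Local Notation sc t := (t%:C *: (1 : E)).
Implicit Types x y : E.

Definition pos_functional (F : E -> R[i]) := forall x, cpos x -> 0 <= F x.

(** As x is not positive, ospec (- x) > 0. The functional with value - ospec (- x) at x, defined on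
    the real line through x, is dominated by [ospec] and hence extends. *)
Lemma cpos_separation x : star x = x -> ~ cpos x ->
  exists F : {linear E -> R[i]^o}, pos_functional F /\ F x < 0.
Proof.
move=> sx npx.
have E10 : (1 : E) <> 0.
  move=> e; apply: npx; rewrite -[x]mul1r e mul0r; exact: cpos0.
have px : 0 < ospec (- x).
  rewrite ltNge; apply/negP => /(ospecP E10).
  by rewrite scale0r sub0r rpart_id ?opprK // starN sx.
have p0 : ospec (0 : E) = 0.
  by have := ospecZ E10 0 (ltr0Sn R 1); rewrite scaler0; lra.
have pp : 0 <= ospec x + ospec (- x).
  by rewrite -p0 -[X in ospec X](subrr x) ospecD.
have [|g [gD gZ gp g0]] := @hahn_banach R E (@ospec R E) (ospecD E10) (ospecZ E10)
  [set a | exists s : R, a = (s%:C *: x, - s * ospec (- x))].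
  split.
  - by exists 0; rewrite scale0r oppr0 mul0r.
  - move=> a r b q [s [-> ->]] [t [-> ->]]; exists (s + t).
    by rewrite rmorphD scalerDl opprD mulrDl.
  - move=> t a r [s [-> ->]]; exists (t * s).
    by rewrite rmorphM scalerA -mulrN mulrA.
  - move=> a r [s [-> ->]]; case: (ltgtP s 0) => [s0|s0|->].
    + have -> : s%:C *: x = (- s)%:C *: - x by rewrite rmorphN scaleNr scalerN opprK.
      by rewrite ospecZ //; lra.
    + by rewrite ospecZ //; nra.
    + by rewrite scale0r p0 oppr0 mul0r.
have [|F [Fp FE]] := complexify E10 ler01 gD gZ.
  by move=> y; rewrite mul1r.
have gi y : star y = y -> g ('i *: y) <= 0.
  move=> sy; apply: le_trans (gp _) _; apply: ospec_le0 => //.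
  by rewrite rpart_i // oppr0; exact: cpos0.
have gi0 : g ('i *: x) = 0.
  have h1 := gi _ sx; have h2 := gi (- x).
  have : g (- ('i *: x)) = - g ('i *: x).
    by rewrite -scaleN1r -(rmorphN1 (real_complex R)) gZ; lra.
  by rewrite -scalerN; have := h2 _; rewrite starN sx => /(_ erefl); lra.
exists F; split => //; rewrite FE gi0 oppr0 ltcE /= eqxx /=.
have -> : g x = - ospec (- x).
  by apply: g0; exists 1; rewrite rmorph1 scale1r mulN1r.
by rewrite oppr_lt0.
Qed.

(** Krein's argument: on M the real part of f is dominated by f 1 times [ospec], because the scalar
    [ospec x] minus [rpart x] is a positive element of M. *)
Lemma pos_functional_extension (M : set E) (f : E -> R[i]) :
  M 1 -> (forall (c : R[i]) x y, M x -> M y -> M (c *: x + y)) ->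
  (forall x, M x -> M (star x)) ->
  (forall (c : R[i]) x y, M x -> M y -> f (c *: x + y) = c * f x + f y) ->
  (forall x, M x -> cpos x -> 0 <= f x) ->
  exists F : {linear E -> R[i]^o}, pos_functional F /\ forall x, M x -> F x = f x.
Proof.
move=> M1 Mlin Mstar flin fpos.
have f00 : f 0 = 0.
  by have := flin (-1) _ _ M1 M1; rewrite scaleN1r addNr mulN1r addNr.
have M0 : M 0 by have := Mlin (-1) _ _ M1 M1; rewrite scaleN1r addNr.
have [E1|E10] := pselect ((1 : E) = 0).
  have E0 x : x = 0 by rewrite -[x]mul1r E1 mul0r.
  have l0 : linear (fun _ : E => 0 : R[i]^o).
    by move=> c x y; rewrite scaler0 addr0.
  exists (lin_of l0); split => // x _.
  by rewrite (E0 x) f00.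
have MZ (c : R[i]) x : M x -> M (c *: x) by move=> Mx; rewrite -[_ *: x]addr0; exact: Mlin.
have fZ (c : R[i]) x : M x -> f (c *: x) = c * f x.
  by move=> Mx; rewrite -[c *: x]addr0 flin // f00 addr0.
have MD x y : M x -> M y -> M (x + y).
  by move=> Mx My; rewrite -[x]scale1r; exact: Mlin.
have fD x y : M x -> M y -> f (x + y) = f x + f y.
  by move=> Mx My; rewrite -[x in LHS]scale1r flin // mul1r.
pose tau := Re (f 1).
have f1 : f 1 = tau%:C.
  have : 0 <= f 1.
    by apply: fpos => //; have := cpos_scalar E ler01; rewrite rmorph1 scale1r.
  by move=> h; rewrite /tau RRe_real // ger0_real.
have tau0 : 0 <= tau.
  rewrite -lecR -f1; apply: fpos => //.
  by have := cpos_scalar E ler01; rewrite rmorph1 scale1r.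
have fscB (t : R) x : M x -> f (sc t - x) = (t * tau)%:C - f x.
  move=> Mx; rewrite -scaleN1r addrC flin //; last exact: MZ.
  by rewrite mulN1r fZ // f1 rmorphM addrC.
have fsa x : M x -> star x = x -> Im (f x) = 0.
  move=> Mx sx; have := cpos_subl sx (lexx _).
  have /fpos : M (sc (nrm x) - x).
    by rewrite -scaleN1r addrC; apply: Mlin => //; exact: MZ.
  rewrite fscB // => h /h /ger0_Im; case: (f x) => a b /=; lra.
have reM x : M x -> Re (f (rpart x)) = Re (f x).
  move=> Mx.
  pose k := (2^-1)%:C *: ('i *: (star x - x)).
  have sk : star k = k by rewrite starZr starZi starB starK -scalerN opprB.
  have Mk : M k by apply: (MZ _ _ (MZ _ _ (MD _ _ (Mstar _ Mx) _))); rewrite -scaleN1r; exact: MZ.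
  have Mr : M (rpart x) by apply: MZ; apply: MD => //; exact: Mstar.
  have -> : f x = f (rpart x) + 'i * f k.
    rewrite -fZ // -fD //; last exact: MZ.
    congr f; rewrite /rpart /k !scalerA.
    have -> : 'i * (2^-1)%:C * 'i = - (2^-1)%:C :> R[i].
      by rewrite mulrAC -expr2 sqr_i mulN1r.
    by rewrite -{1}[x]scale_halfD; lmod R.
  have := fsa _ Mk sk; case: (f (rpart x)) => a b; case: (f k) => c d /= ->.
  by ring.
pose q (x : E) := tau * ospec x.
have qD x y : q (x + y) <= q x + q y by rewrite -mulrDr ler_wpM2l // ospecD.
have qZ (t : R) x : 0 < t -> q (t%:C *: x) = t * q x.
  by move=> t0; rewrite /q ospecZ // mulrCA.
have [|g [gD gZ gp g0]] := hahn_banach qD qZ (G0 := [set a | M a.1 /\ a.2 = Re (f a.1)]).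
  split => /=.
  + by rewrite f00.
  + move=> x r y s [Mx ->] [My ->]; split; first exact: MD.
    by rewrite fD //; case: (f x) (f y) => ? ? [? ?].
  + move=> t x r [Mx ->]; split; first exact: MZ.
    by rewrite fZ //; case: (f x) => a b /=; ring.
  + move=> x r [Mx ->]; rewrite -reM //.
    have Mr : M (rpart x) by apply: MZ; apply: MD => //; exact: Mstar.
    have /fpos : M (sc (ospec x) - rpart x).
      by rewrite -scaleN1r addrC; apply: Mlin => //; exact: MZ.
    rewrite fscB //.
    move=> h; have /h : cpos (sc (ospec x) - rpart x) by apply/(ospecP E10).
    by rewrite lecE /= => /andP[_]; rewrite /q; case: (f (rpart x)) => a b /=; lra.
have [F [Fp FE]] := complexify E10 tau0 gD gZ gp.
exists F; split => // x Mx; rewrite FE.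
rewrite (g0 x (Re (f x))) // (g0 ('i *: x) (Re (f ('i *: x)))); last first.
  by split => //=; exact: MZ.
by rewrite fZ //; case: (f x) => a b /=; congr Complex; ring.
Qed.

End Extension.

(** * Positivity tested by scalar quadratic forms *)

Section Representations.
Variables (R : realType) (E : cstarAlgType R) (L : Type) (K : L -> finType).
Variable rho : E -> forall l, K l -> K l -> Calg R.
Arguments rho : clear implicits.
Hypothesis rhoM : forall z w l, rho (z * w) l = opmul (rho z l) (rho w l).
Hypothesis rhoS : forall z l, rho (star z) l = opadj (rho z l).
Hypothesis rhoN : forall z l a b, rho (- z) l a b = - rho z l a b.
Hypothesis rhoI : forall z w, (forall l a b, rho z l a b = rho w l a b) -> z = w.

Definition qform (J : finType) (x : J -> J -> Calg R) (v : J -> Calg R) : R[i] :=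
  dotp v (opapp x v).

Lemma CalgM (x y : Calg R) : x * y = (x : R[i]) * (y : R[i]). Proof. by []. Qed.
Lemma CalgZ (c : R[i]) (x : Calg R) : c *: x = c * (x : R[i]). Proof. by []. Qed.
Lemma CalgD (x y : Calg R) : x + y = (x : R[i]) + (y : R[i]). Proof. by []. Qed.
Lemma Calg_star (x : Calg R) : star x = (x : R[i])^*%C. Proof. by []. Qed.

Lemma dotp_ge0 (J : finType) (v : J -> Calg R) : 0 <= (dotp v v : R[i]).
Proof.
apply: (@sumr_ge0 R[i]) => j _; rewrite CalgM Calg_star mulrC; exact: mulcJ_ge0.
Qed.

Lemma dotp_unitl (J : finType) (v : J -> Calg R) a : dotp (unitv _ a) v = v a.
Proof.
rewrite /dotp /unitv (bigD1 a) //= eqxx star1 mul1r big1 ?addr0 //.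
by move=> b /negbTE ->; rewrite star0 mul0r.
Qed.

Lemma qform_comb (J : finType) (x : J -> J -> Calg R) v w (c : R[i]) :
  qform x (fun j => v j + c *: w j) =
  qform x v + c * dotp v (opapp x w) + (c^*)%C * dotp w (opapp x v)
    + (c^*)%C * c * qform x w.
Proof.
rewrite /qform.
have -> : opapp x (fun j => v j + c *: w j) =
    fun j => opapp x v j + c *: opapp x w j.
  apply/funext => j; rewrite /opapp scaler_sumr -big_split.
  by apply: eq_bigr => k _; rewrite mulrDr mulZr.
rewrite dotpDl !dotpDr !dotpZl !dotpZr.
rewrite -[LHS]/((qform x v + c * dotp v (opapp x w)) +
  ((c^*)%C * dotp w (opapp x v) + (c^*)%C * (c * qform x w)) : R[i]).
by rewrite mulrA [LHS]addrA.
Qed.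

Lemma qform_adj (J : finType) (x : J -> J -> Calg R) v :
  qform (opadj x) v = ((qform x v)^*)%C.
Proof. by rewrite /qform -Calg_star star_dotp dotp_adj. Qed.

(* By polarization over p + q and p + i q. *)
Lemma qform_inj (J : finType) (x y : J -> J -> Calg R) :
  (forall v, qform x v = qform y v) -> forall a b, x a b = y a b.
Proof.
move=> h a b.
have key (z : J -> J -> Calg R) : dotp (unitv _ a) (opapp z (unitv _ b)) = z a b.
  by rewrite dotp_unitl opapp_unitv.
pose p := unitv (Calg R) a; pose q := unitv (Calg R) b.
have := h (fun j => p j + 1%C *: q j); have := h (fun j => p j + 'i *: q j).
rewrite !qform_comb !h conjc1 !mul1r.
move: (dotp p (opapp x q)) (dotp p (opapp y q)) (key x) (key y) => A1 A2 <- <-.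
move: (dotp q (opapp x p)) (dotp q (opapp y p)) => B1 B2.
have -> : ('i^*)%C = - 'i :> R[i] by simpc.
have canc (s t c d c' d' : R[i]) : s + c + d + t = s + c' + d' + t -> c + d = c' + d'.
  by rewrite -!addrA => /addrI; rewrite !addrA => /addIr.
move=> /canc e1 /canc e2.
have e3 : 'i * (A1 - B1 : R[i]) = 'i * (A2 - B2).
  by rewrite !mulrBr -!mulNr.
have i0 : 'i != 0 :> R[i] by rewrite eq_complex /= oner_eq0 andbF.
have /(mulfI i0) e4 := e3.
have : (A1 : R[i]) *+ 2 = A2 *+ 2.
  have -> : (A1 : R[i]) *+ 2 = (A1 + B1) + (A1 - B1) by ring.
  by rewrite e2 e4; ring.
by move/eqP; rewrite eqrMn2r // => /eqP.
Qed.

(** The converse goes through [cpos_of_flank]: if - b z b is positive, the form of b z b at v is at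
    most 0, but it is also the form of z at b v. So all forms of b z b vanish, and polarization with
    joint faithfulness gives b z b = 0. *)
Lemma rep_pos z : cpos z <-> forall l v, 0 <= qform (rho z l) v.
Proof.
split=> [/cposP[y ->] l v|h].
  by rewrite rhoM rhoS /qform opapp_mul -{1}(opadjK (rho y l)) -dotp_adj ?opadjK dotp_ge0.
apply: cpos_of_flank.
  apply: rhoI => l; apply: qform_inj => v; rewrite rhoS qform_adj.
  have := ger0_Im (h l v); case: (qform _ _) => a b /= ->; by simpc.
move=> b sb hb.
have zero l v : qform (rho (b * z * b) l) v = 0.
  apply/le_anti/andP; split; last first.
    rewrite !rhoM /qform !opapp_mul -{1}sb rhoS -dotp_adj.
    exact: h.
  have /cposP[y ey] := hb.
  have : 0 <= qform (rho (- (b * z * b)) l) v.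
    rewrite ey rhoM rhoS /qform opapp_mul -{1}(opadjK (rho y l)) -dotp_adj opadjK.
    exact: dotp_ge0.
  have -> : qform (rho (- (b * z * b)) l) v = - qform (rho (b * z * b) l) v.
    rewrite /qform.
    have -> : opapp (rho (- (b * z * b)) l) v = fun j => - opapp (rho (b * z * b) l) v j.
      apply/funext => j; rewrite /opapp -sumrN.
      by apply: eq_bigr => k _; rewrite rhoN mulNr.
    exact: (etrans (dotpNr v (opapp (rho (b * z * b) l) v))).
  by rewrite oppr_ge0.
apply: rhoI => l; apply: qform_inj => v; rewrite zero.
(* [rhoN] at 0 says that each entry equals its opposite. *)
have e0 : rho 0 l = fun a b => 0.
  apply/funext => p; apply/funext => q.
  have := rhoN 0 p q; rewrite oppr0 => /eqP; rewrite -addr_eq0 => /eqP e.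
  apply/eqP; have : (rho 0 l p q : R[i]) *+ 2 == 0 by rewrite mulr2n; apply/eqP.
  by rewrite mulrn_eq0.
rewrite e0 /qform /dotp big1 // => j _; rewrite /opapp big1 ?mulr0 // => k _.
by rewrite mul0r.
Qed.

End Representations.

(** * Matrix algebras over a C*-algebra and their order *)

Section Matrices.
Variables (R : realType) (A : cstarAlgType R).

Definition matAlg (n : nat) : cstarAlgType R := falg A (fun _ : unit => 'I_n : finType).

Lemma flat_bounded n (X : 'M[A]_n) :
  bounded_opfam (I := unit) (J := fun=> 'I_n : finType) (fun _ a b => X a b).
Proof.
exists (\sum_a \sum_b nrm (X a b)); last by move=> i; exact: opbnd_sum.
by apply: sumr_ge0 => a _; apply: sumr_ge0 => b _; exact: nrm_ge0.
Qed.

Definition flat n (X : 'M[A]_n) : matAlg n := bfam_of _ (flat_bounded X).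
Definition unflat n (x : matAlg n) : 'M[A]_n := \matrix_(a, b) ent x tt a b.

Lemma ent_flat n (X : 'M[A]_n) (i : unit) (a b : 'I_n) : ent (flat X) i a b = X a b.
Proof. by []. Qed.

Lemma unflatK n (x : matAlg n) : flat (unflat x) = x.
Proof. by apply: falg_eq => -[] a b; rewrite ent_flat mxE. Qed.

Lemma flat_inj n : injective (@flat n).
Proof. by move=> X Y e; apply/matrixP => a b; exact: (congr1 (fun z => ent z tt a b) e). Qed.

Lemma flatM n (X Y : 'M[A]_n) : flat (X *m Y) = flat X * flat Y.
Proof.
by apply: falg_eq => i a b; rewrite entM ent_flat mxE; apply: eq_bigr => c _.
Qed.

Definition mxstar n (X : 'M[A]_n) : 'M[A]_n := (map_mx (@star R A) X)^T.

Lemma flat_star n (X : 'M[A]_n) : flat (mxstar X) = star (flat X).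
Proof. by apply: falg_eq => i a b; rewrite ent_star ent_flat !mxE. Qed.

Lemma flatD n (X Y : 'M[A]_n) : flat (X + Y) = flat X + flat Y.
Proof. by apply: falg_eq => i a b; rewrite entD !ent_flat mxE. Qed.

Lemma flatZ n (c : R[i]) (X : 'M[A]_n) :
  flat (map_mx (fun x => c *: x) X) = c *: flat X.
Proof. by apply: falg_eq => i a b; rewrite entZ !ent_flat mxE. Qed.

Lemma flat1 n : flat (1%:M : 'M[A]_n) = 1.
Proof.
by apply: falg_eq => i a b; rewrite ent1 ent_flat mxE /opone; case: eqP.
Qed.

Lemma flat_pos n (X : 'M[A]_n) :
  cpos (flat X) <-> exists Y : 'M[A]_n, X = mxstar Y *m Y.
Proof.
split=> [/cposP[y e]|[Y ->]]; last first.
  by rewrite flatM flat_star; exact: cpos_starM.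
by exists (unflat y); apply: flat_inj; rewrite flatM flat_star unflatK.
Qed.

End Matrices.

Section MatrixPositivity.
Variable R : realType.

Definition flatS (S : opSystem R) n (X : 'M[S]_n) : matAlg (ambient S) n :=
  flat (map_mx val X).

Lemma mx_posP (S : opSystem R) n (X : 'M[S]_n) : mx_pos X <-> cpos (flatS X).
Proof. by split=> [[Y e]|/flat_pos[Y e]]; [apply/flat_pos | ]; exists Y. Qed.

Variables (I : Type) (J : I -> finType).
Local Notation W := (falg (Calg R) J).

(** M_n of a product of matrix algebras is again such a product: the component at i is one scalar
    matrix with index set ['I_n * J i]. *)
Definition mxform n (X : 'M[W]_n) i : ('I_n * J i) -> ('I_n * J i) -> Calg R :=
  fun s t => ent (X s.1 t.1) i s.2 t.2.

Arguments mxform {n} X i s t.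

Section Rep.
Variables (n : nat) (i : I).
Implicit Types z w : matAlg W n.
Definition mxrep z : ('I_n * J i) -> ('I_n * J i) -> Calg R :=
  fun s t => ent (ent z tt s.1 t.1) i s.2 t.2.

Lemma mxrepM z w : mxrep (z * w) = opmul (mxrep z) (mxrep w).
Proof.
apply/funext => -[a p]; apply/funext => -[b q].
rewrite /mxrep entM /opmul ent_sum /=.
under eq_bigr => c _ do rewrite entM /opmul.
by rewrite (pair_bigA _ (fun c r => ent (ent z tt a c) i p r * ent (ent w tt c b) i r q)).
Qed.

Lemma mxrep_star z : mxrep (star z) = opadj (mxrep z).
Proof.
apply/funext => s; apply/funext => t.
have e : ent (star z) tt s.1 t.1 = star (ent z tt t.1 s.1).
  exact: (congr1 (fun f => f s.1 t.1) (ent_star z tt)).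
by rewrite /mxrep e.
Qed.

Lemma mxrepN z s t : mxrep (- z) s t = - mxrep z s t.
Proof.
have e : ent (- z) tt s.1 t.1 = - ent z tt s.1 t.1 by exact: entN.
by rewrite /mxrep e; exact: entN.
Qed.

Lemma mxrep_flat (X : 'M[W]_n) : mxrep (flat X) = mxform X i.
Proof.
apply/funext => s; apply/funext => t.
exact: (congr1 (fun x : W => ent x i s.2 t.2) (ent_flat X tt s.1 t.1)).
Qed.

End Rep.

Arguments mxrep {n} i z s t.

Lemma mxrep_inj n (z w : matAlg W n) :
  (forall i s t, mxrep i z s t = mxrep i w s t) -> z = w.
Proof.
move=> h; apply: falg_eq => -[] a b; apply: falg_eq => i p q.
exact: (h i (a, p) (b, q)).
Qed.

Lemma flat_forms n (X : 'M[W]_n) :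
  cpos (flat X) <-> forall i v, 0 <= qform (mxform X i) v.
Proof.
have [h1 h2] := rep_pos (fun z w i => mxrepM i z w) (fun z i => mxrep_star i z)
  (fun z i s t => mxrepN z s t) (@mxrep_inj n) (flat X).
split=> [/h1 h i v|h]; first by rewrite -mxrep_flat; exact: h.
by apply: h2 => i v; rewrite mxrep_flat; exact: h.
Qed.

End MatrixPositivity.

Arguments mxform {R I J n} X i s t.

(** * States of order n on an operator system *)

Lemma sum_pair (U : nmodType) (I J : finType) (G : I * J -> U) :
  \sum_s G s = \sum_i \sum_j G (i, j).
Proof. by rewrite pair_bigA; apply: eq_bigr => -[]. Qed.

Section MatrixUnits.
Variables (V : nmodType) (n : nat).

Definition Emat (p q : 'I_n) (a : V) : 'M[V]_n :=
  \matrix_(i, j) (if (i == p) && (j == q) then a else 0).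

Lemma sum_Emat (U : nmodType) (f : 'I_n -> 'I_n -> V -> U) p q a :
  (forall i j, f i j 0 = 0) ->
  \sum_i \sum_j f i j (Emat p q a i j) = f p q a.
Proof.
move=> f0; rewrite (bigD1 p) //= (bigD1 q) //= mxE !eqxx /=.
rewrite big1 ?addr0 => [|j /negbTE jq]; last by rewrite mxE jq andbF f0.
by rewrite big1 ?addr0 // => i /negbTE ip; rewrite big1 // => j _; rewrite mxE ip f0.
Qed.

End MatrixUnits.

Lemma map_Emat (U V : nmodType) (f : U -> V) n (p q : 'I_n) a :
  f 0 = 0 -> map_mx f (Emat p q a) = Emat p q (f a).
Proof. by move=> f0; apply/matrixP => i j; rewrite !mxE; case: ifP. Qed.

Section UcpStar.
Variable R : realType.
Implicit Types S T : opSystem R.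

Definition os_adj S (x : S) : S := exist _ (star (val x)) (os_star (valP x)).

Lemma mx_pos1 S (x : S) : mx_pos (const_mx x : 'M[S]_1) <-> cpos (val x).
Proof.
split=> [[Y /matrixP/(_ ord0 ord0)]|/cposP[y e]].
  by rewrite !mxE big_ord1 !mxE => ->; exact: cpos_starM.
exists (const_mx y); apply/matrixP => a b; rewrite !mxE big_ord1 !mxE; exact: e.
Qed.

Lemma ucp_pos1 S T (f : {linear S -> T}) x : ucp f -> cpos (val x) -> cpos (val (f x)).
Proof.
move=> [_ fp] /mx_pos1 /fp h; apply/mx_pos1; move: h.
by congr mx_pos; apply/matrixP => a b; rewrite !mxE.
Qed.

Lemma ucp_one S T (f : {linear S -> T}) : ucp f -> f (os_one S) = os_one T.
Proof. by case. Qed.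

(** The scalar |x| minus x is positive, so its image is positive and in particular self-adjoint. *)
Lemma ucp_sa S T (f : {linear S -> T}) (x : S) : ucp f ->
  star (val x) = val x -> star (val (f x)) = val (f x).
Proof.
move=> uf sx; pose t := nrm (val x).
have : cpos (val (t%:C *: os_one S - x)) by exact: cpos_subl.
move=> /(ucp_pos1 uf) /cpos_sa.
have -> : f (t%:C *: os_one S - x) = t%:C *: os_one T - f x.
  by rewrite linearB linearZ ucp_one.
move=> h; have : star (t%:C *: (1 : ambient T) - val (f x)) =
  t%:C *: (1 : ambient T) - val (f x) by exact: h.
by rewrite starB star_sc => /eqP; rewrite (inj_eq (addrI _)) eqr_opp => /eqP.
Qed.

Lemma os_adj_decomp S (x : S) : exists h k : S, [/\ star (val h) = val h,
  star (val k) = val k, x = h + 'i *: k & os_adj x = h - 'i *: k].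
Proof.
exists ((2^-1)%:C *: (x + os_adj x)), ((2^-1)%:C *: ('i *: (os_adj x - x))).
have ii : 'i * (2^-1)%:C * 'i = - (2^-1)%:C :> R[i].
  by rewrite mulrAC -expr2 sqr_i mulN1r.
split.
- by rewrite [LHS]starZr starD starK addrC.
- by rewrite [LHS]starZr starZi starB starK -scalerN opprB.
- by rewrite !scalerA ii; lmod R.
- by rewrite !scalerA ii; lmod R.
Qed.

Lemma ucp_star S T (f : {linear S -> T}) x : ucp f ->
  f (os_adj x) = os_adj (f x).
Proof.
move=> uf; have [h [k [sh sk -> ->]]] := os_adj_decomp x.
have -> : f (h - 'i *: k) = f h - 'i *: f k by rewrite linearB linearZ.
have -> : f (h + 'i *: k) = f h + 'i *: f k by rewrite linearD linearZ.
apply: val_inj; transitivity (val (f h) - 'i *: val (f k)); first by [].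
transitivity (star (val (f h) + 'i *: val (f k))); last by [].
by rewrite starD starZi !ucp_sa.
Qed.

End UcpStar.

Section States.
Variable R : realType.

(** The amplification of f applied to X, read as one scalar matrix over ['I_k * 'I_n]. *)
Definition stform (V : Type) n (f : 'I_n -> 'I_n -> V -> R[i]) k (X : 'M[V]_k)
  : ('I_k * 'I_n) -> ('I_k * 'I_n) -> Calg R :=
  fun s t => f s.2 t.2 (X s.1 t.1).

(* A state of order n is a unital completely positive map from S to the n x n
   complex matrices, given by its coordinate functionals. *)
Record state (S : opSystem R) (n : nat) := State {
  st_fun :> 'I_n -> 'I_n -> S -> R[i];
  st_lin : forall p q (c : R[i]) x y,
    st_fun p q (c *: x + y) = c * st_fun p q x + st_fun p q y;
  st_one : forall p q, st_fun p q (os_one S) = (p == q)%:R;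
  st_pos : forall k (X : 'M[S]_k) v, mx_pos X -> 0 <= qform (stform st_fun X) v
}.

Lemma qformE (J : finType) (x : J -> J -> Calg R) (v : J -> Calg R) :
  qform x v = \sum_s \sum_t ((v s : R[i])^*)%C * ((x s t : R[i]) * (v t : R[i])) :> R[i].
Proof.
rewrite /qform /dotp /opapp; apply: eq_bigr => s _.
by rewrite CalgM Calg_star; exact: (@mulr_sumr R[i]).
Qed.

(** One direction of the correspondence between functionals on M_n(A) and maps from A to M_n: the
    coordinates are the values of F at the matrices with a single entry a. *)
Definition fcoord (A : cstarAlgType R) n (F : matAlg A n -> R[i]) (p q : 'I_n)
  (a : A) : R[i] := F (flat (Emat p q a)).

(** The matrix is the sum over c of [star V * V], where V carries [w c] in row 0 and zeros
    elsewhere; order 0 has no such row and is treated apart. *)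
Lemma gram_pos (A : cstarAlgType R) (C : finType) n (w : C -> 'I_n -> A) :
  cpos (flat (\matrix_(p, q) \sum_c star (w c p) * w c q)).
Proof.
case: n w => [|m] w.
  set x := flat _; have -> : x = 0 by apply: falg_eq => i [].
  exact: cpos0.
pose Vc c : matAlg A m.+1 :=
  flat (\matrix_(r, q) if r == ord0 then w c q else 0).
have -> : flat (\matrix_(p, q) \sum_c star (w c p) * w c q) =
    \sum_c star (Vc c) * Vc c.
  apply: falg_eq => i p q; rewrite ent_sum ent_flat mxE; apply: eq_bigr => c _.
  rewrite entM ent_star /opmul /opadj (bigD1 ord0) //= !ent_flat !mxE eqxx.
  rewrite big1 ?addr0 // => r /negbTE r0.
  by rewrite !ent_flat !mxE r0 mulr0.
by apply: cpos_sum => c _; exact: cpos_starM.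
Qed.

Section Functional.
Variables (A : cstarAlgType R) (n : nat) (F : {linear matAlg A n -> R[i]^o}).

Lemma flat_Emat_lin p q (c : R[i]) (x y : A) :
  flat (Emat p q (c *: x + y)) = c *: flat (Emat p q x) + flat (Emat p q y)
  :> matAlg A n.
Proof.
rewrite -flatZ -flatD; congr flat; apply/matrixP => i j; rewrite !mxE.
by case: ifP; rewrite ?scaler0 ?addr0.
Qed.

Lemma fcoord_lin p q (c : R[i]) (x y : A) :
  fcoord F p q (c *: x + y) = c * fcoord F p q x + fcoord F p q y.
Proof. by rewrite /fcoord flat_Emat_lin linearP. Qed.

Lemma fcoord0 p q : fcoord F p q 0 = 0.
Proof.
rewrite /fcoord; have -> : flat (Emat p q 0) = 0 :> matAlg A n.
  by apply: falg_eq => i a b; rewrite ent_flat mxE; case: ifP.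
exact: linear0.
Qed.

Lemma flat_sum (X : 'M[A]_n) : flat X = \sum_p \sum_q flat (Emat p q (X p q)).
Proof.
apply: falg_eq => i a b; rewrite ent_sum.
under eq_bigr => p _ do rewrite ent_sum.
under eq_bigr => p _ do under eq_bigr => q _ do rewrite ent_flat mxE.
rewrite ent_flat (bigD1 a) //= (bigD1 b) //= !eqxx /=.
rewrite big1 ?addr0 => [|q]; last by rewrite eq_sym => /negbTE ->; rewrite ?andbF.
rewrite big1 ?addr0 // => p; rewrite eq_sym => /negbTE ->.
by rewrite big1.
Qed.

Lemma fcoord_sum (X : 'M[A]_n) : F (flat X) = \sum_p \sum_q fcoord F p q (X p q).
Proof.
rewrite flat_sum linear_sum; apply: eq_bigr => p _; rewrite linear_sum.
by [].
Qed.

(** Writing X as [star Y * Y] turns the form at v into the value of F at the Gram matrix of the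
    elements sum_b v(b, q) Y c b. Thus positivity of F on M_n(A) yields complete positivity of the
    associated map. *)
Lemma fcoord_pos k (X : 'M[A]_k) v : pos_functional F -> cpos (flat X) ->
  0 <= qform (stform (fcoord F) X) v.
Proof.
move=> Fp /flat_pos[Y eX].
pose w c q : A := \sum_b (v (b, q) : R[i]) *: Y c b.
pose Z : 'M[A]_n := \matrix_(p, q) \sum_c star (w c p) * w c q.
have Zp : cpos (flat Z) by exact: gram_pos.
suff -> : qform (stform (fcoord F) X) v = F (flat Z) by exact: Fp.
rewrite qformE fcoord_sum.
have eZ p q : Z p q = \sum_a \sum_b
    (((v (a, p) : R[i])^*)%C * (v (b, q) : R[i])) *: X a b.
  rewrite /Z mxE.
  transitivity (\sum_c \sum_a \sum_b
    (((v (a, p) : R[i])^*)%C * (v (b, q) : R[i])) *: (star (Y c a) * Y c b)).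
    apply: eq_bigr => c _; rewrite /w star_sum mulr_suml; apply: eq_bigr => a _.
    rewrite starZ mulr_sumr; apply: eq_bigr => b _.
    by rewrite mulZl mulZr scalerA.
  rewrite exchange_big; apply: eq_bigr => a _.
  rewrite exchange_big; apply: eq_bigr => b _.
  rewrite -scaler_sumr eX mxE; congr (_ *: _).
  by apply: eq_bigr => c _; rewrite !mxE.
have flin p q (I : finType) (G : I -> R[i]) (H : I -> A) :
    fcoord F p q (\sum_i G i *: H i) = \sum_i G i * fcoord F p q (H i).
  elim/big_rec2: _ => [|i y z _ <-]; [exact: fcoord0 | exact: fcoord_lin].
rewrite sum_pair exchange_big; apply: eq_bigr => p _.
under eq_bigr => a _ do rewrite sum_pair exchange_big.
rewrite exchange_big; apply: eq_bigr => q _ /=.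
rewrite eZ -(sum_pair (fun s => (((v (s.1, p) : R[i])^*)%C * (v (s.2, q) : R[i])) *:
  X s.1 s.2)) flin sum_pair /=.
apply: eq_bigr => a _; apply: eq_bigr => b _.
by rewrite /stform /= -mulrA; congr (_ * _); rewrite mulrC.
Qed.

End Functional.
End States.

Section StateExtension.
Variable R : realType.
Implicit Types S T : opSystem R.

Lemma st0 S n (f : state S n) p q : f p q 0 = 0.
Proof.
by have := st_lin f p q (-1) 0 0; rewrite scaler0 addr0 mulN1r addNr.
Qed.

Definition state_of_functional S n (F : {linear matAlg (ambient S) n -> R[i]^o})
  (Fp : pos_functional F) (F1 : forall p q, fcoord F p q 1 = (p == q)%:R) : state S n.
Proof.
refine (@State R S n (fun p q x => fcoord F p q (val x)) _ _ _).
- by move=> p q c x y; exact: fcoord_lin.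
- by move=> p q; exact: F1.
- move=> k X v /mx_posP pX.
  have := @fcoord_pos R (ambient S) n F k (map_mx val X) v Fp pX.
  by congr (is_true (0 <= qform _ _)); apply/funext => s; apply/funext => t;
     rewrite /stform mxE.
Defined.

(** Evaluation at the sum of the e_p tensor e_p recovers the functional on M_n(V) attached to f;
    this is the other direction of the correspondence with functionals. *)
Lemma qform_delta (V : Type) n (f : 'I_n -> 'I_n -> V -> R[i]) (X : 'M[V]_n) :
  qform (stform f X) (fun s => if s.1 == s.2 then 1 else 0) =
  \sum_p \sum_q f p q (X p q).
Proof.
rewrite qformE sum_pair exchange_big.
apply: eq_bigr => p _; rewrite (bigD1 p) //= eqxx conjc1.
rewrite [X in _ + X]big1 => [|a /negbTE ->]; last first.
  by rewrite big1 // => t _; rewrite conjc0 mul0r.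
rewrite addr0 sum_pair exchange_big; apply: eq_bigr => q _.
rewrite (bigD1 q) //= eqxx big1 => [|b /negbTE ->]; last by rewrite !mulr0.
by rewrite addr0 mul1r mulr1.
Qed.

Lemma st_trace_pos S n (f : state S n) (X : 'M[S]_n) : mx_pos X ->
  0 <= \sum_p \sum_q f p q (X p q).
Proof. by move=> pX; rewrite -qform_delta; exact: st_pos. Qed.

Lemma flatS_map_inj S T (j : {linear S -> T}) n : injective j ->
  injective (fun X : 'M[S]_n => flatS (map_mx j X)).
Proof.
move=> inj X Y /flat_inj /matrixP e; apply/matrixP => a b.
by apply: inj; apply: val_inj; have := e a b; rewrite !mxE.
Qed.

(** A state of order n on S is viewed as a functional on M_n(S). Transported to the image of M_n(S)
    in the matrices over the ambient algebra of T it stays positive, because j reflects the matrix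
    order; a positive extension is read back as a state. *)
Lemma state_extension S T (j : {linear S -> T}) n (f : state S n) :
  complete_order_injection j ->
  exists g : state T n, forall p q x, g p q (j x) = f p q x.
Proof.
move=> [uj inj jpos].
pose m (X : 'M[S]_n) := flatS (map_mx j X).
pose F0 (X : 'M[S]_n) := \sum_p \sum_q f p q (X p q).
(* The value 0 outside the image of [m] is a default; the extension theorem constrains [F1] on the
   image only. *)
pose F1 (x : matAlg (ambient T) n) : R[i] :=
  if pselect (exists X, x = m X) is left h then F0 (projT1 (cid h)) else 0.
have F1E X : F1 (m X) = F0 X.
  rewrite /F1; case: pselect => [h|]; last by case; exists X.
  by case: cid => Y /= e; rewrite (flatS_map_inj inj e).
have mlin (c : R[i]) (X Y : 'M[S]_n) : m (\matrix_(a, b) (c *: X a b + Y a b)) = c *: m X + m Y.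
  rewrite /m /flatS -flatZ -flatD; congr flat; apply/matrixP => a b.
  by rewrite !mxE linearP.
have [|||||F [Fp FE]] := @pos_functional_extension R (matAlg (ambient T) n)
  [set x | exists X, x = m X] F1.
- exists (\matrix_(a, b) (if a == b then os_one S else 0)).
  rewrite -flat1; congr flat; apply/matrixP => a b; rewrite !mxE.
  by case: eqP; rewrite ?(ucp_one uj) ?linear0.
- by move=> c _ _ [X ->] [Y ->]; eexists; rewrite -mlin.
- move=> _ [X ->]; exists (\matrix_(a, b) os_adj (X b a)).
  rewrite -flat_star; congr flat; apply/matrixP => a b.
  by rewrite !mxE (ucp_star _ uj).
- move=> c _ _ [X ->] [Y ->]; rewrite -mlin !F1E /F0 mulr_sumr -big_split.
  apply: eq_bigr => p _; rewrite mulr_sumr -big_split; apply: eq_bigr => q _.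
  by rewrite mxE st_lin.
- move=> _ [X ->] /mx_posP /jpos pX; rewrite F1E; exact: st_trace_pos.
have FEm p q (x : S) : fcoord F p q (val (j x)) = f p q x.
  have e : flat (Emat p q (val (j x))) = m (Emat p q x).
    by rewrite /m /flatS !map_Emat ?linear0.
  rewrite /fcoord e FE; last by eexists.
  by rewrite F1E /F0 sum_Emat // => a b; exact: st0.
have F11 p q : fcoord F p q 1 = (p == q)%:R.
  by have := FEm p q (os_one S); rewrite (ucp_one uj) st_one.
by exists (state_of_functional Fp F11).
Qed.

End StateExtension.

(** * Separation of non-positive matrices by states *)

Section StateSeparation.
Variables (R : realType) (S : opSystem R).

Lemma state_pos_functional (A : cstarAlgType R) : (1 : A) <> 0 ->
  exists w : {linear A -> R[i]^o}, pos_functional w /\ 0 < w 1.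
Proof.
move=> A1; have [||w [wp w1]] := @cpos_separation R A (- 1).
- by rewrite starN star1.
- have p1 := cpos_scalar A ler01; rewrite rmorph1 scale1r in p1.
  by move=> n1; apply: A1; exact: cpos_anti.
by exists w; split => //; rewrite linearN oppr_lt0 in w1.
Qed.

(** The trace followed by w. Its matrix of values at the unit is w 1 times the identity; when w 1 >
    0, adding a small multiple of it to a positive functional makes the matrix of that functional
    invertible. *)
Lemma trace_functional (A : cstarAlgType R) n (w : {linear A -> R[i]^o}) :
  pos_functional w -> exists T : {linear matAlg A n -> R[i]^o},
  pos_functional T /\ forall p q, fcoord T p q 1 = (p == q)%:R * w 1.
Proof.
move=> wp; pose T (x : matAlg A n) : R[i]^o := \sum_p w (ent x tt p p).
have Tlin : linear T.
  move=> c x y; rewrite /T scaler_sumr -big_split; apply: eq_bigr => p _.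
  by rewrite entD entZ linearP.
exists (lin_of Tlin); split.
  move=> x /cposP[z ->]; apply: (@sumr_ge0 R[i]) => p _; apply: wp.
  by rewrite entM ent_star; apply: cpos_sum => c _; exact: cpos_starM.
move=> p q; rewrite /fcoord /= /T.
have [->|npq] := eqVneq p q.
  rewrite (bigD1 q) //= ent_flat mxE !eqxx /= big1 ?addr0 ?mul1r // => i /negbTE iq.
  by rewrite ent_flat mxE iq linear0.
rewrite mul0r big1 // => i _; rewrite ent_flat mxE.
case: eqP => [->|]; rewrite ?linear0 //=.
by rewrite (negbTE npq) linear0.
Qed.

Lemma pos_functional_star (A : cstarAlgType R) (F : {linear A -> R[i]^o}) x :
  pos_functional F -> star x = x -> Im (F x) = 0.
Proof.
move=> Fp sx; have h1 := Fp _ (cpos_subl sx (lexx _)).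
have h2 := Fp _ (cpos_scalar A (nrm_ge0 x)).
move: h1; rewrite linearB => h1.
have := ger0_Im h1; have := ger0_Im h2; case: (F x) => a b.
by case: (F _) => c d /= -> ; rewrite sub0r => /eqP; rewrite oppr_eq0 => /eqP.
Qed.

(** If x is not self-adjoint, k = i (star x - x) is self-adjoint and nonzero, so some positive
    functional does not vanish at k, and its value at x is not real. *)
Lemma nonpos_functional (A : cstarAlgType R) (x : A) : ~ cpos x ->
  exists F : {linear A -> R[i]^o}, pos_functional F /\ ~ (0 <= (F x : R[i])).
Proof.
move=> nx; have [sx|nsx] := pselect (star x = x).
  have [F [Fp Fx]] := cpos_separation sx nx; exists F; split => // h.
  by have := lt_le_trans Fx h; rewrite ltxx.
pose k := 'i *: (star x - x).
have sk : star k = k by rewrite starZi starB starK -scalerN opprB.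
have k0 : k <> 0.
  move=> e; apply: nsx; apply/eqP; rewrite -subr_eq0; apply/eqP.
  have : 'i *: k = 0 by rewrite e scaler0.
  by rewrite scalerA -expr2 sqr_i scaleN1r => /eqP; rewrite oppr_eq0 => /eqP.
have [F [Fp Fk]] : exists F : {linear A -> R[i]^o}, pos_functional F /\ F k <> 0.
  have [pk|npk] := pselect (cpos k).
    have npk : ~ cpos (- k) by move=> h; apply: k0; exact: cpos_anti.
    have [|F [Fp Fx]] := cpos_separation _ npk; first by rewrite starN sk.
    by exists F; split => // e; move: Fx; rewrite linearN e oppr0 ltxx.
  have [F [Fp Fx]] := cpos_separation sk npk.
  by exists F; split => // e; move: Fx; rewrite e ltxx.
exists F; split => // Fx; apply: Fk.
have h : F k = 'i * (F (star x + x) - 2%:R * F x : R[i]).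
  rewrite linearZ linearB linearD /= /GRing.scale /=; congr (_ * _); ring.
have := pos_functional_star Fp sk.
have : Im (F (star x + x)) = 0.
  by apply: pos_functional_star => //; rewrite starD starK addrC.
rewrite h; move: (F (star x + x)) (F x) (ger0_Im Fx) => [a b] [c d] /= -> ->.
by simpc => /= e; apply/eqP; rewrite eq_complex /=; apply/andP; split; apply/eqP; lra.
Qed.

(** The bound makes Q positive, so Q = Z^* Z, and Z is invertible because a kernel vector would have
    form 0. Then L = Z^-1 compresses Q to the identity. *)
Lemma gram_inverse n (Q : 'I_n -> 'I_n -> Calg R) (c : R) : 0 < c ->
  (forall v : 'I_n -> Calg R, c%:C * (dotp v v : R[i]) <= qform Q v) ->
  exists L M : 'M[R[i]]_n, L *m M = 1%:M /\
    forall p q, \sum_r \sum_t (L r p)^*%C * (Q r t : R[i]) * L t q = (p == q)%:R.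
Proof.
move=> c0 hQ.
pose rho (z : matAlg (Calg R) n) (i : unit) := ent z i.
pose q : matAlg (Calg R) n := flat (\matrix_(a, b) Q a b).
have qE i : ent q i = Q.
  by apply/funext => a; apply/funext => b; rewrite ent_flat mxE.
have qp : cpos q.
  apply/(rep_pos (rho := rho)) => [//|//|z i a b|z w h|i v].
  - exact: entN.
  - exact: falg_eq.
  - rewrite /rho qE; apply: le_trans (hQ v).
    by rewrite mulr_ge0 ?dotp_ge0 // lecR ltW.
have /cposP[z ez] := qp.
pose Z : 'M[R[i]]_n := \matrix_(a, b) (ent z tt a b : R[i]).
have QE a b : (Q a b : R[i]) = \sum_k (Z k a)^*%C * Z k b.
  rewrite -(qE tt) ez entM ent_star; apply: eq_bigr => k _.
  by rewrite !mxE.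
have Zu : Z \in unitmx.
  rewrite unitmxE unitfE -det_tr; apply/det0P => -[v vn vZ].
  have : qform Q (fun k => v 0 k) = 0.
    rewrite qformE.
    transitivity (\sum_k (\sum_a v 0 a * Z k a)^*%C * (\sum_b v 0 b * Z k b)).
      under [RHS]eq_bigr => k _ do rewrite rmorph_sum mulr_suml.
      rewrite [RHS]exchange_big; apply: eq_bigr => a _.
      under [RHS]eq_bigr => k _ do rewrite mulr_sumr.
      rewrite [RHS]exchange_big; apply: eq_bigr => b _.
      rewrite QE mulr_suml mulr_sumr; apply: eq_bigr => k _.
      by rewrite rmorphM /=; ring.
    rewrite big1 // => k _.
    have -> : \sum_b v 0 b * Z k b = 0.
      have /matrixP/(_ 0 k) := vZ; rewrite !mxE => e; rewrite -[RHS]e.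
      by apply: eq_bigr => b _; rewrite !mxE.
    by rewrite mulr0.
  have := hQ (fun k => v 0 k) => /[swap] ->.
  have d0 := dotp_ge0 (fun k => v 0 k : Calg R).
  rewrite pmulr_rle0 ?ltcR // => d1.
  have {d0 d1} d0 : dotp (fun k => v 0 k : Calg R) (fun k => v 0 k) = 0.
    by apply/le_anti/andP.
  move/negP: vn; apply; apply/eqP/rowP => k; rewrite mxE.
  apply: (@nrm_le0 R (Calg R)); apply: le_trans (nrm_coord (fun k => v 0 k : Calg R) k) _.
  by rewrite /hnrm d0 nrm0 sqrtr0.
exists (invmx Z), Z; split; first exact: mulVmx.
move=> a b.
transitivity (\sum_k ((Z *m invmx Z) k a)^*%C * (Z *m invmx Z) k b).
  under [RHS]eq_bigr => k _ do rewrite !mxE rmorph_sum mulr_suml.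
  rewrite [RHS]exchange_big; apply: eq_bigr => r _.
  under [RHS]eq_bigr => k _ do rewrite mulr_sumr.
  rewrite [RHS]exchange_big; apply: eq_bigr => t _.
  rewrite QE mulr_sumr mulr_suml; apply: eq_bigr => k _.
  by rewrite rmorphM /=; ring.
rewrite mulmxV //; under eq_bigr => k _ do rewrite !mxE.
rewrite (bigD1 a) //= eqxx conjc1 mul1r big1 ?addr0 // => k /negbTE ->.
by rewrite conjc0 mul0r.
Qed.

Lemma qform_compress (V : Type) n k (g : 'I_n -> 'I_n -> V -> R[i])
    (L : 'M[R[i]]_n) (X : 'M[V]_k) v :
  qform (stform (fun p q s => \sum_r \sum_t (L r p)^*%C * g r t s * L t q) X) v =
  qform (stform g X) (fun s => \sum_p L s.2 p * (v (s.1, p) : R[i])).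
Proof.
rewrite !qformE !sum_pair; apply: eq_bigr => a _.
under eq_bigr => p _ do rewrite sum_pair.
under [RHS]eq_bigr => r _ do rewrite sum_pair.
rewrite exchange_big [RHS]exchange_big; apply: eq_bigr => b _.
rewrite /stform /=.
transitivity (\sum_p \sum_q \sum_r \sum_t
  ((v (a, p) : R[i])^*)%C * ((L r p)^*%C * g r t (X a b) * L t q * (v (b, q) : R[i]))).
  apply: eq_bigr => p _; apply: eq_bigr => q _.
  rewrite mulr_suml mulr_sumr; apply: eq_bigr => r _.
  by rewrite mulr_suml mulr_sumr.
transitivity (\sum_r \sum_t \sum_p \sum_q
  ((v (a, p) : R[i])^*)%C * ((L r p)^*%C * g r t (X a b) * L t q * (v (b, q) : R[i]))).
  under eq_bigr => p _ do rewrite exchange_big.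
  rewrite exchange_big; apply: eq_bigr => r _.
  under eq_bigr => p _ do rewrite exchange_big.
  by rewrite exchange_big.
apply: eq_bigr => r _; apply: eq_bigr => t _.
rewrite rmorph_sum mulr_suml; apply: eq_bigr => p _.
rewrite mulr_sumr mulr_sumr; apply: eq_bigr => q _.
by rewrite rmorphM /=; ring.
Qed.

Lemma perturb (z w : R[i]) : ~ (0 <= z) -> exists2 e : R, 0 < e & ~ (0 <= z + e%:C * w).
Proof.
move=> nz; apply: contrapT => h; apply: nz.
have hp e : 0 < e -> 0 <= z + e%:C * w.
  by move=> e0; apply: contrapT => ne; apply: h; exists e.
have h1 := hp 1 ltr01; have h2 := hp 2 (ltr0Sn R 1).
case: z w hp h1 h2 {h} => a b [c d] hp; rewrite !lecE /=.
move=> /andP[/eqP h1 _] /andP[/eqP h2 _]; apply/andP; split; first by apply/eqP; lra.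
rewrite leNgt; apply/negP => a0.
(* With this e the perturbation adds at most |a| / 2 to the negative real part a. *)
have e0 : 0 < - a / (2 * (`|c| + 1)).
  by rewrite divr_gt0 ?oppr_gt0 // mulr_gt0 // ltr_wpDl.
have := hp _ e0; rewrite lecE /= => /andP[_].
have c1 : 0 < `|c| + 1 by rewrite ltr_wpDl.
have : - a / (2 * (`|c| + 1)) * c <= - a / 2.
  rewrite invfM mulrA -mulrA ler_piMr //; first by lra.
  by rewrite mulrC ler_pdivrMr // mul1r; have := ler_norm c; lra.
by lra.
Qed.

(** A positive functional that detects X gives a completely positive map into M_k which need not be
    unital. Its value Q at the unit is made invertible by a trace perturbation small enough to keep
    the detection. Compression by L makes the map unital, and the vector built from M undoes the
    compression in the form at X. *)
Lemma state_separation k (X : 'M[S]_k) : ~ mx_pos X ->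
  exists (f : state S k) v, ~ (0 <= qform (stform f X) v).
Proof.
move=> nX; pose x := flatS X.
have nx : ~ cpos x by move=> /mx_posP.
have A1 : (1 : ambient S) <> 0.
  move=> e; apply: nx; have -> : x = 0; last exact: cpos0.
  apply: falg_eq => i a b.
  by rewrite -[LHS]mul1r e mul0r -[RHS]mul1r e mul0r.
have [F [Fp Fx]] := nonpos_functional nx.
have [w [wp w1]] := state_pos_functional A1.
have [T [Tp T1]] := trace_functional k wp.
have [e e0 hG] := perturb (T x) Fx.
pose G y : R[i]^o := (F y : R[i]) + e%:C * (T y : R[i]).
have Glin : linear G.
  move=> d y z.
  have eF : F (d *: y + z) = d * (F y : R[i]) + F z :> R[i] by exact: (linearP F).
  have eT : T (d *: y + z) = d * (T y : R[i]) + T z :> R[i] by exact: (linearP T).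
  rewrite -[RHS]/(d * (G y : R[i]) + (G z : R[i])) /G eF eT; ring.
pose G' := lin_of Glin.
have Gp : pos_functional G'.
  move=> y py; apply: addr_ge0; first exact: Fp.
  by apply: mulr_ge0; [rewrite lecR ltW | exact: Tp].
pose Q p q : Calg R := fcoord G' p q (1 : ambient S).
pose c := e * Re (w 1).
have w1E : w 1 = (Re (w 1))%:C by rewrite RRe_real // realE ltW.
have c0 : 0 < c by rewrite mulr_gt0 // -ltcR -w1E.
have QE p q : (Q p q : R[i]) = fcoord F p q 1 + c%:C * (p == q)%:R.
  rewrite /Q /fcoord /= /G; congr (_ + _).
  by have := T1 p q; rewrite /fcoord => ->; rewrite w1E rmorphM /GRing.scale /=; ring.
have hQ (v : 'I_k -> Calg R) : c%:C * (dotp v v : R[i]) <= qform Q v.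
  have := @fcoord_pos R _ k F 1 (const_mx 1) (fun s => v s.2) Fp.
  have -> : flat (const_mx 1 : 'M[ambient S]_1) = 1.
    by rewrite -flat1; congr flat; apply/matrixP => a b; rewrite !mxE !ord1.
  have p1 := cpos_scalar (matAlg (ambient S) 1) ler01.
  rewrite rmorph1 scale1r in p1; move=> /(_ p1).
  rewrite -[c%:C * _ <= _]subr_ge0; congr (is_true (0 <= _)).
  rewrite !qformE sum_pair big_ord1 /dotp mulr_sumr -sumrB; apply: eq_bigr => p _.
  rewrite sum_pair big_ord1 /stform /= mxE.
  under [X in X - _]eq_bigr => q _ do rewrite QE mulrDl mulrDr.
  rewrite big_split /= [X in _ + X - _](bigD1 p) //= eqxx.
  rewrite [X in _ + (_ + X) - _]big1 => [|q]; last first.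
    by rewrite eq_sym => /negbTE ->; rewrite mulr0 mul0r mulr0.
  rewrite mulr1 addr0 CalgM Calg_star; move: (\sum_i _) => s; ring.
have [L [M [LM LQ]]] := gram_inverse c0 hQ.
pose f p q (s : S) : R[i] :=
  \sum_r \sum_t (L r p)^*%C * fcoord G' r t (val s) * L t q.
have flin p q (d : R[i]) y z : f p q (d *: y + z) = d * f p q y + f p q z.
  rewrite /f mulr_sumr -big_split; apply: eq_bigr => r _.
  rewrite mulr_sumr -big_split; apply: eq_bigr => t _.
  have -> : val (d *: y + z) = d *: val y + val z by [].
  by rewrite fcoord_lin /=; ring.
have formE n (Y : 'M[S]_n) v : qform (stform f Y) v =
    qform (stform (fcoord G') (map_mx val Y)) (fun s => \sum_p L s.2 p * (v (s.1, p) : R[i])).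
  rewrite -qform_compress; congr (qform _ _).
  by apply/funext => s; apply/funext => t; rewrite /stform mxE.
have fpos n (Y : 'M[S]_n) v : mx_pos Y -> 0 <= qform (stform f Y) v.
  by move=> /mx_posP pY; rewrite formE; exact: fcoord_pos.
exists (State flin LQ fpos), (fun s => M s.2 s.1).
rewrite formE.
have -> : (fun s : 'I_k * 'I_k => \sum_p L s.2 p * M p s.1) =
    (fun s => if s.1 == s.2 then 1 else 0).
  apply/funext => -[a r] /=; have /matrixP/(_ r a) := LM.
  by rewrite !mxE => ->; rewrite eq_sym; case: eqP.
by rewrite qform_delta -fcoord_sum.
Qed.

End StateSeparation.

(** * Norm bounds from the order *)

Section OrderNorm.
Variables (R : realType).

Lemma cposM_comm (E : cstarAlgType R) (p q : E) : cpos p -> cpos q -> p * q = q * p ->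
  cpos (p * q).
Proof.
move=> pp pq pqC; have [z [sz zz _ zc]] := cpos_sqrt pp.
have zq : q * z = z * q by apply: zc.
rewrite -zz -mulrA -zq mulrA -{1}sz; exact: cpos_conj.
Qed.

(** The factors t - y and t + y commute, so their product t^2 - y^2 is positive and |y|^2 = |y^2| <=
    t^2. *)
Lemma nrm_le_pm (E : cstarAlgType R) (y : E) (t : R) : 0 <= t -> star y = y ->
  cpos (t%:C *: (1 : E) - y) -> cpos (t%:C *: (1 : E) + y) -> nrm y <= t.
Proof.
move=> t0 sy h1 h2.
have e : (t%:C *: (1 : E) - y) * (t%:C *: (1 : E) + y) = (t * t)%:C *: (1 : E) - y * y.
  rewrite mulrBl !mulrDr !mul_sc !mulr_sc scalerA -rmorphM; lmod R.
have e' : (t%:C *: (1 : E) + y) * (t%:C *: (1 : E) - y) = (t * t)%:C *: (1 : E) - y * y.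
  rewrite mulrDl !mulrBr !mul_sc !mulr_sc scalerA -rmorphM; lmod R.
have := cposM_comm h1 h2; rewrite e e' => /(_ erefl) h.
rewrite -(@ler_pXn2r _ 2) ?nnegrE ?nrm_ge0 // -nrm_sa // expr2.
by apply: nrm_le_scalar h; [rewrite mulr_ge0 | exact: cpos_sqr].
Qed.

Lemma ucp_nrm_sa (S T : opSystem R) (f : {linear S -> T}) x : ucp f ->
  star (val x) = val x -> nrm (val (f x)) <= nrm (val x).
Proof.
move=> uf sx; set t := nrm (val x).
have h1 : cpos (val (t%:C *: os_one S - x)) by exact: cpos_subl.
have h2 : cpos (val (t%:C *: os_one S + x)).
  have -> : val (t%:C *: os_one S + x) = t%:C *: (1 : ambient S) - (- val x) by rewrite opprK.
  by apply: cpos_subl; rewrite ?nrmN // starN sx.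
apply: nrm_le_pm; first exact: nrm_ge0.
- exact: ucp_sa.
- have := ucp_pos1 uf h1.
  have -> // : f (t%:C *: os_one S - x) = t%:C *: os_one T - f x.
  by rewrite linearB linearZ ucp_one.
- have := ucp_pos1 uf h2.
  have -> // : f (t%:C *: os_one S + x) = t%:C *: os_one T + f x.
  by rewrite linearD linearZ ucp_one.
Qed.

End OrderNorm.

(** * Products of matrix algebras as operator systems *)

Section FullSystems.
Variables (R : realType).

Definition fullsys (A : cstarAlgType R) : opSystem R.
Proof.
by refine (@OpSystem R A predT _ _ _ _).
Defined.

Definition fin (A : cstarAlgType R) (x : A) : fullsys A := exist _ x isT.

Lemma os_valP (S : opSystem R) (c : R[i]) (x y : S) :
  val (c *: x + y) = c *: val x + val y.
Proof. by []. Qed.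

Definition st_pull (S T : opSystem R) (f : {linear S -> T}) (uf : ucp f) n
  (s : state T n) : state S n.
Proof.
refine (@State R S n (fun p q x => s p q (f x)) _ _ _).
- by move=> p q c x y; rewrite linearP st_lin.
- by move=> p q; rewrite ucp_one // st_one.
- move=> k X v pX; have [_ /(_ _ _ pX) pfX] := uf.
  have := st_pos s v pfX; congr (is_true (0 <= qform _ _)).
  by apply/funext => a; apply/funext => b; rewrite /stform mxE.
Defined.

(** On self-adjoint elements the order bounds a state by the norm; the factor 2 comes from x = h + i
    k. The bound depends on neither the state nor its order, so arbitrary families of states take
    values in the bounded families. *)
Lemma state_bnd (S : opSystem R) n (s : state S n) (x : S) :
  opbnd (fun p q => s p q x : Calg R) (nrm (val x) * 2).
Proof.
have sadd p q y z : s p q (y + z) = s p q y + s p q z.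
  by have := st_lin s p q 1 y z; rewrite scale1r mul1r.
have sZ p q (c : R[i]) y : s p q (c *: y) = c * s p q y.
  by have := st_lin s p q c y 0; rewrite addr0 st0 addr0.
have sN p q y : s p q (- y) = - s p q y by rewrite -scaleN1r sZ mulN1r.
pose y h : matAlg (Calg R) n := flat (\matrix_(p, q) (s p q h : Calg R)).
have yP h : cpos (val h) -> cpos (y h).
  move=> ph; apply/(rep_pos (rho := fun (z : matAlg (Calg R) n) i => ent z i)) => [//|//|z i a b|z w e|i v].
  - exact: entN.
  - exact: falg_eq.
  - have /mx_pos1 ph1 := ph.
    have := st_pos s (fun t => v t.2) ph1; congr (is_true (0 <= _)).
    rewrite !qformE sum_pair big_ord1; apply: eq_bigr => p _.
    rewrite sum_pair big_ord1; apply: eq_bigr => q _.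
    by rewrite /stform /= mxE ent_flat mxE.
have y1 (t : R) : y (t%:C *: os_one S) = t%:C *: (1 : matAlg (Calg R) n).
  apply: falg_eq => i a b; rewrite entZ ent1 ent_flat mxE sZ st_one /opone.
  by rewrite /GRing.scale /=; case: eqP.
have yD h k : y (h + k) = y h + y k.
  by apply: falg_eq => i a b; rewrite entD !ent_flat !mxE sadd.
have yN h : y (- h) = - y h.
  by apply: falg_eq => i a b; rewrite entN !ent_flat !mxE sN.
have ysa h : star (val h) = val h -> nrm (y h) <= nrm (val h).
  move=> sh; set t := nrm (val h).
  have h1 : cpos (val (t%:C *: os_one S - h)) by exact: cpos_subl.
  have h2 : cpos (val (t%:C *: os_one S + h)).
    have -> : val (t%:C *: os_one S + h) = t%:C *: (1 : ambient S) - (- val h) by rewrite opprK.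
    by apply: cpos_subl; rewrite ?nrmN // starN sh.
  have {h1} := yP _ h1; rewrite yD yN y1 => h1.
  have {h2} := yP _ h2; rewrite yD y1 => h2.
  apply: nrm_le_pm; [exact: nrm_ge0 | | exact: h1 | exact: h2].
  by have := cpos_sa h2; rewrite starD star_sc => /(@addrI _ _ _ _).
have [h [k [sh sk ex ea]]] := os_adj_decomp x.
have hk : nrm (val h) <= nrm (val x) /\ nrm (val k) <= nrm (val x).
  have sx : nrm (val (os_adj x)) = nrm (val x) by exact: nrm_star.
  have v1 : val x = val h + 'i *: val k by rewrite {1}ex.
  have v2 : val (os_adj x) = val h - 'i *: val k by rewrite ea.
  have e1 : (2%:R : R)%:C *: val h = val x + val (os_adj x).
    by rewrite v1 v2 rmorph_nat scaler_nat mulr2n; lmod R.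
  have e2 : (2%:R : R)%:C *: ('i *: val k) = val x - val (os_adj x).
    by rewrite v1 v2 rmorph_nat scaler_nat mulr2n; lmod R.
  have := nrmD (val x) (val (os_adj x)); have := nrmB (val x) (val (os_adj x)).
  rewrite -e1 -e2 !nrmZr nrmZi sx ger0_norm //; lra.
have [hx kx] := hk.
have bh z : star (val z) = val z -> nrm (val z) <= nrm (val x) ->
    opbnd (fun p q => s p q z : Calg R) (nrm (val x)).
  move=> sz zx v; have := @falg_bnd _ _ _ _ (y z) tt v.
  have -> : ent (y z) tt = fun p q => s p q z.
    by apply/funext => p; apply/funext => q; rewrite ent_flat mxE.
  move/le_trans; apply; rewrite ler_wpM2r ?hnrm_ge0 //.
  by apply: le_trans zx; exact: ysa.
have b2 := opbndD (bh h sh hx) (opbndZ 'i (bh k sk kx)).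
move: b2; have -> : Normc.normc 'i = 1 :> R by rewrite /= expr0n add0r expr1n sqrtr1.
rewrite mul1r -mulr2n -[nrm (val x) *+ 2]mulr_natr; congr (opbnd _ _).
apply/funext => p; apply/funext => q; rewrite [in RHS]ex sadd sZ.
by [].
Qed.

Lemma entCP (I : Type) (J : I -> finType) (c : R[i]) (X Y : falg (Calg R) J) i a b :
  ent (c *: X + Y) i a b = c * (ent X i a b : R[i]) + (ent Y i a b : R[i]).
Proof. by rewrite entP CalgD CalgZ. Qed.

Lemma ent_one (I : Type) (J : I -> finType) i a b :
  ent (val (os_one (fullsys (falg (Calg R) J)))) i a b = (a == b)%:R :> R[i].
Proof.
rewrite [LHS](congr1 (fun f => f a b) (ent1 (Calg R) J i)) /opone.
by case: eqP.
Qed.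

Section Components.
Variables (I : Type) (n : I -> nat).
Local Notation J := (fun i => 'I_(n i) : finType).
Local Notation W := (fullsys (falg (Calg R) J)).

Lemma full_eq (x y : W) :
  (forall i a b, ent (val x) i a b = ent (val y) i a b) -> x = y.
Proof. by move=> h; apply: val_inj; apply: falg_eq. Qed.

Lemma full_posP k (X : 'M[W]_k) : mx_pos X <->
  forall i v, 0 <= qform (stform (fun p q (w : W) => ent (val w) i p q) X) v.
Proof.
have e i : mxform (map_mx val X) i = stform (fun p q (w : W) => ent (val w) i p q) X.
  by apply/funext => s; apply/funext => t; rewrite /mxform /stform mxE.
split=> [/mx_posP /flat_forms h i v|h]; first by rewrite -e; exact: h.
by apply/mx_posP/flat_forms => i v; rewrite e; exact: h.
Qed.

Definition compstate (i : I) : state W (n i).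
Proof.
refine (@State R W (n i) (fun p q (w : W) => ent (val w) i p q) _ _ _).
- move=> p q c x y; rewrite [X in ent X](os_valP c x y); exact: entCP.
- by move=> p q; exact: ent_one.
- by move=> k X v /full_posP; exact.
Defined.

Variables (S : opSystem R) (f : forall i, state S (n i)).

Lemma famState_bounded (x : S) :
  bounded_opfam (J := J) (fun i p q => f i p q x : Calg R).
Proof.
exists (nrm (val x) * 2); first by rewrite mulr_ge0 ?nrm_ge0.
by move=> i; exact: state_bnd.
Qed.

Definition famState_fun (x : S) : W := fin (A := falg (Calg R) J) (bfam_of _ (famState_bounded x)).

Lemma famState_linear : linear famState_fun.
Proof.
move=> c x y; apply: full_eq => i a b.
exact: (st_lin (f i) a b c x y).
Qed.

Definition famState : {linear S -> W} := lin_of famState_linear.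

Lemma famState_ucp : ucp famState.
Proof.
split.
  apply: full_eq => i a b.
  have e1 := st_one (f i) a b; have e2 := @ent_one I J i a b.
  exact: (@etrans R[i] _ _ _ e1 (esym e2)).
move=> k X pX; apply/full_posP => i v.
have := st_pos (f i) v pX; congr (is_true (0 <= qform _ _)).
by apply/funext => s; apply/funext => t; rewrite /stform mxE.
Qed.

End Components.

(** If f vanishes at a self-adjoint z, both z and - z are positive by reflection, so z = 0. The
    general case follows from x = h + i k, as f commutes with the involution. *)
Lemma order_reflecting_inj (S T : opSystem R) (f : {linear S -> T}) : ucp f ->
  (forall n (X : 'M[S]_n), mx_pos (map_mx f X) -> mx_pos X) ->
  complete_order_injection f.
Proof.
move=> uf fr; split => //.
have sa0 h : star (val h) = val h -> f h = 0 -> h = 0.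
  move=> sh fh.
  have pos z : f z = 0 -> cpos (val z).
    move=> fz; apply/mx_pos1/fr; have -> : map_mx f (const_mx z) = (const_mx 0 : 'M[T]_1).
      by apply/matrixP => a b; rewrite !mxE.
    by apply/mx_pos1; exact: cpos0.
  apply: val_inj; apply: cpos_anti; first exact: pos.
  by apply: (pos (- h)); rewrite linearN fh oppr0.
have f0 x : f x = 0 -> x = 0.
  move=> fx; have fa : f (os_adj x) = 0.
    by rewrite ucp_star // fx; apply: val_inj; exact: star0.
  have [h [k [sh sk ex ea]]] := os_adj_decomp x.
  have fh : f h = 0.
    have -> : h = (2^-1)%:C *: (x + os_adj x) by rewrite ea ex; lmod R.
    by rewrite linearZ_LR linearD fx fa addr0 scaler0.
  have fk : f k = 0.
    have -> : k = ((2^-1)%:C * - 'i) *: (x - os_adj x).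
      rewrite ea ex; have -> : h + 'i *: k - (h - 'i *: k) = 'i *: k + 'i *: k by lmod R.
      rewrite scalerDr !scalerA -mulrA mulNr -expr2 sqr_i opprK mulr1 -scalerDl -rmorphD.
      have -> : (2^-1 + 2^-1 : R) = 1 by field.
      by rewrite rmorph1 scale1r.
    by rewrite linearZ_LR linearB fx fa subrr scaler0.
  by rewrite ex (sa0 _ sh fh) (sa0 _ sk fk) scaler0 addr0.
by move=> x y e; apply/eqP; rewrite -subr_eq0; apply/eqP/f0; rewrite linearB e subrr.
Qed.

End FullSystems.

(** * The cofree system *)

Section GroupoidLaws.
Variable G : groupoid.
Implicit Types g h k : G.

Lemma dom_inv g : dom (ginv g) = rng g.
Proof. by apply: unit_space_inj; rewrite /= /gd ginvK. Qed.

Lemma rng_inv g : rng (ginv g) = dom g.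
Proof. by apply: unit_space_inj; rewrite /= /gr ginvK. Qed.

Lemma gd_rng g h : dom g = rng h -> gd g = gr h.
Proof. by move=> /(congr1 sval). Qed.

Lemma gmul_invK g k : rng k = rng g -> gmul g (gmul (ginv g) k) = k.
Proof.
by move=> e; rewrite -{1}(ginvK g) gmulKV //; apply: gd_rng; rewrite dom_inv e.
Qed.

Lemma gmul_Kinv g k : dom g = rng k -> gmul (ginv g) (gmul g k) = k.
Proof. by move=> /gd_rng; exact: gmulKV. Qed.

Lemma rng_Vmul g k : rng k = rng g -> rng (gmul (ginv g) k) = dom g.
Proof. by move=> e; rewrite rng_mul ?rng_inv // dom_inv e. Qed.

Lemma dom_Vmul g k : rng k = rng g -> dom (gmul (ginv g) k) = dom k.
Proof. by move=> e; rewrite dom_mul // dom_inv e. Qed.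

Lemma gmulVA g h k : dom g = rng h -> rng k = rng g ->
  gmul (ginv (gmul g h)) k = gmul (ginv h) (gmul (ginv g) k).
Proof.
move=> e1 e2; set m := RHS.
have rm : rng (gmul (ginv g) k) = rng h by rewrite rng_Vmul.
have hm : gmul h m = gmul (ginv g) k by exact: gmul_invK.
have dm : dom h = rng m by rewrite rng_Vmul.
have <- : gmul (gmul g h) m = k.
  by rewrite gmulA ?hm ?gmul_invK //; exact: gd_rng.
by rewrite gmul_Kinv // dom_mul.
Qed.

Lemma rng_gr g : rng (gr g) = rng g.
Proof. by rewrite rng_mul // rng_inv. Qed.

Lemma dom_gr g : dom (gr g) = rng g.
Proof. by rewrite dom_mul ?dom_inv // rng_inv. Qed.

Lemma gd_inv g : gd g = gr (ginv g).
Proof. by rewrite /gr ginvK. Qed.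

Lemma gmul_dom g : gmul g (gd g) = g.
Proof.
have h1 : gd g = gr (ginv g) by apply: gd_rng; rewrite rng_inv.
have h2 : gd (ginv g) = gr g by apply: gd_rng; rewrite dom_inv.
by rewrite -[gd g]/(gmul (ginv g) g) -gmulA //; have := gmulVK h1; rewrite ginvK.
Qed.

Lemma rng_unit (u : unit_space G) : rng (sval u) = u.
Proof. by case: u => u [g ug] /=; apply: unit_space_inj; rewrite /= ug; exact: (congr1 sval (rng_gr g)). Qed.

Lemma dom_unit (u : unit_space G) : dom (sval u) = u.
Proof. by case: u => u [g ug] /=; apply: unit_space_inj; rewrite /= ug; exact: (congr1 sval (dom_gr g)). Qed.

Lemma gmul_unit g (u : unit_space G) : dom g = u -> gmul g (sval u) = g.
Proof. by move=> <-; exact: gmul_dom. Qed.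

Lemma ginv_mul g h : dom g = rng h -> ginv (gmul g h) = gmul (ginv h) (ginv g).
Proof.
move=> e; have r1 : rng (gr g) = rng g := rng_gr g.
have := gmulVA e r1.
have -> : gr g = gd (ginv g) by rewrite gd_inv ginvK.
rewrite gmul_dom => <-; rewrite -[LHS]gmul_dom; congr gmul.
rewrite !gd_inv !ginvK; have := rng_mul e; by move/(congr1 sval).
Qed.

Lemma unit_idem (u : unit_space G) : gmul (sval u) (sval u) = sval u.
Proof. by apply: gmul_unit; exact: dom_unit. Qed.

Lemma ginv_unit (u : unit_space G) : ginv (sval u) = sval u.
Proof.
have := @gmul_Kinv (sval u) (sval u); rewrite dom_unit rng_unit => /(_ erefl).
by rewrite unit_idem gmul_unit // dom_inv rng_unit.
Qed.

End GroupoidLaws.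

Section CastedAction.
Variables (R : realType) (G : groupoid).
Implicit Types (B C : gsystem R G) (u v w : unit_space G) (g h : G).

(** The action with its endpoints named separately, so that equations between composites are stated
    without transport along equalities of units. *)
Definition actc B g u v (e1 : dom g = u) (e2 : rng g = v) : {linear B u -> B v} :=
  eq_rect (rng g) (fun v => {linear B u -> B v})
    (eq_rect (dom g) (fun u => {linear B u -> B (rng g)}) (act B g) u e1) v e2.

Lemma actc_iso B g u v (e1 : dom g = u) (e2 : rng g = v) :
  complete_order_iso (actc B e1 e2).
Proof. by destruct e1, e2; exact: act_iso. Qed.

Lemma actc_ucp B g u v (e1 : dom g = u) (e2 : rng g = v) : ucp (actc B e1 e2).
Proof. by have [] := actc_iso B e1 e2. Qed.

Lemma actc_inj B g u v (e1 : dom g = u) (e2 : rng g = v) : injective (actc B e1 e2).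
Proof. by have [_ [f [_ fK _]]] := actc_iso B e1 e2; exact: can_inj fK. Qed.

Lemma actc_eq B g g' u v (e1 : dom g = u) (e2 : rng g = v) (e1' : dom g' = u)
  (e2' : rng g' = v) x : g = g' -> actc B e1 e2 x = actc B e1' e2' x.
Proof.
move=> e; subst g'.
by rewrite (Prop_irrelevance e1' e1) (Prop_irrelevance e2' e2).
Qed.

Lemma gmor_actc B C (Phi : gmorphism B C) g u v (e1 : dom g = u) (e2 : rng g = v) x :
  actc C e1 e2 (Phi u x) = Phi v (actc B e1 e2 x).
Proof. by destruct e1, e2; exact: gmor_equiv. Qed.

Lemma fib_castK B u v (e : u = v) (e' : v = u) (x : B v) :
  fib_cast e (fib_cast e' x) = x.
Proof. by destruct e; rewrite (Prop_irrelevance e' erefl). Qed.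

Lemma actcE B g u v (e1 : dom g = u) (e2 : rng g = v) x :
  actc B e1 e2 x = fib_cast e2 (act B g (fib_cast (esym e1) x)).
Proof. by destruct e1, e2. Qed.

Lemma fib_cast_irr B u v (e e' : u = v) (x : B u) : fib_cast e x = fib_cast e' x.
Proof. by rewrite (Prop_irrelevance e e'). Qed.

Lemma actc_mul B g h u v w (e1 : dom h = u) (e2 : rng h = v) (e3 : dom g = v)
  (e4 : rng g = w) (e5 : dom (gmul g h) = u) (e6 : rng (gmul g h) = w) x :
  actc B e5 e6 x = actc B e3 e4 (actc B e1 e2 x).
Proof.
have e : dom g = rng h by rewrite e2 e3.
destruct e1, e4.
have := act_mul e (fib_cast (esym e5) x).
rewrite (fib_cast_irr (dom_mul e) e5) fib_castK => h1.
rewrite actcE (fib_cast_irr e6 (rng_mul e)) h1 !actcE /=.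
destruct e2 => /=; by rewrite (fib_cast_irr (esym e3) (esym e)).
Qed.

(** The action of a unit is idempotent and injective. *)
Lemma actc_unit B u v (e1 : dom (sval u) = v) (e2 : rng (sval u) = v) x :
  actc B e1 e2 x = x.
Proof.
apply: (@actc_inj B _ _ _ e1 e2).
have e5 : dom (gmul (sval u) (sval u)) = v by rewrite unit_idem.
have e6 : rng (gmul (sval u) (sval u)) = v by rewrite unit_idem.
rewrite -(actc_mul e1 e2 e1 e2 e5 e6).
by apply: actc_eq; exact: unit_idem.
Qed.

End CastedAction.

Section CofreeSystem.
Variables (R : realType) (G : groupoid) (A : gsystem R G).
Implicit Types (u v : unit_space G) (g h k : G).

Definition jdx : Type := {v : unit_space G & {n : nat & state (A v) n}}.
Definition jdim (j : jdx) : nat := tag (tagged j).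

(** The endpoints of the arrow are recorded as equations, so that translating the arrow leaves the
    state in [ix_j] in place without a cast. *)
Record idx u : Type := Idx {
  ix_g : G;
  ix_j : jdx;
  ix_r : rng ix_g = u;
  ix_d : dom ix_g = tag ix_j
}.
Definition ix_n u (i : idx u) : nat := jdim (ix_j i).

(* The fibre over u is the product of the matrix algebras M_n over all pairs of
   an arrow k with range u and a state of order n on the fibre over d(k). *)
Definition wfib u : opSystem R :=
  fullsys (falg (Calg R) (fun i : idx u => 'I_(ix_n i) : finType)).

Definition wcoord u (w : wfib u) k j (r : rng k = u) (d : dom k = tag j)
  (p q : 'I_(jdim j)) : R[i] := ent (val w) (Idx r d) p q.

Lemma wcoord_eq u (w : wfib u) k k' j (r : rng k = u) (d : dom k = tag j)
  (r' : rng k' = u) (d' : dom k' = tag j) (p q : 'I_(jdim j)) : k = k' ->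
  wcoord w r d p q = wcoord w r' d' p q.
Proof.
move=> e; subst k'.
by rewrite (Prop_irrelevance r' r) (Prop_irrelevance d' d).
Qed.

Lemma wfib_eq u (w w' : wfib u) :
  (forall k j (r : rng k = u) (d : dom k = tag j) (p q : 'I_(jdim j)),
     wcoord w r d p q = wcoord w' r d p q) -> w = w'.
Proof. by move=> h; apply: full_eq => -[k j r d] p q; exact: h. Qed.

Definition wstate u k j (r : rng k = u) (d : dom k = tag j) : state (wfib u) (jdim j) :=
  @compstate R (idx u) (fun i => ix_n i) (Idx r d).

Lemma wstateE u k j (r : rng k = u) (d : dom k = tag j) p q w :
  wstate r d p q w = wcoord w r d p q.
Proof. by []. Qed.

Definition wmap u (S : opSystem R)
  (f : forall k j, rng k = u -> dom k = tag j -> state S (jdim j)) : {linear S -> wfib u} :=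
  famState (fun i : idx u => f _ _ (ix_r i) (ix_d i)).

Lemma wmapE u (S : opSystem R)
  (f : forall k j, rng k = u -> dom k = tag j -> state S (jdim j))
  (x : S) k j (r : rng k = u) (d : dom k = tag j) p q :
  wcoord (wmap f x) r d p q = f k j r d p q x.
Proof. by []. Qed.

Lemma wmap_ucp u (S : opSystem R)
  (f : forall k j, rng k = u -> dom k = tag j -> state S (jdim j)) :
  ucp (wmap f).
Proof. exact: famState_ucp. Qed.

(** The coordinate of g w at k is that of w at g^-1 k. *)
Definition wact g : {linear wfib (dom g) -> wfib (rng g)} :=
  wmap (fun k j (r : rng k = rng g) (d : dom k = tag j) =>
    wstate (rng_Vmul r) (etrans (dom_Vmul r) d)).

Lemma rng_mulV g k : rng k = dom g -> rng (gmul g k) = rng g.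
Proof. by move=> e; rewrite rng_mul. Qed.

Lemma dom_mulV g k : rng k = dom g -> dom (gmul g k) = dom k.
Proof. by move=> e; rewrite dom_mul. Qed.

Definition wact_inv g : {linear wfib (rng g) -> wfib (dom g)} :=
  wmap (fun k j (r : rng k = dom g) (d : dom k = tag j) =>
    wstate (rng_mulV r) (etrans (dom_mulV r) d)).

Lemma wact_iso g : complete_order_iso (wact g).
Proof.
split; first exact: wmap_ucp.
exists (wact_inv g); split; first exact: wmap_ucp.
  move=> w; apply: wfib_eq => k j r d p q.
  rewrite wmapE wstateE wmapE wstateE; apply: wcoord_eq.
  by rewrite gmul_Kinv.
move=> w; apply: wfib_eq => k j r d p q.
rewrite wmapE wstateE wmapE wstateE; apply: wcoord_eq.
by rewrite gmul_invK.
Qed.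

Lemma wcoord_cast u v (e : u = v) (w : wfib u) k j (r : rng k = v) (d : dom k = tag j) p q :
  wcoord (eq_rect u (fun t => wfib u -> wfib t) id v e w) r d p q =
  wcoord w (etrans r (esym e)) d p q.
Proof. by destruct e; apply: wcoord_eq. Qed.

Lemma wact_mul g h (e : dom g = rng h) (x : wfib (dom (gmul g h))) :
  fib_cast (rng_mul e) (wact (gmul g h) x) =
  wact g (fib_cast (esym e) (wact h (fib_cast (dom_mul e) x))).
Proof.
apply: wfib_eq => k j r d p q.
rewrite [LHS]wcoord_cast wmapE wstateE [RHS]wmapE wstateE [RHS]wcoord_cast.
rewrite wmapE wstateE [RHS]wcoord_cast; apply: wcoord_eq.
by apply: gmulVA.
Qed.

Definition wsys : gsystem R G := GSystem wact_iso wact_mul.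

Lemma wsys_actc g u v (e1 : dom g = u) (e2 : rng g = v) (w : wsys u) k j
    (r : rng k = v) (d : dom k = tag j) p q
    (r' : rng (gmul (ginv g) k) = u) (d' : dom (gmul (ginv g) k) = tag j) :
  wcoord (actc wsys e1 e2 w) r d p q = wcoord w r' d' p q.
Proof.
destruct e1, e2; rewrite [LHS]wmapE wstateE; exact: wcoord_eq.
Qed.

Section Induced.
Variables (B : gsystem R G) (ext : forall j : jdx, state (B (tag j)) (jdim j)).

Lemma dom_invr k u : rng k = u -> dom (ginv k) = u.
Proof. by rewrite dom_inv. Qed.

Lemma rng_invd k v : dom k = v -> rng (ginv k) = v.
Proof. by rewrite rng_inv. Qed.

(** The coordinate at k tests k^-1 x by the state chosen on the fibre over d(k); equivariance is the
    identity (g^-1 k)^-1 x = k^-1 (g x). *)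
Definition ind_map u : {linear B u -> wsys u} :=
  wmap (fun k j (r : rng k = u) (d : dom k = tag j) =>
    st_pull (actc_ucp B (dom_invr r) (rng_invd d)) (ext j)).

Lemma ind_mapE u x k j (r : rng k = u) (d : dom k = tag j) p q :
  wcoord (ind_map u x) r d p q = ext j p q (actc B (dom_invr r) (rng_invd d) x).
Proof. by []. Qed.

Lemma ind_equiv g (x : B (dom g)) :
  act wsys g (ind_map (dom g) x) = ind_map (rng g) (act B g x).
Proof.
apply: wfib_eq => k j r d p q; rewrite [LHS]wmapE wstateE !ind_mapE; congr (ext j _ _ _).
have dk : dom (ginv k) = rng g by rewrite dom_inv.
have e5 : dom (gmul (ginv k) g) = dom g by rewrite dom_mul.
have e6 : rng (gmul (ginv k) g) = tag j by rewrite rng_mul // rng_inv.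
rewrite -[act B g x]/(actc B erefl erefl x).
rewrite -(actc_mul erefl erefl (dom_invr r) (rng_invd d) e5 e6).
apply: actc_eq; rewrite ginv_mul ?ginvK //.
by rewrite dom_inv.
Qed.

Definition induced : gmorphism B wsys :=
  @GMorphism R G B wsys ind_map (fun u => wmap_ucp _) ind_equiv.

End Induced.

Lemma induced_unit (B : gsystem R G)
    (ext : forall j : jdx, state (B (tag j)) (jdim j)) (j : jdx) (x : B (tag j)) p q :
  wcoord (@induced B ext (tag j) x) (rng_unit (tag j)) (dom_unit (tag j)) p q = ext j p q x.
Proof.
rewrite [LHS]ind_mapE; congr (ext j _ _ _).
have e1 : dom (sval (tag j)) = tag j by exact: dom_unit.
have e2 : rng (sval (tag j)) = tag j by exact: rng_unit.
by rewrite (actc_eq _ _ e1 e2) ?actc_unit // ginv_unit.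
Qed.

(* The uniqueness half of cofreeness; [induced_unit] is the existence half. *)
Lemma wsys_morphism_coord (B : gsystem R G) (Psi : gmorphism B wsys) u x k j
    (r : rng k = u) (d : dom k = tag j) p q :
  wcoord (Psi u x) r d p q =
  wcoord (Psi (tag j) (actc B (dom_invr r) (rng_invd d) x))
    (rng_unit (tag j)) (dom_unit (tag j)) p q.
Proof.
rewrite -gmor_actc.
have dk : dom k = rng (sval (tag j)) by rewrite rng_unit.
have e : gmul (ginv (ginv k)) (sval (tag j)) = k by rewrite ginvK gmul_unit.
have r' : rng (gmul (ginv (ginv k)) (sval (tag j))) = u by rewrite e.
have d' : dom (gmul (ginv (ginv k)) (sval (tag j))) = tag j by rewrite e.
by rewrite (wsys_actc _ _ _ _ _ _ _ r' d'); apply: wcoord_eq.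
Qed.

(** Only the coordinates of Psi at units are extended, each on its own by [state_extension]; the
    remaining coordinates, of Psi and of the induced morphism alike, are determined by
    translation. *)
Lemma wsys_injective : g_injective wsys.
Proof.
move=> B C Phi Psi Phi_inj.
have ex (j : jdx) : {e : state (C (tag j)) (jdim j) |
    forall p q x, e p q (Phi (tag j) x) =
      wcoord (Psi (tag j) x) (rng_unit (tag j)) (dom_unit (tag j)) p q}.
  apply: cid.
  exact: (state_extension (st_pull (gmor_ucp Psi (tag j))
    (wstate (rng_unit (tag j)) (dom_unit (tag j)))) (Phi_inj (tag j))).
exists (induced (fun j => sval (ex j))) => u x.
apply: wfib_eq => k j r d p q.
by rewrite [LHS]ind_mapE gmor_actc (svalP (ex j)) [RHS]wsys_morphism_coord.
Qed.

(** The tautological choice: the coordinate with label j at the unit arrow is the state contained in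
    j. *)
Definition wemb : gmorphism A wsys := induced (fun j => tagged (tagged j)).

Lemma wemb_injection : g_injection wemb.
Proof.
move=> u; apply: order_reflecting_inj; first exact: gmor_ucp.
move=> n X pX; apply: contrapT => /state_separation[f [v nf]]; apply: nf.
(* The separating state is itself one of the coordinates, at the unit arrow over u. *)
pose j : jdx := existT _ u (existT _ n f).
have := proj1 (full_posP _) pX (Idx (rng_unit (tag j)) (dom_unit (tag j))) v.
congr (is_true (0 <= qform _ _)).
apply/funext => s; apply/funext => t; rewrite /stform mxE.
exact: (@induced_unit A (fun j => tagged (tagged j)) j).
Qed.

End CofreeSystem.

(** * Minimal morphisms *)

Section UltraLimit.
Variables (R : realType) (T : Type) (U : set_system T).
Hypothesis UU : UltraFilter U.

Let UP : ProperFilter U := ultra_proper.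

(** Compactness of [-c, c] gives a cluster point, and a cluster point of an ultrafilter is a
    limit. *)
Lemma ultra_cvg (f : T -> R) (c : R) : (forall t, `|f t| <= c) ->
  exists l : R, f @ U --> l.
Proof.
move=> fc.
have fF : ProperFilter (f @ U) by exact: fmap_proper_filter.
have [|l [_ cl]] := @segment_compact R (- c) c (f @ U) fF.
  by apply: (@filterE _ U) => t /=; rewrite in_itv /= -ler_norml.
exists l => N Nl; have [//|nN] := in_ultra_setVsetC (f @^-1` N) UU.
by have [y [h1 h2]] := cl (~` N) N nN Nl.
Qed.

Definition ulim (f : T -> R) : R := lim (f @ U).

Lemma ulimP (f : T -> R) (c : R) : (forall t, `|f t| <= c) -> f @ U --> ulim f.
Proof. by move=> /ultra_cvg[l hl]; apply/cvg_ex; exists l. Qed.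

Definition bddc (f : T -> R[i]) := exists c : R, forall t, Normc.normc (f t) <= c.

Definition ulimc (f : T -> R[i]) : R[i] :=
  (ulim (fun t => Re (f t)) +i* ulim (fun t => Im (f t)))%C.

Lemma bddc_cst a : bddc (fun=> a).
Proof. by exists (Normc.normc a). Qed.

Lemma bddcD f g : bddc f -> bddc g -> bddc (fun t => f t + g t).
Proof.
move=> [c hf] [d hg]; exists (c + d) => t.
by apply: le_trans (le_normcD _ _) _; apply: lerD.
Qed.

Lemma bddcM a f : bddc f -> bddc (fun t => a * f t).
Proof.
move=> [c hf]; exists (Normc.normc a * c) => t.
by rewrite Normc.normcM ler_wpM2l // normc_ge0.
Qed.

Lemma ulim_Re f : bddc f -> (fun t => Re (f t)) @ U --> ulim (fun t => Re (f t)).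
Proof. by move=> [c h]; apply: (@ulimP _ c) => t; apply: le_trans (normc_Re _) (h t). Qed.

Lemma ulim_Im f : bddc f -> (fun t => Im (f t)) @ U --> ulim (fun t => Im (f t)).
Proof. by move=> [c h]; apply: (@ulimP _ c) => t; apply: le_trans (normc_Im _) (h t). Qed.

Lemma ulimc_eq f l : (fun t => Re (f t)) @ U --> Re l ->
  (fun t => Im (f t)) @ U --> Im l -> ulimc f = l.
Proof.
by move=> h1 h2; rewrite /ulimc /ulim (cvg_lim _ h1) // (cvg_lim _ h2) //; case: l {h1 h2}.
Qed.

Lemma ulimc_cst a : ulimc (fun=> a) = a.
Proof. by apply: ulimc_eq; exact: cvg_cst. Qed.

Lemma ulimcD f g : bddc f -> bddc g -> ulimc (fun t => f t + g t) = ulimc f + ulimc g.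
Proof.
move=> bf bg; apply: ulimc_eq.
  rewrite (_ : (fun t => Re (f t + g t)) = (fun t => Re (f t) + Re (g t))).
    by rewrite /=; apply: cvgD; exact: ulim_Re.
  by apply/funext => t; case: (f t) (g t) => ? ? [? ?].
rewrite (_ : (fun t => Im (f t + g t)) = (fun t => Im (f t) + Im (g t))).
  by rewrite /=; apply: cvgD; exact: ulim_Im.
by apply/funext => t; case: (f t) (g t) => ? ? [? ?].
Qed.

Lemma ulimcM a f : bddc f -> ulimc (fun t => a * f t) = a * ulimc f.
Proof.
move=> bf; case: a => a b; apply: ulimc_eq.
  rewrite (_ : (fun t => Re _) = (fun t => a * Re (f t) - b * Im (f t))).
    rewrite /=; apply: cvgB; apply: cvgMr; [exact: ulim_Re | exact: ulim_Im].
  by apply/funext => t; case: (f t).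
rewrite (_ : (fun t => Im _) = (fun t => a * Im (f t) + b * Re (f t))).
  rewrite /=; apply: cvgD; apply: cvgMr; [exact: ulim_Im | exact: ulim_Re].
by apply/funext => t; case: (f t).
Qed.

Lemma ulimc_sum (I : finType) (f : I -> T -> R[i]) : (forall i, bddc (f i)) ->
  bddc (fun t => \sum_i f i t) /\
  ulimc (fun t => \sum_i f i t) = \sum_i ulimc (f i).
Proof.
move=> bf; elim: (index_enum I) => [|i s [ih1 ih2]].
  rewrite big_nil (_ : (fun t => _) = fun=> 0); last first.
    by apply/funext => t; rewrite big_nil.
  by split; [exact: bddc_cst | exact: ulimc_cst].
rewrite big_cons (_ : (fun t => _) = fun t => f i t + \sum_(j <- s) f j t); last first.
  by apply/funext => t; rewrite big_cons.
by split; [exact: bddcD | rewrite ulimcD // ih2].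
Qed.

Lemma ulimc_ge0 f : bddc f -> U [set t | 0 <= f t] -> 0 <= ulimc f.
Proof.
move=> bf h; rewrite lecE /=; apply/andP; split.
  apply/eqP; rewrite /ulim; apply: cvg_lim => //.
  by apply: cvg_near_cst; apply: filterS h => t /= ft; rewrite (ger0_Im ft).
apply: limr_ge; first by apply/cvg_ex; eexists; exact: ulim_Re.
apply: filterS h => t /=; rewrite lecE => /andP[_].
by [].
Qed.

Lemma qform_ulim (J : finType) (x : T -> J -> J -> Calg R) (v : J -> Calg R) :
  (forall a b, bddc (fun t => x t a b)) ->
  bddc (fun t => qform (x t) v) /\
  ulimc (fun t => qform (x t) v) = qform (fun a b => ulimc (fun t => x t a b)) v.
Proof.
move=> bx.
rewrite (_ : (fun t => qform (x t) v) = fun t =>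
  \sum_a \sum_b (((v a : R[i])^*)%C * (v b : R[i])) * (x t a b : R[i])); last first.
  apply/funext => t; rewrite qformE; apply: eq_bigr => a _; apply: eq_bigr => b _.
  by ring.
have b1 a b : bddc (fun t => (((v a : R[i])^*)%C * (v b : R[i])) * (x t a b : R[i])).
  by apply: bddcM; exact: bx.
have b2 a := ulimc_sum (fun b => b1 a b).
have [b3 e3] := ulimc_sum (fun a => proj1 (b2 a)).
split => //; rewrite e3 qformE; apply: eq_bigr => a _.
rewrite (proj2 (b2 a)); apply: eq_bigr => b _.
by rewrite ulimcM //; ring.
Qed.

Variables (S : opSystem R) (n : nat) (s : T -> state S n).

Lemma state_bddc p q x : bddc (fun t => s t p q x).
Proof.
exists (nrm (val x) * 2) => t.
have := opbnd_entry p q _ (state_bnd (s t) x); apply.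
by rewrite mulr_ge0 // nrm_ge0.
Qed.

Definition st_lim : state S n.
Proof.
refine (@State R S n (fun p q x => ulimc (fun t => s t p q x)) _ _ _).
- move=> p q c x y; rewrite -ulimcM; last exact: state_bddc.
  rewrite -ulimcD; [|by apply: bddcM; exact: state_bddc|exact: state_bddc].
  by congr ulimc; apply/funext => t; rewrite st_lin.
- move=> p q; rewrite -[RHS]ulimc_cst.
  by congr ulimc; apply/funext => t; rewrite st_one.
- move=> k X v pX.
  have [bq eq] := @qform_ulim _ (fun t => stform (s t) X) v
    (fun a b => state_bddc _ _ _).
  rewrite -[qform _ _]eq; apply: ulimc_ge0 => //.
  by apply: filterE => t /=; exact: st_pos.
Defined.

End UltraLimit.

(** * Composition and midpoints of morphisms *)

Section Morphisms.
Variables (R : realType).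
Implicit Types S T V : opSystem R.

Lemma comp_is_linear S T V (g : {linear T -> V}) (f : {linear S -> T}) :
  linear (fun x => g (f x)).
Proof. by move=> c x y; rewrite !linearP. Qed.

Definition lcomp S T V (g : {linear T -> V}) (f : {linear S -> T}) : {linear S -> V} :=
  lin_of (comp_is_linear g f).

Lemma lcompE S T V (g : {linear T -> V}) (f : {linear S -> T}) x : lcomp g f x = g (f x).
Proof. by []. Qed.

Lemma ucp_comp S T V (g : {linear T -> V}) (f : {linear S -> T}) :
  ucp g -> ucp f -> ucp (lcomp g f).
Proof.
move=> [g1 gp] [f1 fp]; split; first by rewrite lcompE f1 g1.
by move=> n X pX; have := gp _ _ (fp _ _ pX); rewrite -map_mx_comp.
Qed.

Lemma id_is_linear S : linear (@id S). Proof. by []. Qed.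
Definition lid S : {linear S -> S} := lin_of (@id_is_linear S).

Lemma ucp_id S : ucp (lid S).
Proof. by split=> // n X; rewrite (_ : map_mx _ X = X) //; apply/matrixP => a b; rewrite mxE. Qed.

Lemma mid_is_linear S T (f g : {linear S -> T}) :
  linear (fun x => (2^-1)%:C *: (f x + g x)).
Proof.
by move=> c x y; rewrite !linearP; lmod R.
Qed.

Definition lmid S T (f g : {linear S -> T}) : {linear S -> T} :=
  lin_of (mid_is_linear f g).

Lemma lmidE S T (f g : {linear S -> T}) x : lmid f g x = (2^-1)%:C *: (f x + g x).
Proof. by []. Qed.

Lemma os_halfD S (x : S) : (2^-1)%:C *: (x + x) = x.
Proof. by lmod R. Qed.

Lemma ucp_mid S T (f g : {linear S -> T}) : ucp f -> ucp g -> ucp (lmid f g).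
Proof.
move=> [f1 fp] [g1 gp]; split; first by rewrite lmidE f1 g1 os_halfD.
move=> n X pX; apply/mx_posP.
have -> : flatS (map_mx (lmid f g) X) =
    (2^-1)%:C *: (flatS (map_mx f X) + flatS (map_mx g X)).
  rewrite /flatS -flatD -flatZ; congr flat; apply/matrixP => a b; rewrite !mxE.
  by [].
apply: cposZ; first by rewrite invr_ge0.
by apply: cposD; apply/mx_posP; [exact: fp | exact: gp].
Qed.

Lemma ucp_bound S T (f : {linear S -> T}) x : ucp f ->
  nrm (val (f x)) <= 2 * nrm (val x).
Proof.
move=> uf; have [h [k [sh sk ex ea]]] := os_adj_decomp x.
have v1 : val x = val h + 'i *: val k by rewrite {1}ex.
have v2 : star (val x) = val h - 'i *: val k.
  by have := congr1 val ea.
have e1 : (2%:R : R)%:C *: val h = val x + star (val x).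
  by rewrite v2 v1 rmorph_nat scaler_nat mulr2n; lmod R.
have e2 : (2%:R : R)%:C *: ('i *: val k) = val x - star (val x).
  by rewrite v2 v1 rmorph_nat scaler_nat mulr2n; lmod R.
have := nrmD (val x) (star (val x)); have := nrmB (val x) (star (val x)).
rewrite -e1 -e2 !nrmZr nrmZi nrm_star ger0_norm // => b2 b1.
have -> : val (f x) = val (f h) + 'i *: val (f k) by rewrite {1}ex linearD linearZ_LR.
have := nrmD (val (f h)) ('i *: val (f k)); rewrite nrmZi.
have := ucp_nrm_sa uf sh; have := ucp_nrm_sa uf sk; lra.
Qed.

Lemma eq_on_sa S T (f g : {linear S -> T}) :
  (forall x, star (val x) = val x -> f x = g x) -> f =1 g.
Proof.
move=> h x; have [y [k [sy sk -> _]]] := os_adj_decomp x.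
by rewrite !linearD !linearZ_LR !h.
Qed.

Variable G : groupoid.
Implicit Types B C D : gsystem R G.

Definition gm_id B : gmorphism B B :=
  @GMorphism R G B B (fun u => lid (B u)) (fun u => ucp_id (B u)) (fun g x => erefl).

Lemma gm_comp_equiv B C D (Psi : gmorphism C D) (Phi : gmorphism B C) g x :
  act D g (lcomp (Psi (dom g)) (Phi (dom g)) x) =
  lcomp (Psi (rng g)) (Phi (rng g)) (act B g x).
Proof. by rewrite !lcompE !gmor_equiv. Qed.

Definition gm_comp B C D (Psi : gmorphism C D) (Phi : gmorphism B C) : gmorphism B D :=
  @GMorphism R G B D (fun u => lcomp (Psi u) (Phi u))
    (fun u => ucp_comp (gmor_ucp Psi u) (gmor_ucp Phi u)) (gm_comp_equiv Psi Phi).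

Lemma gm_mid_equiv B C (Psi Phi : gmorphism B C) g x :
  act C g (lmid (Psi (dom g)) (Phi (dom g)) x) =
  lmid (Psi (rng g)) (Phi (rng g)) (act B g x).
Proof. by rewrite !lmidE linearZ_LR linearD !gmor_equiv. Qed.

Definition gm_mid B C (Psi Phi : gmorphism B C) : gmorphism B C :=
  @GMorphism R G B C (fun u => lmid (Psi u) (Phi u))
    (fun u => ucp_mid (gmor_ucp Psi u) (gmor_ucp Phi u)) (gm_mid_equiv Psi Phi).

End Morphisms.

(** * Minimal morphisms are idempotent *)

Section MinimalMorphism.
Variables (R : realType) (G : groupoid) (A W : gsystem R G) (iota : gmorphism A W).

Record fixm := Fixm {
  fm :> gmorphism W W;
  fm_fix : forall u x, fm u (iota u x) = iota u x
}.

Definition fm_le (P Q : fixm) := forall u (w : W u), star (val w) = val w ->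
  nrm (val (P u w)) <= nrm (val (Q u w)).

(** [fm_le] is only a preorder, so a minimal P has to lie below everything that lies below it. *)
Definition fm_min (P : fixm) := forall Q, fm_le Q P -> fm_le P Q.

Lemma fm_le_trans P Q S : fm_le P Q -> fm_le Q S -> fm_le P S.
Proof. by move=> h1 h2 u w sw; apply: le_trans (h1 u w sw) (h2 u w sw). Qed.

Definition fm_id : fixm := @Fixm (gm_id W) (fun u x => erefl).

Definition fm_comp (P Q : fixm) : fixm.
Proof.
by refine (@Fixm (gm_comp P Q) _) => u x; rewrite /= !fm_fix.
Defined.

Definition fm_mid (P Q : fixm) : fixm.
Proof.
by refine (@Fixm (gm_mid P Q) _) => u x; rewrite [LHS]lmidE !fm_fix os_halfD.
Defined.

Lemma fm_contr (P : fixm) u w : star (val w) = val w -> nrm (val (P u w)) <= nrm (val w).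
Proof. exact: ucp_nrm_sa (gmor_ucp P u). Qed.

Section Idempotent.
Variable P : fixm.
Hypothesis Pmin : fm_min P.

Fixpoint fpow m : fixm := if m is m'.+1 then fm_comp (fpow m') (fpow m') else P.
Fixpoint favg m : fixm :=
  if m is m'.+1 then fm_mid (favg m') (fm_comp (fpow m') (favg m')) else P.

(* [fpow m] is P^(2^m) and [favg m] is the average of P, P^2, ..., P^(2^m). *)
Lemma favg_telescope m u (x : W u) :
  favg m u (x - P u x) = ((2^-1) ^+ m)%:C *: (P u x - fpow m u (P u x)).
Proof.
elim: m => [|m ih]; first by rewrite /= expr0 scale1r linearB.
have -> : favg m.+1 u (x - P u x) = (2^-1)%:C *:
   (favg m u (x - P u x) + fpow m u (favg m u (x - P u x))) by [].
rewrite ih.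
have -> : fpow m.+1 u (P u x) = fpow m u (fpow m u (P u x)) by [].
have -> : fpow m u (((2^-1) ^+ m)%:C *: (P u x - fpow m u (P u x))) =
    ((2^-1) ^+ m)%:C *: (fpow m u (P u x) - fpow m u (fpow m u (P u x))).
  by rewrite linearZ_LR linearB.
by rewrite exprS rmorphM; lmod R.
Qed.

(** Each average is half the sum of the previous one and its image under a power of P, and that
    power is contractive on self-adjoint elements. *)
Lemma favg_le m : fm_le (favg m) P.
Proof.
elim: m => [u w sw //|m ih] u w sw; apply: le_trans (ih u w sw).
have -> : val (favg m.+1 u w) = (2^-1)%:C *:
   (val (favg m u w) + val (fpow m u (favg m u w))) by [].
rewrite nrm_half.
have s2 : star (val (favg m u w)) = val (favg m u w).
  exact: ucp_sa (gmor_ucp _ _) sw.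
have := nrmD (val (favg m u w)) (val (fpow m u (favg m u w))).
have := fm_contr (fpow m) s2; lra.
Qed.

Lemma half_pow_small (e : R) : 0 < e -> exists m, (2^-1) ^+ m <= e :> R.
Proof.
move=> e0; exists (Num.truncn e^-1).+1; set m := (Num.truncn e^-1).+1.
have h : e^-1 < m%:R by exact: truncnS_gt.
have h2 : (m%:R : R) <= 2 ^+ m.
  by rewrite -natrX ler_nat ltnW // ltn_expl.
rewrite exprVn invf_ple ?posrE ?exprn_gt0 //.
exact: ltW (lt_le_trans h h2).
Qed.

Lemma fm_min_idem u x : P u (P u x) = P u x.
Proof.
suff h : lcomp (P u) (P u) =1 P u by exact: h.
apply: eq_on_sa => {}x sx; rewrite lcompE.
have sPx : star (val (P u x)) = val (P u x) by exact: ucp_sa (gmor_ucp _ _) sx.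
have sd : star (val (x - P u x)) = val (x - P u x).
  have -> : val (x - P u x) = val x - val (P u x) by [].
  by rewrite starB sx sPx.
have z0 : P u (x - P u x) = 0.
  (* Minimality bounds |P d|, for d = x - P x, by the norm of the averages at d; the telescoped
     value is 2^-m times a difference of two terms of norm at most |P x|. *)
  apply: val_inj; apply: (@nrm_small _ _ _ (2 * nrm (val (P u x)))) => e e0.
  have [m hm] := half_pow_small e0.
  apply: le_trans (Pmin (@favg_le m) sd) _.
  rewrite favg_telescope.
  have -> : val (((2^-1) ^+ m)%:C *: (P u x - fpow m u (P u x))) =
    ((2^-1) ^+ m)%:C *: (val (P u x) - val (fpow m u (P u x))) by [].
  rewrite nrmZr ger0_norm ?exprn_ge0 ?invr_ge0 //.
  have h1 := nrmB (val (P u x)) (val (fpow m u (P u x))).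
  have h2 := fm_contr (fpow m) sPx.
  rewrite [leRHS]mulrC; apply: ler_pM; rewrite ?nrm_ge0 ?exprn_ge0 ?invr_ge0 //.
  by apply: le_trans h1 _; rewrite mulr_natl mulr2n lerD2l.
by move: z0; rewrite linearB => /eqP; rewrite subr_eq0 => /eqP.
Qed.

End Idempotent.

Lemma fm_min_le P Q : fm_min P -> fm_le Q P -> fm_min Q.
Proof.
move=> Pm QP S SQ; apply: (fm_le_trans QP); apply: Pm.
exact: (fm_le_trans SQ QP).
Qed.

End MinimalMorphism.

(** * Norm bounds along ultrafilters *)

Section DetectedLimit.
Variables (R : realType) (V : opSystem R) (I : Type) (n : I -> nat).
Variable f : forall i, state V (n i).

Definition detects_pos := forall h : V,
  (forall i v, 0 <= qform (fun a b => f i a b h : Calg R) v) -> cpos (val h).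

Lemma state_pos1 k (s : state V k) (h : V) v : cpos (val h) ->
  0 <= qform (fun a b => s a b h : Calg R) v.
Proof.
move=> /mx_pos1 ph; have := st_pos s (fun t => v t.2) ph.
congr (is_true (0 <= _)); rewrite !qformE sum_pair big_ord1; apply: eq_bigr => p _.
by rewrite sum_pair big_ord1; apply: eq_bigr => q _; rewrite /stform /= mxE.
Qed.

Variables (T : Type) (U : set_system T) (UU : UltraFilter U).

(** For self-adjoint z, |z| <= t means that t + z and t - z are positive. The states f detect these
    conditions, which therefore pass to coordinatewise limits: the norm is lower semicontinuous. *)
Lemma ulim_nrm_le (z : T -> V) (z0 : V) (t : R) : detects_pos ->
  (forall i a b, bddc (fun s => f i a b (z s))) ->
  (forall i a b, f i a b z0 = ulimc U (fun s => f i a b (z s))) ->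
  star (val z0) = val z0 -> (forall s, star (val (z s)) = val (z s)) ->
  U [set s | nrm (val (z s)) <= t] -> nrm (val z0) <= t.
Proof.
move=> det bz hz sz0 sz hU; have UP : ProperFilter U := ultra_proper.
have t0 : 0 <= t by have [s hs] := filter_ex hU; exact: le_trans (nrm_ge0 _) hs.
have fE i a b (c : R[i]) y : f i a b (c *: y + t%:C *: os_one V) =
    c * f i a b y + f i a b (t%:C *: os_one V) by exact: st_lin.
(* Used with c = 1 and c = -1. *)
have key (c : R[i]) : U [set s | cpos (val (c *: z s + t%:C *: os_one V))] ->
  cpos (val (c *: z0 + t%:C *: os_one V)).
  move=> hc; apply: det => i v.
  have bx a b : bddc (fun s => f i a b (c *: z s + t%:C *: os_one V)).
    rewrite (_ : (fun s => _) = fun s => c * f i a b (z s) + f i a b (t%:C *: os_one V)).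
      by apply: bddcD; [apply: bddcM; exact: bz | exact: bddc_cst].
    by apply/funext => s; exact: fE.
  have [bq eq] := qform_ulim UU (x := fun s a b =>
    f i a b (c *: z s + t%:C *: os_one V)) v bx.
  have -> : (fun a b => f i a b (c *: z0 + t%:C *: os_one V) : Calg R) =
      (fun a b => ulimc U (fun s => f i a b (c *: z s + t%:C *: os_one V))).
    apply/funext => a; apply/funext => b; rewrite fE hz -(ulimcM UU); last exact: bz.
    rewrite -[X in _ + X](ulimc_cst UU) -(ulimcD UU); last 2 first.
    - by apply: bddcM; exact: bz.
    - exact: bddc_cst.
    by congr (ulimc U _); apply/funext => s; rewrite fE.
  rewrite -eq; apply: (ulimc_ge0 UU bq).
  by apply: filterS hc => s hs; exact: state_pos1.
have vE (c : R[i]) (y : V) : val (c *: y + t%:C *: os_one V) =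
  c *: val y + t%:C *: (1 : ambient V) by [].
have p1 s : nrm (val (z s)) <= t -> cpos (val (-1 *: z s + t%:C *: os_one V)).
  by move=> hs; rewrite vE scaleN1r addrC; exact: cpos_subl (sz s) hs.
have p2 s : nrm (val (z s)) <= t -> cpos (val (1 *: z s + t%:C *: os_one V)).
  move=> hs; rewrite vE scale1r addrC -[val (z s)]opprK.
  by apply: cpos_subl; rewrite ?nrmN // starN sz.
apply: (nrm_le_pm t0 sz0).
- have := key (- 1) (@filterS _ U _ _ _ p1 hU); rewrite vE scaleN1r addrC; exact.
- have := key 1 (@filterS _ U _ _ _ p2 hU); rewrite vE scale1r addrC; exact.
Qed.

Lemma ulim_ucp_nrm_le (L : {linear V -> V}) (P : T -> {linear V -> V}) (w : V) (t : R) :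
  detects_pos -> (forall i a b, bddc (fun s => f i a b (P s w))) ->
  (forall i a b, f i a b (L w) = ulimc U (fun s => f i a b (P s w))) ->
  ucp L -> (forall s, ucp (P s)) -> star (val w) = val w ->
  U [set s | nrm (val (P s w)) <= t] -> nrm (val (L w)) <= t.
Proof.
move=> det bz hz uL uP sw hU.
exact: (ulim_nrm_le det bz hz (ucp_sa uL sw) (fun s => ucp_sa (uP s) sw) hU).
Qed.

End DetectedLimit.

Section FullSystemDetects.
Variables (R : realType) (I : Type) (n : I -> nat).

Lemma full_detects : detects_pos (@compstate R I n).
Proof.
move=> h hf.
apply/(rep_pos (rho := fun (z : falg (Calg R) (fun i => 'I_(n i) : finType)) i => ent z i)).
- by [].
- by [].
- by move=> y i a b; exact: entN.
- by move=> y y'; exact: falg_eq.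
- exact: hf.
Qed.

End FullSystemDetects.

(** What Zorn's lemma needs from a limit: by the first clause it fixes A again, by the second it is
    a lower bound. *)
Definition has_limits (R : realType) (G : groupoid) (W : gsystem R G) :=
  forall (T : Type) (U : set_system T), UltraFilter U ->
  forall P : T -> gmorphism W W, exists L : gmorphism W W, forall u (w : W u),
    (forall w', (forall s, P s u w = w') -> L u w = w') /\
    forall t, star (val w) = val w ->
      U [set s | nrm (val (P s u w)) <= t] -> nrm (val (L u w)) <= t.

Section CofreeLimits.
Variables (R : realType) (G : groupoid) (A : gsystem R G).
Local Notation W := (wsys A).
Variables (T : Type) (U : set_system T) (UU : UltraFilter U).
Variable P : T -> gmorphism W W.

Definition lim_map u : {linear W u -> W u} :=
  wmap (fun k j (r : rng k = u) (d : dom k = tag j) =>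
    st_lim UU (fun s => st_pull (gmor_ucp (P s) u) (wstate r d))).

Lemma lim_mapE u w k j (r : rng k = u) (d : dom k = tag j) p q :
  wcoord (lim_map u w) r d p q = ulimc U (fun s => wcoord (P s u w) r d p q).
Proof. by []. Qed.

Lemma lim_equiv g (w : W (dom g)) :
  act W g (lim_map (dom g) w) = lim_map (rng g) (act W g w).
Proof.
apply: wfib_eq => k j r d p q; rewrite [LHS]wmapE wstateE !lim_mapE.
congr (ulimc U _); apply/funext => s.
by rewrite -gmor_equiv [RHS]wmapE wstateE.
Qed.

Definition lim_gm : gmorphism W W :=
  @GMorphism R G W W lim_map (fun u => wmap_ucp _) lim_equiv.

Lemma lim_cst u (w w' : W u) : (forall s, P s u w = w') -> lim_gm u w = w'.
Proof.
move=> h; apply: wfib_eq => k j r d p q; rewrite lim_mapE -[RHS](ulimc_cst UU).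
by congr (ulimc U _); apply/funext => s; rewrite h.
Qed.

Lemma lim_nrm u (w : W u) t : star (val w) = val w ->
  U [set s | nrm (val (P s u w)) <= t] -> nrm (val (lim_gm u w)) <= t.
Proof.
move=> sw hU.
pose f : forall i : idx A u, state (W u) (ix_n i) :=
  @compstate R (idx A u) (fun i => ix_n i).
have det : detects_pos f by exact: full_detects.
have bz i a b : bddc (fun s => f i a b (P s u w)).
  exact: (state_bddc (fun s => st_pull (gmor_ucp (P s) u) (f i)) a b w).
have hz i a b : f i a b (lim_gm u w) = ulimc U (fun s => f i a b (P s u w)).
  by case: i a b => [k j r d] a b.
exact: (@ulim_ucp_nrm_le R (W u) (idx A u) _ f T U UU (lim_gm u) (fun s => P s u) w t
  det bz hz (gmor_ucp lim_gm u) (fun s => gmor_ucp (P s) u) sw hU).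
Qed.

End CofreeLimits.

Lemma wsys_limits (R : realType) (G : groupoid) (A : gsystem R G) :
  has_limits (wsys A).
Proof.
move=> T U UU P; exists (lim_gm UU P) => u w; split.
  exact: lim_cst.
exact: lim_nrm.
Qed.

Section MinimalExists.
Variables (R : realType) (G : groupoid) (A W : gsystem R G) (iota : gmorphism A W).
Hypothesis Wlim : has_limits W.
Local Notation fixm := (fixm iota).

Lemma fm_min_exists : exists P : fixm, fm_min P.
Proof.
(* The order is reversed, since Zorn's lemma delivers maximal elements. *)
pose le (P Q : fixm) : bool := `[< fm_le Q P >].
have [|P Q S /asboolP h1 /asboolP h2|C Ctot|P Pm] := ZL_preorder (fm_id iota) (R := le).
- by move=> P; apply/asboolP => u w _.
- by apply/asboolP; exact: (fm_le_trans h2 h1).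
- have [[P0 CP0]|nC] := pselect (exists P, C P); last first.
    by exists (fm_id iota) => P CP; case: nC; exists P.
  (* The tails of the chain form a filter base; the limit along an ultrafilter containing them lies
     below every member of the chain. *)
  pose B (P : fixm) : set fixm := [set Q | C Q /\ fm_le Q P].
  have FF : ProperFilter (filter_from C B).
    apply: filter_from_proper; last by move=> P CP; exists P; split => // u w _.
    apply: filter_from_filter; first by exists P0.
    move=> P Q CP CQ; have [/asboolP h|/asboolP h] := Ctot _ _ CP CQ.
      exists Q => // S [CS SQ]; split; split => //; exact: (fm_le_trans SQ h).
    exists P => // S [CS SP]; split; split => //; exact: (fm_le_trans SP h).
  have [U [UU FU]] := ultraFilterLemma FF.
  have UP : ProperFilter U := ultra_proper.
  have [L hL] := Wlim UU (fun P : fixm => P : gmorphism W W).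
  have Lfix u x : L u (iota u x) = iota u x.
    by apply: (hL u (iota u x)).1 => s; exact: fm_fix.
  exists (Fixm Lfix) => P CP; apply/asboolP => u w sw.
  have UC : U [set Q | fm_le Q P] by apply: FU; exists P => // Q [].
  by apply: (hL u w).2 => //; apply: filterS UC => Q h; exact: h.
- exists P => Q QP; apply/asboolP; apply: Pm; exact/asboolP.
Qed.

End MinimalExists.

(** * The envelope *)

Section ImageSystem.
Variables (R : realType) (S : opSystem R) (P : {linear S -> S}).
Hypotheses (Pucp : ucp P) (PP : forall x, P (P x) = P x).

Definition img_pred : {pred ambient S} :=
  fun a => `[< exists2 w : S, val w = a & P w = w >].

Lemma img_predP a : reflect (exists2 w : S, val w = a & P w = w) (a \in img_pred).
Proof. exact: asboolP. Qed.

Lemma img_submod : submod_closed img_pred.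
Proof.
split; first by apply/img_predP; exists 0; rewrite ?linear0.
move=> c _ _ /img_predP[x <- Px] /img_predP[y <- Py]; apply/img_predP.
by exists (c *: x + y); rewrite ?linearP ?Px ?Py.
Qed.

Lemma img_star : {in img_pred, forall a, star a \in img_pred}.
Proof.
move=> _ /img_predP[x <- Px]; apply/img_predP.
by exists (os_adj x); rewrite ?ucp_star ?Px.
Qed.

Lemma img_unit : 1 \in img_pred.
Proof. by apply/img_predP; exists (os_one S); rewrite ?ucp_one. Qed.

(** The fixed points of a bounded map form a closed set. For a fixed y near w, P w - w = P (w - y) -
    (w - y); the constant 3 is the 2 of [ucp_bound] plus 1. *)
Lemma img_closed : closed [set a | a \in img_pred].
Proof.
move=> a ca.
have aS : a \in @os_pred R S.
  apply: os_closed; apply: closure_subset ca => b /img_predP[w <- _].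
  exact: valP.
pose w : S := exist _ a aS; apply/img_predP; exists w => //.
apply/eqP; rewrite -subr_eq0; apply/eqP; apply: val_inj.
apply: (@nrm_small _ _ _ 3) => e e0.
have ec0 : 0 < e%:C by rewrite ltcR.
have [b [/img_predP[y vy Py]]] := ca _ (nbhsx_ballx a e%:C ec0).
rewrite -ball_normE -vy => hb.
have h : nrm (a - val y) <= e by apply: ltW; move: hb; rewrite /ball_ /= nrmE ltcR.
have -> : P w - w = P (w - y) - (w - y) by rewrite linearB Py opprB addrA subrK.
have vwy : val (w - y) = a - val y by [].
have -> : val (P (w - y) - (w - y)) = val (P (w - y)) - val (w - y) by [].
have := nrmB (val (P (w - y))) (val (w - y)).
have := ucp_bound (w - y) Pucp; rewrite vwy; lra.
Qed.

Definition img : opSystem R := OpSystem img_submod img_star img_unit img_closed.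

Lemma img_incl_subproof (x : img) : val x \in @os_pred R S.
Proof. by have /img_predP[w <- _] := valP x; exact: valP. Qed.

Definition img_incl_fun (x : img) : S := exist _ (val x) (img_incl_subproof x).

Lemma img_incl_linear : linear img_incl_fun.
Proof. by move=> c x y; apply: val_inj. Qed.

Definition img_incl : {linear img -> S} := lin_of img_incl_linear.

Lemma img_retr_subproof (x : S) : val (P x) \in img_pred.
Proof. by apply/img_predP; exists (P x). Qed.

Definition img_retr_fun (x : S) : img := exist _ (val (P x)) (img_retr_subproof x).

Lemma img_retr_linear : linear img_retr_fun.
Proof. by move=> c x y; apply: val_inj; rewrite /= linearP. Qed.

Definition img_retr : {linear S -> img} := lin_of img_retr_linear.

Lemma img_retrE x : val (img_retr x) = val (P x). Proof. by []. Qed.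

Lemma img_inclK x : P (img_incl x) = img_incl x.
Proof.
have /img_predP[w vw Pw] := valP x.
by have -> : img_incl x = w by apply: val_inj; rewrite vw.
Qed.

Lemma img_retr_incl : cancel img_incl img_retr.
Proof. by move=> x; apply: val_inj; rewrite img_retrE img_inclK. Qed.

Lemma img_incl_retr x : img_incl (img_retr x) = P x.
Proof. exact: val_inj. Qed.

Lemma img_incl_pos n (X : 'M[img]_n) : mx_pos (map_mx img_incl X) <-> mx_pos X.
Proof.
by split=> -[Y h]; exists Y; rewrite -h -map_mx_comp; apply/matrixP => a b; rewrite !mxE.
Qed.

Lemma img_incl_ucp : ucp img_incl.
Proof.
split; first exact: val_inj.
by move=> n X /img_incl_pos.
Qed.

Lemma img_retr_ucp : ucp img_retr.
Proof.
split; first by apply: val_inj; rewrite img_retrE ucp_one.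
move=> n X pX; apply/img_incl_pos; have := Pucp.2 _ _ pX.
by congr mx_pos; apply/matrixP => a b; rewrite !mxE img_incl_retr.
Qed.

End ImageSystem.

Section ActionInverse.
Variables (R : realType) (G : groupoid) (B : gsystem R G) (g : G).

Lemma act_invK (x : B (dom g)) : actc B (dom_inv g) (rng_inv g) (act B g x) = x.
Proof.
rewrite -[act B g x]/(actc B erefl erefl x).
rewrite -(actc_mul _ _ _ _ (dom_unit (dom g)) (rng_unit (dom g))).
exact: (@actc_unit R G B (dom g)).
Qed.

Lemma act_Kinv (y : B (rng g)) : act B g (actc B (dom_inv g) (rng_inv g) y) = y.
Proof.
rewrite -[LHS]/(actc B erefl erefl (actc B (dom_inv g) (rng_inv g) y)).
rewrite -(actc_mul _ _ _ _ (dom_unit (rng g)) (rng_unit (rng g))).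
exact: (@actc_unit R G B (rng g)).
Qed.

End ActionInverse.

Section ImageGSystem.
Variables (R : realType) (G : groupoid) (W : gsystem R G) (P : gmorphism W W).
Hypothesis PP : forall u x, P u (P u x) = P u x.

Definition ifib u : opSystem R := img (gmor_ucp P u).

Definition iincl u : {linear ifib u -> W u} := img_incl (gmor_ucp P u).

Definition iretr u : {linear W u -> ifib u} := img_retr (gmor_ucp P u) (@PP u).

Lemma iinclK u x : P u (iincl u x) = iincl u x. Proof. exact: img_inclK. Qed.

Lemma iretr_incl u : cancel (iincl u) (iretr u). Proof. exact: img_retr_incl. Qed.

Lemma iincl_retr u x : iincl u (iretr u x) = P u x. Proof. exact: img_incl_retr. Qed.

Lemma iincl_inj u : injective (iincl u). Proof. exact: can_inj (@iretr_incl u). Qed.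

Lemma iincl_ucp u : ucp (iincl u). Proof. exact: img_incl_ucp. Qed.

Lemma iretr_ucp u : ucp (iretr u). Proof. exact: img_retr_ucp. Qed.

Definition iact g : {linear ifib (dom g) -> ifib (rng g)} :=
  lcomp (iretr (rng g)) (lcomp (act W g) (iincl (dom g))).

Definition iact_inv g : {linear ifib (rng g) -> ifib (dom g)} :=
  lcomp (iretr (dom g)) (lcomp (actc W (dom_inv g) (rng_inv g)) (iincl (rng g))).

(** P commutes with the action, so the retraction inside [iact] changes nothing. *)
Lemma iincl_act g x : iincl (rng g) (iact g x) = act W g (iincl (dom g) x).
Proof. by rewrite [LHS]iincl_retr lcompE -gmor_equiv iinclK. Qed.

Lemma iincl_act_inv g x :
  iincl (dom g) (iact_inv g x) = actc W (dom_inv g) (rng_inv g) (iincl (rng g) x).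
Proof. by rewrite [LHS]iincl_retr lcompE -gmor_actc iinclK. Qed.

Lemma iact_iso g : complete_order_iso (iact g).
Proof.
have [ua _] := act_iso W g.
split; first by apply: ucp_comp; [exact: iretr_ucp | apply: ucp_comp ua (iincl_ucp _)].
exists (iact_inv g); split.
- apply: ucp_comp; first exact: iretr_ucp.
  exact: ucp_comp (actc_ucp _ _ _) (iincl_ucp _).
- by move=> x; apply: iincl_inj; rewrite iincl_act_inv iincl_act act_invK.
- by move=> x; apply: iincl_inj; rewrite iincl_act iincl_act_inv act_Kinv.
Qed.

Lemma iincl_cast u v (e : u = v) (x : ifib u) :
  iincl v (fib_cast e x) = fib_cast e (iincl u x).
Proof. by destruct e. Qed.

Lemma iact_mul g h (e : dom g = rng h) (x : ifib (dom (gmul g h))) :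
  fib_cast (rng_mul e) (iact (gmul g h) x) =
  iact g (fib_cast (esym e) (iact h (fib_cast (dom_mul e) x))).
Proof.
apply: iincl_inj; rewrite iincl_cast !iincl_act iincl_cast iincl_act iincl_cast.
exact: act_mul.
Qed.

Definition isys : gsystem R G := GSystem iact_iso iact_mul.

Definition iemb : gmorphism isys W :=
  @GMorphism R G isys W iincl iincl_ucp (fun g x => esym (iincl_act x)).

Lemma iretr_equiv g (x : W (dom g)) :
  act isys g (iretr (dom g) x) = iretr (rng g) (act W g x).
Proof.
by apply: iincl_inj; rewrite [LHS]iincl_act !iincl_retr gmor_equiv.
Qed.

Definition iret : gmorphism W isys :=
  @GMorphism R G W isys iretr iretr_ucp iretr_equiv.

(** The image is an equivariant retract of W: a morphism is extended into W and then retracted. *)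
Lemma isys_injective : g_injective W -> g_injective isys.
Proof.
move=> Winj B C Phi Psi Phi_inj.
have [Xi h] := Winj B C Phi (gm_comp iemb Psi) Phi_inj.
exists (gm_comp iret Xi) => u x.
rewrite [LHS]lcompE h; exact: iretr_incl.
Qed.

End ImageGSystem.

(** * Rigidity and uniqueness of the envelope *)

Section Envelope.
Variables (R : realType) (G : groupoid) (A W : gsystem R G) (iota : gmorphism A W).
Hypotheses (Winj : g_injective W) (iota_inj : g_injection iota).
Variables (P : fixm iota) (Pmin : fm_min P).

Let PP := fm_min_idem Pmin.
Let env := isys PP.

Definition env_emb : gmorphism A env := gm_comp (iret PP) iota.

Lemma iemb_env u x : iemb PP u (env_emb u x) = iota u x.
Proof. by rewrite [LHS]iincl_retr fm_fix. Qed.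

Lemma env_emb_injection : g_injection env_emb.
Proof.
move=> u; have [_ inj pos] := iota_inj u; split; first exact: gmor_ucp.
  move=> x y /(congr1 (iemb PP u)); rewrite !iemb_env; exact: inj.
move=> n X /(gmor_ucp (iemb PP) u).2 pX; apply: pos; move: pX.
by congr mx_pos; apply/matrixP => a b; rewrite !mxE iemb_env.
Qed.

Lemma env_rigid : g_rigid env_emb.
Proof.
move=> Phi hPhi u.
have Qfix v x : gm_comp (iemb PP) (gm_comp Phi (iret PP)) v (iota v x) = iota v x.
  by rewrite [LHS]lcompE lcompE -{2}(iemb_env x) -(hPhi v x).
pose Q : fixm iota := Fixm Qfix.
have QE v w : Q v w = iemb PP v (Phi v (iret PP v w)) by [].
(* Q applies Phi after P, up to the inclusion, and Phi is contractive on self-adjoint elements. *)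
have QP : fm_le Q P.
  move=> v w sw.
  have sP : star (val (iret PP v w)) = val (iret PP v w).
    exact: ucp_sa (gmor_ucp _ _) sw.
  exact: (ucp_nrm_sa (gmor_ucp Phi v) sP).
have Qmin := fm_min_le Pmin QP.
suff h : Phi u =1 lid (env u) by exact: h.
apply: eq_on_sa => x sx.
apply: (@iincl_inj _ _ _ _ PP).
have sPx : star (val (Phi u x)) = val (Phi u x) by exact: ucp_sa (gmor_ucp _ _) sx.
pose y := iemb PP u x; pose z := Q u y - y.
have rx : iret PP u y = x by exact: iretr_incl.
have Qy : Q u y = iemb PP u (Phi u x) by rewrite QE rx.
(* z lies in the image of P and, Q being idempotent, in the kernel of Q; minimality of P then gives
   |z| = |P z| <= |Q z| = 0. *)
have Pz : P u z = z.
  have PK t : P u (iemb PP u t) = iemb PP u t by exact: (@iinclK R G W P u t).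
  by rewrite /z Qy linearB !PK.
have Qz : Q u z = 0.
  by rewrite linearB (fm_min_idem Qmin) subrr.
have sz : star (val z) = val z.
  have -> : val z = val (Phi u x) - val x by rewrite /z Qy.
  by rewrite starB sx sPx.
have z0 : z = 0.
  apply: val_inj; apply: nrm_le0.
  rewrite -[leRHS](nrm0 (ambient (W u))) -[X in nrm X <= _](congr1 val Pz).
  by rewrite -[X in _ <= nrm X](congr1 val Qz); exact: Pmin.
by move: z0 => /eqP; rewrite subr_eq0 Qy => /eqP.
Qed.

Lemma env_injective_envelope : g_injective_envelope env_emb.
Proof.
split; [exact: env_emb_injection | exact: isys_injective | exact: env_rigid].
Qed.

End Envelope.

(** Injectivity extends each embedding along the other; both composites fix A, so rigidity makes
    them identities. *)
Lemma envelope_unique (R : realType) (G : groupoid) (A W W' : gsystem R G)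
    (Theta : gmorphism A W) (Theta' : gmorphism A W') :
  g_injective_envelope Theta -> g_injective_envelope Theta' -> g_isomorphic W W'.
Proof.
move=> [inj Winj rig] [inj' Winj' rig'].
have [Phi hPhi] := Winj' _ _ Theta Theta' inj.
have [Psi hPsi] := Winj _ _ Theta' Theta inj'.
exists Phi => u; split; first exact: gmor_ucp.
exists (Psi u); split; first exact: gmor_ucp.
  by apply: (rig (gm_comp Psi Phi)) => v x; rewrite [LHS]lcompE hPhi hPsi.
by apply: (rig' (gm_comp Phi Psi)) => v x; rewrite [LHS]lcompE hPsi hPhi.
Qed.

Theorem theorem3p11 (R : realType) (G : groupoid) (A : gsystem R G) :
  (exists (W : gsystem R G) (Upsilon : gmorphism A W),
     g_injective_envelope Upsilon) /\
  (forall (W W' : gsystem R G)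
          (Theta : gmorphism A W) (Theta' : gmorphism A W'),
     g_injective_envelope Theta -> g_injective_envelope Theta' ->
     g_isomorphic W W').
Proof.
split; last by move=> W W' Theta Theta'; exact: envelope_unique.
have [P Pmin] := fm_min_exists (wemb A) (@wsys_limits R G A).
exists (isys (fm_min_idem Pmin)), (env_emb Pmin).
exact: (env_injective_envelope (@wsys_injective R G A) (@wemb_injection R G A) Pmin).
Qed.
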